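(* Let $G=\operatorname{Aut}(\mathbf{Q},<)$ be the group of order-preserving bijections of $\mathbf{Q}$, and let $G\wr G$ be the wreath product, regarded as an oligomorphic group via its action on $\mathbf{Q}\times\mathbf{Q}$. Then $G\wr G$ admits a regular ($\mathbf{Z}$-valued) measure $\mu$ such that, for any field $k$, the category $\underline{\mathrm{Rep}}_k(G\wr G;\mu)$ is a semi-simple pre-Tannakian category.
   Context: Wreath product: $H=G\wr G$ is the group of permutations of $\mathbf{Q}\times\mathbf{Q}$ of the form $(a,b)\mapsto(g(a),h_a(b))$, with $g\in G$ and $h_a\in G$ for each $a\in\mathbf{Q}$. It is oligomorphic: it has finitely many orbits on $(\mathbf{Q}\times\mathbf{Q})^n$ for every $n$. A subgroup of $H$ is called open if it contains the pointwise stabilizer of some finite subset of $\mathbf{Q}\times\mathbf{Q}$. In what follows, all $H$-sets are assumed to have open stabilizers. An $H$-set is finitary if it has finitely many orbits. Products and fiber products of finitary $H$-sets are finitary. Measures: a measure for $H$ valued in a commutative ring $k$ is a rule $\mu$ assigning to each map $f\colon Y\to X$ of transitive $H$-sets a value $\mu(f)\in k$ such that: (a) $\mu(f)=1$ if $f$ is an isomorphism; (b) $\mu(g\circ f)=\mu(g)\mu(f)$ when defined; (c) if $f\colon Y\to X$ and $X'\to X$ are maps of transitive $H$-sets, and $Y'_1,\dots,Y'_n$ are the orbits of $H$ on $Y\times_X X'$ with projections $f'_i\colon Y'_i\to X'$, then $\mu(f)=\sum_{i=1}^n\mu(f'_i)$. The measure $\mu$ is regular if $\mu(f)$ is a unit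 of $k$ for every $f$. A $\mathbf{Z}$-valued measure is regarded as valued in any field $k$ via $\mathbf{Z}\to k$, and a regular $\mathbf{Z}$-valued measure stays regular. The category: let $\mu$ be a $k$-valued measure, with $k$ a field. For a map $f\colon X\to Y$ of finitary $H$-sets and an $H$-invariant function $\varphi\colon X\to k$, let $f_*\varphi\colon Y\to k$ be the $H$-invariant function whose value on an orbit $O\subset Y$ is $\sum_{O'}\varphi(O')\,\mu(O'\to O)$, the sum being over the orbits $O'$ in $f^{-1}(O)$. The category $\underline{\mathrm{Perm}}_k(H;\mu)$ has one object $\mathrm{Vec}_X$ for each finitary $H$-set $X$. Morphisms $\mathrm{Vec}_X\to\mathrm{Vec}_Y$ are $H$-invariant functions $Y\times X\to k$ (''matrices''). The composition of $A\colon\mathrm{Vec}_X\to\mathrm{Vec}_Y$ and $B\colon\mathrm{Vec}_Y\to\mathrm{Vec}_Z$ is $BA=p_*\big(B(z,y)A(y,x)\big)$, where $p\colon Z\times Y\times X\to Z\times X$ is the projection. The symmetric tensor product is $\mathrm{Vec}_X\otimes\mathrm{Vec}_Y=\mathrm{Vec}_{X\times Y}$, with the Kronecker product of matrices on morphisms and the symmetry given by swapping factors. Here $\underline{\mathrm{Rep}}_k(H;\mu)$ denotes the Karoubi (idempotent) completion of $\underline{\mathrm{Perm}}_k(H;\mu)$. A pre-Tannakian category over $k$ is a $k$-linear abelian symmetric monoidal category with $k$-bilinear tensor product in which all objects have finite length, all Hom spaces are finite dimensional over $k$, every object is rigid (has a dual), and $\operatorname{End}(\mathbf{1})=k$. It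 is semi-simple if every object is a finite direct sum of simple objects. *)

(* Defs.v *)
From HB Require Import structures.
From mathcomp Require Import all_boot all_order all_algebra.
From mathcomp Require Import boolp classical_sets functions cardinality fsbigop.
From mathcomp Require Import ring lra.

Set Implicit Arguments.
Unset Strict Implicit.
Unset Printing Implicit Defensive.

Import Order.TTheory GRing.Theory Num.Theory.
Local Open Scope classical_set_scope.
Local Open Scope ring_scope.

#[local] Obligation Tactic := idtac.

(** * Permutation groups and their smooth sets *)

Record permGroup := PermGroup {
  pgrp :> groupType;
  pdom : choiceType;
  pact : pgrp -> pdom -> pdom;
  pact1 : forall w, pact 1%g w = w;
  pactM : forall g h w, pact (g * h)%g w = pact g (pact h w);
  pact_faithful : forall g h, (forall w, pact g w = pact h w) -> g = h }.

(** [hopen] says that the stabilizer of every point is open, i.e. that it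
    contains the pointwise stabilizer of a finite subset of [pdom H]. *)
Record hset (H : permGroup) := HSet {
  hcar :> Type;
  hact : H -> hcar -> hcar;
  hact1 : forall x, hact 1%g x = x;
  hactM : forall g h x, hact (g * h)%g x = hact g (hact h x);
  hopen : forall x, exists A : seq (pdom H), forall g,
    {in A, forall w, pact g w = w} -> hact g x = x }.

Record hmap (H : permGroup) (X Y : hset H) := HMap {
  hfun :> X -> Y;
  hfunP : forall g x, hfun (hact g x) = hact g (hfun x) }.

Section HSets.
Variable H : permGroup.
Implicit Types X Y Z : hset H.

Lemma hactK X (g : H) : cancel (@hact H X g) (hact g^-1%g).
Proof. by move=> x; rewrite -hactM mulVg hact1. Qed.

Lemma hactVK X (g : H) : cancel (@hact H X g^-1%g) (hact g).
Proof. by move=> x; rewrite -hactM mulgV hact1. Qed.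

Lemma pactK (g : H) : cancel (@pact H g) (pact g^-1%g).
Proof. by move=> x; rewrite -pactM mulVg pact1. Qed.

Lemma pactVK (g : H) : cancel (@pact H g^-1%g) (pact g).
Proof. by move=> x; rewrite -pactM mulgV pact1. Qed.

Definition hmap_id X : hmap X X := @HMap H X X id (fun g x => erefl).

Program Definition hmap_comp X Y Z (g : hmap Y Z) (f : hmap X Y) : hmap X Z :=
  @HMap H X Z (g \o f) _.
Next Obligation. by move=> X Y Z g f h x /=; rewrite !hfunP. Qed.

Definition hiso X Y (f : hmap X Y) : Prop :=
  exists g : hmap Y X, cancel f g /\ cancel g f.

Definition orb X (x : X) : set X := [set y | exists g : H, y = hact g x].

Lemma orb_refl X (x : X) : orb x x.
Proof. by exists 1%g; rewrite hact1. Qed.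

Lemma orb_eq X (x y : X) : orb x y -> orb x = orb y.
Proof.
case=> g ->; apply/seteqP; split=> z /= [h ->].
  by exists (h * g^-1)%g; rewrite hactM hactK.
by exists (h * g)%g; rewrite hactM.
Qed.

Record orbit X := Orbit {
  oset :> set X;
  orbitP : exists x, oset = orb x }.

HB.instance Definition _ X := gen_eqMixin (orbit X).
HB.instance Definition _ X := gen_choiceMixin (orbit X).

Definition orbit_of X (x : X) : orbit X := @Orbit X (orb x) (ex_intro _ x erefl).

Definition orepr X (O : orbit X) : X := projT1 (cid (orbitP O)).

Lemma orbit_inj X (O O' : orbit X) : oset O = oset O' -> O = O'.
Proof.
case: O O' => [O PO] [O' PO'] /= e; case: _ / e PO' => PO'.
by congr Orbit; apply: Prop_irrelevance.
Qed.

Lemma oreprE X (O : orbit X) : oset O = orb (orepr O).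
Proof. by rewrite /orepr; case: cid. Qed.

Lemma orbit_of_hact X (g : H) (x : X) : orbit_of (hact g x) = orbit_of x.
Proof. by apply: orbit_inj => /=; symmetry; apply: orb_eq; exists g. Qed.

Definition finitary X : Prop := finite_set [set: orbit X].

Definition htransitive X : Prop := exists x : X, forall y, orb x y.

(** ** Constructions *)

Program Definition hpt : hset H :=
  @HSet H unit (fun _ x => x) (fun _ => erefl) (fun _ _ _ => erefl) _.
Next Obligation. by move=> x; exists [::]. Qed.

Program Definition hprod X Y : hset H :=
  @HSet H (X * Y)%type (fun g p => (hact g p.1, hact g p.2)) _ _ _.
Next Obligation. by move=> X Y [x y] /=; rewrite !hact1. Qed.
Next Obligation. by move=> X Y g h [x y] /=; rewrite !hactM. Qed.
Next Obligation.
move=> X Y [x y] /=; have [A hA] := hopen x; have [B hB] := hopen y.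
exists (A ++ B) => g hg; rewrite hA ?hB // => w wA; apply: hg;
by rewrite mem_cat wA ?orbT.
Qed.

Definition hstable X (A : set X) : Prop := forall g x, A x -> A (hact g x).

Program Definition hsub X (A : set X) (AP : hstable A) : hset H :=
  @HSet H {x : X | A x}
    (fun g x => exist _ (hact g (sval x)) (AP g _ (svalP x))) _ _ _.
Next Obligation. by move=> X A AP [x Ax]; apply: eq_exist; rewrite /= hact1. Qed.
Next Obligation. by move=> X A AP g h [x Ax]; apply: eq_exist; rewrite /= hactM. Qed.
Next Obligation.
move=> X A AP [x Ax] /=; have [B hB] := hopen x; exists B => g hg.
by apply: eq_exist => /=; apply: hB.
Qed.

Definition hincl X (A : set X) (AP : hstable A) : hmap (hsub AP) X :=
  @HMap H (hsub AP) X sval (fun g x => erefl).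

Definition hfst X Y : hmap (hprod X Y) X :=
  @HMap H (hprod X Y) X fst (fun g x => erefl).
Definition hsnd X Y : hmap (hprod X Y) Y :=
  @HMap H (hprod X Y) Y snd (fun g x => erefl).

Program Definition hpair Z X Y (f : hmap Z X) (g : hmap Z Y) :
    hmap Z (hprod X Y) :=
  @HMap H Z (hprod X Y) (fun z => (f z, g z)) _.
Next Obligation. by move=> Z X Y f g h z /=; rewrite !hfunP. Qed.

Lemma fib_stable X Y Z (f : hmap Y X) (g : hmap Z X) :
  hstable ([set p | f p.1 = g p.2] : set (hprod Y Z)).
Proof. by move=> h [y z] /= e; rewrite !hfunP e. Qed.

Definition hfib X Y Z (f : hmap Y X) (g : hmap Z X) : hset H :=
  hsub (@fib_stable X Y Z f g).

Definition hfib_snd X Y Z (f : hmap Y X) (g : hmap Z X) : hmap (hfib f g) Z :=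
  hmap_comp (hsnd Y Z) (hincl _).

Program Definition hpow (n : nat) : hset H :=
  @HSet H (n.-tuple (pdom H)) (fun g t => map_tuple (pact g) t) _ _ _.
Next Obligation.
by move=> n t; apply: val_inj => /=; rewrite -[RHS]map_id; apply: eq_map => w;
   rewrite pact1.
Qed.
Next Obligation.
by move=> n g h t; apply: val_inj => /=; rewrite -map_comp; apply: eq_map => w;
   rewrite /= pactM.
Qed.
Next Obligation.
by move=> n t; exists t => g hg; apply: val_inj => /=; apply: map_id_in.
Qed.

(** ** Orbits as transitive sets *)

Record thset := THSet {
  th_hset :> hset H;
  thP : htransitive th_hset }.

Lemma orbit_stable X (O : orbit X) : hstable (oset O).
Proof.
move=> g x; rewrite oreprE => -[h ->].
by exists (g * h)%g; rewrite hactM.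
Qed.

Lemma orbit_transitive X (O : orbit X) : htransitive (hsub (@orbit_stable X O)).
Proof.
have Or : oset O (orepr O) by rewrite oreprE; apply: orb_refl.
exists (exist _ (orepr O) Or) => -[y Oy].
have := Oy; rewrite {1}oreprE => -[g yg].
by exists g; apply: eq_exist.
Qed.

Definition orbit_th X (O : orbit X) : thset := THSet (@orbit_transitive X O).

Definition orbit_incl X (O : orbit X) : hmap (orbit_th O) X :=
  hincl (@orbit_stable X O).

Lemma orbit_imageP X Y (f : hmap X Y) (O : orbit X) :
  exists y, f @` O = orb y.
Proof.
exists (f (orepr O)); rewrite oreprE; apply/seteqP; split=> y.
  by move=> [_ [g ->] <-]; exists g; rewrite hfunP.
by move=> [g ->]; exists (hact g (orepr O)); [exists g | rewrite hfunP].
Qed.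

Definition orbit_image X Y (f : hmap X Y) (O : orbit X) : orbit Y :=
  @Orbit Y (f @` O) (orbit_imageP f O).

Program Definition orbit_map X Y (f : hmap X Y) (O : orbit X) :
    hmap (orbit_th O) (orbit_th (orbit_image f O)) :=
  @HMap H (orbit_th O) (orbit_th (orbit_image f O))
    (fun x => exist _ (f (sval x)) (imageP f (svalP x))) _.
Next Obligation. by move=> X Y f O g x; apply: eq_exist; rewrite /= hfunP. Qed.

End HSets.

Definition oligomorphic (H : permGroup) : Prop :=
  forall n, finitary (hpow H n).

(** ** Measures *)

(** Sums over [_ \in A] are finitely supported sums; the sets of orbits that
    occur below are finite as soon as [H] is oligomorphic (see
    [finitary_hprod] and [finitary_hfib]). *)
Record measure (H : permGroup) (k : comUnitRingType) := Measure {
  mval :> forall Y X : thset H, hmap Y X -> k;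
  measure_iso : forall (Y X : thset H) (f : hmap Y X), hiso f -> mval f = 1;
  measure_comp : forall (Z Y X : thset H) (g : hmap Y X) (f : hmap Z Y),
    @mval Z X (hmap_comp g f) = mval g * mval f;
  measure_fib : forall (Y X X' : thset H) (f : hmap Y X) (g : hmap X' X),
    mval f = \sum_(O \in [set: orbit (hfib f g)])
      @mval (orbit_th O) X' (hmap_comp (hfib_snd f g) (orbit_incl O)) }.

Definition regular (H : permGroup) (k : comUnitRingType) (mu : measure H k) :=
  forall (Y X : thset H) (f : hmap Y X), mu Y X f \is a GRing.unit.

(** ** Finiteness of orbits *)

Section Finitary.
Variable H : permGroup.
Implicit Types X Y Z : hset H.

Lemma finitaryP X : finitary X <->
  exists (T : finType) (c : X -> T), forall x y, c x = c y -> orb x y.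
Proof.
split.
  move=> /finite_seqP[s sE].
  have sP (O : orbit X) : O \in s by have : [set: orbit X] O by []; rewrite sE.
  exists 'I_(size s).+1, (fun x => inord (index (orbit_of x) s)) => x y.
  move=> /(congr1 val) /=.
  rewrite !inordK ?ltnS ?index_size// => /(congr1 (nth (orbit_of x) s)).
  rewrite !nth_index// => /(congr1 (@oset _ _)) /= ->; exact: orb_refl.
case=> T [c cP].
have cinj : {in [set: orbit X] &, injective (fun O => c (orepr O))}.
  move=> O O' _ _ /cP /orb_eq e; apply: orbit_inj.
  by rewrite oreprE e -oreprE.
have := inj_card_eq cinj; rewrite card_eq_le => /andP[_ le].
by apply: card_le_finite le _; apply: finite_finset.
Qed.

Lemma finitary_transitive (X : thset H) : finitary X.
Proof.
have [x xP] := thP X; apply/finitaryP; exists unit, (fun _ => tt) => y z _.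
by rewrite -(orb_eq (xP y)).
Qed.

Lemma finitary_hsub X (A : set X) (AP : hstable A) :
  finitary X -> finitary (hsub AP).
Proof.
move=> /finitaryP[T [c cP]]; apply/finitaryP; exists T, (fun x => c (sval x)).
move=> [x Ax] [y Ay] /cP[g /= yE].
by exists g; apply: eq_exist.
Qed.

Lemma finitary_repr X : finitary X ->
  exists (T : finType) (c : X -> T) (s : X -> H) (B : seq (pdom H)),
    (forall x y, c x = c y -> hact (s x) x = hact (s y) y) /\
    (forall x g, {in B, forall w, pact g w = w} ->
       hact g (hact (s x) x) = hact (s x) x).
Proof.
move=> fX; have /finitaryP[T [c cP]] := fX.
have /finite_seqP[S SE] := fX.
have SP (O : orbit X) : O \in S by have : [set: orbit X] O by []; rewrite SE.
have sP0 (x : X) : exists g, hact g x = orepr (orbit_of x).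
  have : oset (orbit_of x) (orepr (orbit_of x)).
    by rewrite oreprE; apply: orb_refl.
  by case=> g gE; exists g.
have [s sP] := choice sP0.
have [A AP] := choice (fun o : orbit X => hopen (orepr o)).
exists T, c, s, (flatten [seq A o | o <- S]); split.
  move=> x y /cP /orb_eq e; rewrite !sP; congr orepr; exact: orbit_inj.
move=> x g gB; rewrite !sP; apply: AP => w wA; apply: gB.
by apply/flattenP; exists (A (orbit_of x)) => //; apply: map_f.
Qed.

Lemma finitary_hprod X Y : oligomorphic H ->
  finitary X -> finitary Y -> finitary (hprod X Y).
Proof.
move=> olH /finitary_repr[T [c [s [B [cP sP]]]]].
move=> /finitary_repr[T' [c' [s' [B' [cP' sP']]]]].
pose tup (p : hprod X Y) : hpow H (size B + size B') :=
  cat_tuple (map_tuple (pact (s p.1)^-1%g) (in_tuple B))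
            (map_tuple (pact (s' p.2)^-1%g) (in_tuple B')).
have /finitaryP[U [d dP]] := olH (size B + size B')%N.
apply/finitaryP; exists (T * T' * U)%type, (fun p => (c p.1, c' p.2, d (tup p))).
move=> [x x'] [y y'] /= [/cP cxy /cP' cxy' /dP[k]].
move=> /(congr1 val) /eqP /=.
rewrite map_cat eqseq_cat ?size_map// => /andP[/eqP e1 /eqP e2].
have fixB : {in B, forall w, pact (s y * (k * (s x)^-1))%g w = w}.
  move=> w wB; rewrite !pactM.
  move: e1; rewrite -map_comp => /eq_in_map /(_ w wB) /= <-.
  exact: pactVK.
have fixB' : {in B', forall w, pact (s' y' * (k * (s' x')^-1))%g w = w}.
  move=> w wB; rewrite !pactM.
  move: e2; rewrite -map_comp => /eq_in_map /(_ w wB) /= <-.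
  exact: pactVK.
have := sP x _ fixB; rewrite !hactM hactK cxy => /(can_inj (@hactK _ _ _)) e.
have := sP' x' _ fixB'; rewrite !hactM hactK cxy' => /(can_inj (@hactK _ _ _)) e'.
by exists k; rewrite /= e e'.
Qed.

Lemma finitary_hpt : finitary (hpt H).
Proof.
by apply/finitaryP; exists unit, id => -[] [] _; exact: orb_refl.
Qed.

Lemma finitary_hfib X Y Z (f : hmap Y X) (g : hmap Z X) : oligomorphic H ->
  finitary Y -> finitary Z -> finitary (hfib f g).
Proof. by move=> olH fY fZ; apply/finitary_hsub/finitary_hprod. Qed.

End Finitary.

Program Definition measure_intr (H : permGroup) (olH : oligomorphic H)
    (k : comUnitRingType) (mu : measure H int) : measure H k :=
  @Measure H k (fun Y X f => (mu Y X f)%:~R) _ _ _.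
Next Obligation. by move=> H olH k mu Y X f /measure_iso ->. Qed.
Next Obligation. by move=> H olH k mu Z Y X g f; rewrite /= measure_comp intrM. Qed.
Next Obligation.
move=> H olH k mu Y X X' f g /=; rewrite (measure_fib mu f g).
have fin : finite_set [set: orbit (hfib f g)].
  by apply: finitary_hfib => //; apply: finitary_transitive.
by rewrite !(fsbig_finite _ _ fin) /= raddf_sum.
Qed.

(** ** Invariant functions and push-forward *)

Section Invariant.
Variables (H : permGroup) (k : fieldType).

Definition invariant (X : hset H) : {pred X -> k^o} :=
  fun phi => `[< forall g x, phi (hact g x) = phi x >].

Lemma invariant_submod_closed (X : hset H) : submod_closed (@invariant X).
Proof.
split=> [|a u v /asboolP uP /asboolP vP]; apply/asboolP => // g x.
by rewrite !fctE; congr (_ *: _ + _).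
Qed.

HB.instance Definition _ (X : hset H) :=
  GRing.isSubmodClosed.Build k (X -> k^o) (@invariant X)
    (@invariant_submod_closed X).

Record invfun (X : hset H) := InvFun {
  invfun_fun :> X -> k^o;
  invfun_in : invfun_fun \in @invariant X }.

HB.instance Definition _ (X : hset H) := [isSub for @invfun_fun X].
HB.instance Definition _ (X : hset H) := [Choice of invfun X by <:].
HB.instance Definition _ (X : hset H) := [SubChoice_isSubLmodule of invfun X by <:].

Definition mkinv (X : hset H) (phi : X -> k)
    (phiP : forall g x, phi (hact g x) = phi x) : invfun X :=
  @InvFun X phi (asboolT phiP).

Lemma invfunP (X : hset H) (phi : invfun X) g x : phi (hact g x) = phi x.
Proof. by case: phi => phi /= /asboolP. Qed.

(** The orbits [O] with [orbit_image f O = orbit_of y] are those in the preimage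
    of the orbit of [y], and [phi] is evaluated on [O] at a representative. *)
Program Definition push (mu : measure H k) (X Y : hset H) (f : hmap X Y)
    (phi : invfun X) : invfun Y :=
  @mkinv Y (fun y =>
    \sum_(O \in [set O : orbit X | orbit_image f O = orbit_of y])
      phi (orepr O) * mu (orbit_th O) (orbit_th (orbit_image f O))
                         (orbit_map f O)) _.
Next Obligation. by move=> mu X Y f phi g y; rewrite /= orbit_of_hact. Qed.

End Invariant.

(** * Linear symmetric monoidal categories *)

(** [smcData] only carries the operations; [linear_smc] states the laws.
    The Karoubi envelope is formed from data that satisfy the laws (they are
    needed for it to be closed under composition) and is again mere data;
    [pre_tannakian] includes the laws. *)
Record smcData (k : fieldType) := SMCData {
  ob :> Type;
  hom : ob -> ob -> lmodType k;
  idm : forall X, hom X X;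
  comp : forall X Y Z, hom Y Z -> hom X Y -> hom X Z;
  unit_ob : ob;
  tens : ob -> ob -> ob;
  tensm : forall X X' Y Y',
    hom X X' -> hom Y Y' -> hom (tens X Y) (tens X' Y');
  assoc : forall X Y Z, hom (tens (tens X Y) Z) (tens X (tens Y Z));
  assocV : forall X Y Z, hom (tens X (tens Y Z)) (tens (tens X Y) Z);
  lunit : forall X, hom (tens unit_ob X) X;
  lunitV : forall X, hom X (tens unit_ob X);
  runit : forall X, hom (tens X unit_ob) X;
  runitV : forall X, hom X (tens X unit_ob);
  swap : forall X Y, hom (tens X Y) (tens Y X) }.

Arguments unit_ob {k s}.
Arguments idm {k s} X.
Arguments assoc {k s} X Y Z.
Arguments assocV {k s} X Y Z.
Arguments lunit {k s} X.
Arguments lunitV {k s} X.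
Arguments runit {k s} X.
Arguments runitV {k s} X.
Arguments swap {k s} X Y.

Declare Scope smc_scope.
Delimit Scope smc_scope with smc.
Local Open Scope smc_scope.

Notation "g '∘' f" := (comp g f) (at level 40, left associativity) : smc_scope.
Notation "X '⊗' Y" := (tens X Y) (at level 38, left associativity) : smc_scope.
Notation "f '⊠' g" := (tensm f g) (at level 38, left associativity) : smc_scope.
Notation "'𝟙'" := unit_ob : smc_scope.

Record linear_smc (k : fieldType) (C : smcData k) : Prop := LinearSMC {
  compA : forall (W X Y Z : C) (h : hom Y Z) (g : hom X Y) (f : hom W X),
    h ∘ (g ∘ f) = (h ∘ g) ∘ f;
  comp1m : forall (X Y : C) (f : hom X Y), idm Y ∘ f = f;
  compm1 : forall (X Y : C) (f : hom X Y), f ∘ idm X = f;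
  comp_linearl : forall (X Y Z : C) (f : hom X Y),
    linear (fun g : hom Y Z => g ∘ f);
  comp_linearr : forall (X Y Z : C) (g : hom Y Z),
    linear (fun f : hom X Y => g ∘ f);
  tensm1 : forall X Y : C, idm X ⊠ idm Y = idm (X ⊗ Y);
  tensm_comp : forall (X X' X'' Y Y' Y'' : C)
      (g : hom X' X'') (f : hom X X') (g' : hom Y' Y'') (f' : hom Y Y'),
    (g ∘ f) ⊠ (g' ∘ f') = (g ⊠ g') ∘ (f ⊠ f');
  tensm_linearl : forall (X X' Y Y' : C) (g : hom Y Y'),
    linear (fun f : hom X X' => f ⊠ g);
  tensm_linearr : forall (X X' Y Y' : C) (f : hom X X'),
    linear (fun g : hom Y Y' => f ⊠ g);
  assocK : forall X Y Z : C, assocV X Y Z ∘ assoc X Y Z = idm _;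
  assocVK : forall X Y Z : C, assoc X Y Z ∘ assocV X Y Z = idm _;
  lunitK : forall X : C, lunitV X ∘ lunit X = idm _;
  lunitVK : forall X : C, lunit X ∘ lunitV X = idm _;
  runitK : forall X : C, runitV X ∘ runit X = idm _;
  runitVK : forall X : C, runit X ∘ runitV X = idm _;
  swapK : forall X Y : C, swap Y X ∘ swap X Y = idm _;
  assoc_nat : forall (X X' Y Y' Z Z' : C)
      (f : hom X X') (g : hom Y Y') (h : hom Z Z'),
    assoc X' Y' Z' ∘ ((f ⊠ g) ⊠ h) = (f ⊠ (g ⊠ h)) ∘ assoc X Y Z;
  lunit_nat : forall (X X' : C) (f : hom X X'),
    lunit X' ∘ (idm 𝟙 ⊠ f) = f ∘ lunit X;
  runit_nat : forall (X X' : C) (f : hom X X'),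
    runit X' ∘ (f ⊠ idm 𝟙) = f ∘ runit X;
  swap_nat : forall (X X' Y Y' : C) (f : hom X X') (g : hom Y Y'),
    swap X' Y' ∘ (f ⊠ g) = (g ⊠ f) ∘ swap X Y;
  triangle : forall X Y : C,
    (idm X ⊠ lunit Y) ∘ assoc X 𝟙 Y = runit X ⊠ idm Y;
  pentagon : forall W X Y Z : C,
    assoc W X (Y ⊗ Z) ∘ assoc (W ⊗ X) Y Z =
    (idm W ⊠ assoc X Y Z) ∘ assoc W (X ⊗ Y) Z ∘ (assoc W X Y ⊠ idm Z);
  hexagon : forall X Y Z : C,
    assoc Y Z X ∘ swap X (Y ⊗ Z) ∘ assoc X Y Z =
    (idm Y ⊠ swap X Z) ∘ assoc Y X Z ∘ (swap X Y ⊠ idm Z) }.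

Section Categories.
Variables (k : fieldType) (C : smcData k).
Implicit Types X Y Z : C.

Definition iso X Y (f : hom X Y) : Prop :=
  exists g : hom Y X, g ∘ f = idm X /\ f ∘ g = idm Y.

Definition mono X Y (f : hom X Y) : Prop :=
  forall W (u v : hom W X), f ∘ u = f ∘ v -> u = v.

Definition epi X Y (f : hom X Y) : Prop :=
  forall Z (u v : hom Y Z), u ∘ f = v ∘ f -> u = v.

Definition is_kernel X Y (f : hom X Y) K (i : hom K X) : Prop :=
  f ∘ i = 0 /\
  forall W (u : hom W X), f ∘ u = 0 -> exists! v : hom W K, i ∘ v = u.

Definition is_cokernel X Y (f : hom X Y) Q (p : hom Y Q) : Prop :=
  p ∘ f = 0 /\
  forall Z (u : hom Y Z), u ∘ f = 0 -> exists! v : hom Q Z, v ∘ p = u.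

Definition is_zero Z : Prop :=
  (forall X (f g : hom X Z), f = g) /\ (forall X (f g : hom Z X), f = g).

Definition direct_sum n (S : 'I_n -> C) X : Prop :=
  exists (i : forall a, hom (S a) X) (p : forall a, hom X (S a)),
    [/\ forall a, p a ∘ i a = idm (S a),
        forall a b, a != b -> p a ∘ i b = 0 &
        \sum_a i a ∘ p a = idm X].

(** Taking [n = 0] in the first clause gives a zero object. *)
Record abelian : Prop := Abelian {
  ab_sum : forall n (S : 'I_n -> C), exists X, direct_sum S X;
  ab_ker : forall X Y (f : hom X Y), exists K (i : hom K X), is_kernel f i;
  ab_coker : forall X Y (f : hom X Y), exists Q (p : hom Y Q), is_cokernel f p;
  ab_mono : forall X Y (f : hom X Y), mono f ->
    exists Z (g : hom Y Z), is_kernel g f;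
  ab_epi : forall X Y (f : hom X Y), epi f ->
    exists Z (g : hom Z X), is_cokernel g f }.

Definition simple X : Prop :=
  ~ is_zero X /\ forall Y (i : hom Y X), mono i -> is_zero Y \/ iso i.

Inductive finite_length : C -> Prop :=
| finite_length0 X : is_zero X -> finite_length X
| finite_lengthS X Y S (i : hom Y X) (p : hom X S) :
    is_kernel p i -> is_cokernel i p -> simple S ->
    finite_length Y -> finite_length X.

Definition finite_dim (V : lmodType k) : Prop :=
  exists n (b : 'I_n -> V), forall v, exists c : 'I_n -> k,
    v = \sum_a c a *: b a.

Definition rigid X : Prop :=
  exists Y (ev : hom (Y ⊗ X) 𝟙) (coev : hom 𝟙 (X ⊗ Y)),
    runit X ∘ (idm X ⊠ ev) ∘ assoc X Y X ∘ (coev ⊠ idm X) ∘ lunitV X = idm X /\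
    lunit Y ∘ (ev ⊠ idm Y) ∘ assocV Y X Y ∘ (idm Y ⊠ coev) ∘ runitV Y = idm Y.

Record pre_tannakian : Prop := PreTannakian {
  pt_linear_smc : linear_smc C;
  pt_abelian : abelian;
  pt_length : forall X, finite_length X;
  pt_hom : forall X Y, finite_dim (hom X Y);
  pt_rigid : forall X, rigid X;
  pt_end1 : bijective (fun c : k => c *: idm (𝟙 : C)) }.

Definition semisimple : Prop :=
  forall X, exists n (S : 'I_n -> C), (forall a, simple (S a)) /\ direct_sum S X.

End Categories.

(** * Karoubi envelope *)

Section Karoubi.
Variables (k : fieldType) (C : smcData k) (L : linear_smc C).

Record kob := KOb {
  kobj : C;
  kidem : hom kobj kobj;
  kidemP : kidem ∘ kidem = kidem }.

Implicit Types X Y Z : kob.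

Definition khom_pred X Y : {pred hom (kobj X) (kobj Y)} :=
  fun f => kidem Y ∘ f ∘ kidem X == f.

Lemma khom_submod_closed X Y : submod_closed (@khom_pred X Y).
Proof.
have E a u v : kidem Y ∘ (a *: u + v) ∘ kidem X =
    a *: (kidem Y ∘ u ∘ kidem X) + kidem Y ∘ v ∘ kidem X.
  by rewrite (comp_linearr L) (comp_linearl L).
split=> [|a u v]; rewrite !unfold_in /khom_pred.
  by have := E (-1) 0 0; rewrite scaler0 addr0 scaleN1r addNr => ->.
by move=> /eqP eu /eqP ev; rewrite E eu ev.
Qed.

HB.instance Definition _ X Y :=
  GRing.isSubmodClosed.Build k (hom (kobj X) (kobj Y)) (@khom_pred X Y)
    (@khom_submod_closed X Y).

Record khom X Y := KHom {
  khom_val :> hom (kobj X) (kobj Y);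
  khom_in : khom_val \in @khom_pred X Y }.

HB.instance Definition _ X Y := [isSub for @khom_val X Y].
HB.instance Definition _ X Y := [Choice of khom X Y by <:].
HB.instance Definition _ X Y := [SubChoice_isSubLmodule of khom X Y by <:].

Lemma khomP X Y (f : khom X Y) : kidem Y ∘ f ∘ kidem X = f.
Proof. by case: f => f /= /eqP. Qed.

Lemma khoml X Y (f : khom X Y) : kidem Y ∘ f = f.
Proof. by rewrite -(khomP f) !(compA L) kidemP. Qed.

Lemma khomr X Y (f : khom X Y) : f ∘ kidem X = f.
Proof. by rewrite -(khomP f) -!(compA L) kidemP. Qed.

(** The morphism of the envelope cut out by an arbitrary morphism. *)
Program Definition kcut X Y (f : hom (kobj X) (kobj Y)) : khom X Y :=
  @KHom X Y (kidem Y ∘ f ∘ kidem X) _.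
Next Obligation.
move=> X Y f; apply/eqP.
by rewrite !(compA L) kidemP -!(compA L) kidemP.
Qed.

Program Definition kid X : khom X X := @KHom X X (kidem X) _.
Next Obligation. by move=> X; apply/eqP; rewrite !kidemP. Qed.

Program Definition kcomp X Y Z (g : khom Y Z) (f : khom X Y) : khom X Z :=
  @KHom X Z (g ∘ f) _.
Next Obligation.
by move=> X Y Z g f; apply/eqP; rewrite (compA L) khoml -(compA L) khomr.
Qed.

Program Definition ktens X Y : kob :=
  @KOb (kobj X ⊗ kobj Y) (kidem X ⊠ kidem Y) _.
Next Obligation. by move=> X Y; rewrite -(tensm_comp L) !kidemP. Qed.

Program Definition ktensm X X' Y Y' (f : khom X X') (g : khom Y Y') :
    khom (ktens X Y) (ktens X' Y') :=
  @KHom (ktens X Y) (ktens X' Y') (f ⊠ g) _.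
Next Obligation.
move=> X X' Y Y' f g; apply/eqP.
by rewrite /= -!(tensm_comp L) !khoml !khomr.
Qed.

Program Definition kunit : kob := @KOb 𝟙 (idm 𝟙) _.
Next Obligation. by rewrite (comp1m L). Qed.

Definition karoubi : smcData k :=
  @SMCData k kob (fun X Y => khom X Y : lmodType k) kid kcomp kunit ktens ktensm
    (fun X Y Z => @kcut (ktens (ktens X Y) Z) (ktens X (ktens Y Z))
                    (assoc (kobj X) (kobj Y) (kobj Z)))
    (fun X Y Z => @kcut (ktens X (ktens Y Z)) (ktens (ktens X Y) Z)
                    (assocV (kobj X) (kobj Y) (kobj Z)))
    (fun X => @kcut (ktens kunit X) X (lunit (kobj X)))
    (fun X => @kcut X (ktens kunit X) (lunitV (kobj X)))
    (fun X => @kcut (ktens X kunit) X (runit (kobj X)))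
    (fun X => @kcut X (ktens X kunit) (runitV (kobj X)))
    (fun X Y => @kcut (ktens X Y) (ktens Y X) (swap (kobj X) (kobj Y))).

End Karoubi.

(** * The category of permutation modules *)

Section Perm.
Variables (H : permGroup) (olH : oligomorphic H).
Variables (k : fieldType) (mu : measure H k).

Record fhset := FHSet {
  fh_hset :> hset H;
  fhP : finitary fh_hset }.

Implicit Types X Y Z : fhset.

Definition fprod X Y : fhset := FHSet (finitary_hprod olH (fhP X) (fhP Y)).
Definition fpt : fhset := FHSet (finitary_hpt H).

Definition mat X Y : lmodType k := invfun k (hprod Y X).

Program Definition graph_mat X Y (f : hmap X Y) : mat X Y :=
  @mkinv H k (hprod Y X) (fun p => `[< p.1 = f p.2 >]%:R) _.
Next Obligation.
move=> X Y f g [y x] /=; congr (nat_of_bool _)%:R; apply/asbool_equiv_eq.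
rewrite hfunP; split=> [/(can_inj (@hactK _ _ _))|->] //.
Qed.

Program Definition mat_mul3 X Y Z (B : mat Y Z) (A : mat X Y) :
    invfun k (hprod (hprod Z Y) X) :=
  @mkinv H k (hprod (hprod Z Y) X)
    (fun t => (B (t.1.1, t.1.2) : k) * A (t.1.2, t.2)) _.
Next Obligation.
move=> X Y Z B A g [[z y] x] /=.
by rewrite -(invfunP B g (z, y)) -(invfunP A g (y, x)).
Qed.

Definition proj13 X Y Z : hmap (hprod (hprod Z Y) X) (hprod Z X) :=
  hpair (hmap_comp (hfst Z Y) (hfst (hprod Z Y) X)) (hsnd (hprod Z Y) X).

Definition mat_comp X Y Z (B : mat Y Z) (A : mat X Y) : mat X Z :=
  push mu (proj13 X Y Z) (mat_mul3 B A).

Program Definition mat_tens X X' Y Y' (A : mat X X') (B : mat Y Y') :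
    mat (fprod X Y) (fprod X' Y') :=
  @mkinv H k (hprod (hprod X' Y') (hprod X Y))
    (fun t => (A (t.1.1, t.2.1) : k) * B (t.1.2, t.2.2)) _.
Next Obligation.
move=> X X' Y Y' A B g [[x' y'] [x y]] /=.
by rewrite -(invfunP A g (x', x)) -(invfunP B g (y', y)).
Qed.

Definition hassoc (X Y Z : hset H) :
    hmap (hprod (hprod X Y) Z) (hprod X (hprod Y Z)) :=
  hpair (hmap_comp (hfst X Y) (hfst (hprod X Y) Z))
    (hpair (hmap_comp (hsnd X Y) (hfst (hprod X Y) Z)) (hsnd (hprod X Y) Z)).

Definition hassocV (X Y Z : hset H) :
    hmap (hprod X (hprod Y Z)) (hprod (hprod X Y) Z) :=
  hpair (hpair (hfst X (hprod Y Z)) (hmap_comp (hfst Y Z) (hsnd X (hprod Y Z))))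
    (hmap_comp (hsnd Y Z) (hsnd X (hprod Y Z))).

Definition hto_pt (X : hset H) : hmap X (hpt H) :=
  @HMap H X (hpt H) (fun _ => tt) (fun _ _ => erefl).

Definition perm : smcData k :=
  @SMCData k fhset mat
    (fun X => @graph_mat X X (hmap_id X)) mat_comp fpt fprod mat_tens
    (fun X Y Z => @graph_mat (fprod (fprod X Y) Z) (fprod X (fprod Y Z))
                    (hassoc X Y Z))
    (fun X Y Z => @graph_mat (fprod X (fprod Y Z)) (fprod (fprod X Y) Z)
                    (hassocV X Y Z))
    (fun X => @graph_mat (fprod fpt X) X (hsnd fpt X))
    (fun X => @graph_mat X (fprod fpt X) (hpair (hto_pt X) (hmap_id X)))
    (fun X => @graph_mat (fprod X fpt) X (hfst X fpt))
    (fun X => @graph_mat X (fprod X fpt) (hpair (hmap_id X) (hto_pt X)))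
    (fun X Y => @graph_mat (fprod X Y) (fprod Y X)
                  (hpair (hsnd X Y) (hfst X Y))).

End Perm.

(** * The wreath product of two copies of Aut(Q, <) *)

(** A bijection of a total order that preserves the order also reflects it. *)
Definition autQ (g : rat -> rat) : Prop :=
  bijective g /\ {mono g : x y / x < y}.

Definition in_wreath (f : rat * rat -> rat * rat) : Prop :=
  exists (g : rat -> rat) (h : rat -> rat -> rat),
    [/\ autQ g, forall a, autQ (h a) & forall a b, f (a, b) = (g a, h a b)].

Record wreath := Wreath {
  wfun :> rat * rat -> rat * rat;
  wfunP : in_wreath wfun }.

HB.instance Definition _ := gen_eqMixin wreath.
HB.instance Definition _ := gen_choiceMixin wreath.

Lemma wreath_inj (f g : wreath) : wfun f =1 wfun g -> f = g.
Proof.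
case: f g => [f Pf] [g Pg] /= /funext e; case: _ / e Pg => Pg.
by congr Wreath; apply: Prop_irrelevance.
Qed.

Lemma autQ_id : autQ id.
Proof. by split=> //; exists id. Qed.

Lemma autQ_comp f g : autQ f -> autQ g -> autQ (f \o g).
Proof.
by move=> [bf mf] [bg mg]; split=> [|x y /=]; [apply: bij_comp | rewrite mf mg].
Qed.

Lemma autQ_inv f : autQ f -> exists g, [/\ autQ g, cancel f g & cancel g f].
Proof.
move=> [[g fK gK] mf]; exists g; split=> //; split; first by exists f.
by move=> x y; rewrite -mf !gK.
Qed.

Lemma in_wreath_id : in_wreath id.
Proof. by exists id, (fun _ => id); split=> // *; apply: autQ_id. Qed.

Lemma in_wreath_comp f f' : in_wreath f -> in_wreath f' -> in_wreath (f \o f').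
Proof.
move=> [g [h [ag ah fE]]] [g' [h' [ag' ah' fE']]].
exists (g \o g'), (fun a => h (g' a) \o h' a); split=> [|a|a b /=].
- exact: autQ_comp.
- exact: autQ_comp.
- by rewrite fE' fE.
Qed.

Lemma in_wreath_inv f : in_wreath f ->
  exists f', [/\ in_wreath f', cancel f f' & cancel f' f].
Proof.
move=> [g [h [ag ah fE]]].
have [g' [ag' gK g'K]] := autQ_inv ag.
have [h' h'P] := choice (fun a => autQ_inv (ah a)).
exists (fun p => (g' p.1, h' (g' p.1) p.2)); split.
- exists g', (fun a => h' (g' a)); split=> // a; by have [] := h'P (g' a).
- by move=> [a b]; rewrite fE /= gK; have [_ -> _] := h'P a.
- by move=> [a b]; rewrite fE /= g'K; have [_ _ ->] := h'P (g' a).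
Qed.

Definition wreath_one : wreath := Wreath in_wreath_id.
Definition wreath_mul (f g : wreath) : wreath :=
  Wreath (in_wreath_comp (wfunP f) (wfunP g)).
Definition wreath_inv (f : wreath) : wreath :=
  let: exist f' P := cid (in_wreath_inv (wfunP f)) in
  let: And3 Pf' _ _ := P in Wreath Pf'.

Lemma wreath_invK (f : wreath) : cancel f (wreath_inv f).
Proof. by rewrite /wreath_inv; case: cid => f' []. Qed.

Lemma wreath_invVK (f : wreath) : cancel (wreath_inv f) f.
Proof. by rewrite /wreath_inv; case: cid => f' []. Qed.

Lemma wreath_mulA : associative wreath_mul.
Proof. by move=> f g h; apply: wreath_inj. Qed.
Lemma wreath_mul1 : left_id wreath_one wreath_mul.
Proof. by move=> f; apply: wreath_inj. Qed.
Lemma wreath_mulr1 : right_id wreath_one wreath_mul.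
Proof. by move=> f; apply: wreath_inj. Qed.
Lemma wreath_mulV : left_inverse wreath_one wreath_inv wreath_mul.
Proof. by move=> f; apply: wreath_inj => x /=; rewrite wreath_invK. Qed.
Lemma wreath_mulrV : right_inverse wreath_one wreath_inv wreath_mul.
Proof. by move=> f; apply: wreath_inj => x /=; rewrite wreath_invVK. Qed.

HB.instance Definition _ := isGroup.Build wreath
  wreath_mulA wreath_mul1 wreath_mulr1 wreath_mulV wreath_mulrV.

Definition GwrG : permGroup :=
  @PermGroup wreath (rat * rat)%type wfun (fun _ => erefl) (fun _ _ _ => erefl)
    wreath_inj.

(** ** Oligomorphy *)

Lemma autQ_move (c u v : rat) : c < u -> c < v ->
  exists g, [/\ autQ g, g u = v & forall x, x <= c -> g x = x].
Proof.
pose f (u v x : rat) := if x <= c then x else c + (x - c) * ((v - c) / (u - c)).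
have fgt u' v' x : c < u' -> c < v' -> c < x -> c < f u' v' x.
  move=> cu cv cx; rewrite /f leNgt cx /= ltrDl.
  by rewrite mulr_gt0 ?divr_gt0 ?subr_gt0.
have fK u' v' : c < u' -> c < v' -> cancel (f u' v') (f v' u').
  move=> cu cv x; have [xc|cx] := leP x c.
    by rewrite /f xc xc.
  have := fgt _ _ _ cu cv cx; rewrite {1 2}/f => h.
  rewrite leNgt h /= /f leNgt cx /=.
  have : u' - c != 0 by rewrite subr_eq0 gt_eqF.
  have : v' - c != 0 by rewrite subr_eq0 gt_eqF.
  by move=> n1 n2; field; rewrite n1 n2.
move=> cu cv; exists (f u v); split.
- split; first by exists (f v u); apply: fK.
  apply: leW_mono; apply: le_mono => x y xy; have [xc|cx] := leP x c.
    have [yc|cy] := leP y c; first by rewrite /f xc yc.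
    by rewrite {1}/f xc; apply: le_lt_trans xc _; apply: fgt.
  have cy := lt_trans cx xy.
  rewrite /f !leNgt cx cy /= ltrD2l ltr_pM2r ?ltrD2r //.
  by rewrite divr_gt0 ?subr_gt0.
- rewrite /f leNgt cu /= mulrC divfK ?subr_eq0 ?gt_eqF //.
  by rewrite addrC subrK.
- by move=> x xc; rewrite /f xc.
Qed.

Lemma autQ_homogeneous (s : seq (rat * rat)) :
  {in s &, forall p q, (p.1 < q.1) = (p.2 < q.2)} ->
  exists g, autQ g /\ {in s, forall p, g p.1 = p.2}.
Proof.
pose r := [rel p q : rat * rat | q.1 <= p.1].
wlog : s / sorted r s.
  move=> IH sP; have [||g [ag gP]] := IH (sort r s).
  - by apply: sort_sorted => p q /=; apply: le_total.
  - by move=> p q; rewrite !mem_sort; apply: sP.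
  - by exists g; split=> // p ps; apply: gP; rewrite mem_sort.
have rtr : transitive r by move=> q p t /= pq qt; apply: le_trans qt pq.
elim: s => [|[x y] s IH] srt sP; first by exists id; split=> //; apply: autQ_id.
have [||g [ag gP]] := IH.
- exact: path_sorted srt.
- by move=> p q ps qs; apply: sP; rewrite inE ?ps ?qs orbT.
have xmax : {in s, forall p, p.1 <= x}.
  by move=> p ps; have := order_path_min rtr srt => /allP /(_ p ps).
case: s IH srt sP gP xmax => [|[c d] s] _ srt sP gP xmax.
  exists (fun z => z + (y - x)); split.
    split; last by move=> a b; rewrite ltrD2r.
    by exists (fun z => z - (y - x)) => z; rewrite ?addrK ?subrK.
  by move=> p; rewrite inE => /eqP -> /=; rewrite addrC subrK.
have cs : (c, d) \in (c, d) :: s by rewrite inE eqxx.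
have cs' : (c, d) \in [:: (x, y), (c, d) & s] by rewrite inE cs orbT.
have xs' : (x, y) \in [:: (x, y), (c, d) & s] by rewrite inE eqxx.
have gc : g c = d := gP _ cs.
have := xmax _ cs; rewrite le_eqVlt => /orP[/eqP /= cx|/= cx].
  exists g; split=> // p; rewrite inE => /orP[/eqP ->|]; last exact: gP.
  rewrite /= -cx gc; apply/eqP; rewrite eq_le !leNgt.
  by move: (sP _ _ xs' cs') (sP _ _ cs' xs') => /= <- <-; rewrite cx ltxx.
have dgx : d < g x by rewrite -gc ag.2.
have dy : d < y by have /= <- := sP _ _ cs' xs'.
have [f [af fgx fid]] := autQ_move dgx dy.
exists (f \o g); split; first exact: autQ_comp.
move=> p; rewrite inE => /orP[/eqP -> //|ps] /=.
have ps' : p \in [:: (x, y), (c, d) & s] by rewrite inE ps orbT.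
rewrite gP // fid // leNgt; have /= <- := sP _ _ cs' ps'; rewrite -leNgt.
move: ps; rewrite inE => /orP[/eqP -> //|ps].
by have := order_path_min rtr (path_sorted srt) => /allP /(_ p ps).
Qed.

Lemma oligomorphic_GwrG : oligomorphic GwrG.
Proof.
move=> n; apply/finitaryP.
exists {ffun 'I_n * 'I_n -> bool * bool}, (fun t : n.-tuple (rat * rat) =>
  [ffun ij => ((tnth t ij.1).1 < (tnth t ij.2).1,
               (tnth t ij.1).2 < (tnth t ij.2).2)]) => t u tu.
have tuE i j : ((tnth t i).1 < (tnth t j).1) = ((tnth u i).1 < (tnth u j).1) /\
               ((tnth t i).2 < (tnth t j).2) = ((tnth u i).2 < (tnth u j).2).
  by have := congr1 (fun F : {ffun _ -> _} => F (i, j)) tu; rewrite !ffunE => -[].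
have [|g [ag gP]] := @autQ_homogeneous
  [seq ((tnth t i).1, (tnth u i).1) | i <- enum 'I_n].
  by move=> _ _ /mapP[i _ ->] /mapP[j _ ->] /=; have [] := tuE i j.
have [|h [ah hP]] := @autQ_homogeneous
  [seq ((tnth t i).2, (tnth u i).2) | i <- enum 'I_n].
  by move=> _ _ /mapP[i _ ->] /mapP[j _ ->] /=; have [] := tuE i j.
have wP : in_wreath (fun p => (g p.1, h p.2)) by exists g, (fun _ => h); split.
exists (Wreath wP); apply: eq_from_tnth => i; rewrite tnth_map /=.
rewrite (gP ((tnth t i).1, (tnth u i).1)); last by rewrite map_f ?mem_enum.
rewrite (hP ((tnth t i).2, (tnth u i).2)); last by rewrite map_f ?mem_enum.
by case: (tnth u i).
Qed.

(* Main.v *)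
(** An open subgroup of [G wr G] is the pointwise stabilizer of a unique finite
    set of points and fibers, its support, that contains the fibers of its
    points. Counting with compactly supported
    Euler characteristic, [mu (Y -> X) = (-1)^(d(Y) - d(X))], where [d] is the
    size of the support of a point stabilizer, is a measure: a cell, which is an
    open interval, has characteristic [-1] however it is subdivided.

    Since [mu] takes values in [{1, -1}], the trace form on the endomorphism
    algebra of a permutation module is nondegenerate. In characteristic [p] one
    has [tr (A^p) = (tr A)^p]: both sides are sums over orbits on [X^p], which
    cyclic rotation permutes, and as the group is torsion-free the only orbits
    it fixes are those of constant words. So nilpotents have trace [0], and no
    nonzero right ideal is nil. In characteristic [0] the same follows from
    characteristic [2], the structure constants being integers: the regular
    trace form is nondegenerate over the rationals, hence over any extension.
    A finite dimensional algebra without nonzero nil right ideals is von Neumann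
    regular, so that in the Karoubi envelope every monomorphism and every
    epimorphism splits, and all objects are finite sums of simple ones. *)

(* The trace that the measure provides is not the matrix trace of a representation, so no formal
   argument makes nilpotents traceless. This is the obstacle, and the Frobenius identity removes it
   only in positive characteristic. The transfer to characteristic 0 is possible because one family
   of integer structure constants describes an endomorphism algebra over all fields; the prime 2 in
   it is an arbitrary choice.

   The measure is used only through the interface [orbit_sign]. As its value on a map is a product
   of two signs, push-forward is a plain sum over orbits twisted by signs: functoriality holds
   because signs square to 1, and only base change rests on the counting of cells.

   The equation [a b a = a] is aimed at, instead of a structure theory of semisimple algebras,
   because it passes directly to the envelope and there produces retractions, kernels and cokernels
   by splitting idempotents. *)
From HB Require Import structures.
From mathcomp Require Import all_boot all_order all_algebra.
From mathcomp Require Import boolp classical_sets functions cardinality fsbigop.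
From mathcomp Require Import ring lra.
Require Import Defs.

Set Implicit Arguments.
Unset Strict Implicit.
Unset Printing Implicit Defensive.

Import Order.TTheory GRing.Theory Num.Theory.
Local Open Scope ring_scope.

(** * Open subgroups of the wreath product *)

(* [(a, Some b)] is the point [(a, b)] and [(a, None)] the fiber over [a]; an
   open subgroup is the pointwise stabilizer of a finite set of both kinds. The
   order [plt] is lexicographic, each fiber coming just before its points. *)
Notation pnt := (rat * option rat)%type.

(** The second coordinate [0] in the fiber case is arbitrary: by [wreath_fst] the image of the fiber
    does not depend on it. *)
Definition wact (g : wreath) (c : pnt) : pnt :=
  if c.2 is Some b then ((g (c.1, b)).1, Some (g (c.1, b)).2)
  else ((g (c.1, 0)).1, None).

Definition olt (x y : option rat) : bool :=
  match x, y with
  | None, Some _ => true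
  | Some b, Some b' => b < b'
  | _, None => false
  end.

Definition plt (c e : pnt) : bool :=
  (c.1 < e.1) || ((c.1 == e.1) && olt c.2 e.2).

Lemma wreath_fst (g : wreath) a b b' : (g (a, b)).1 = (g (a, b')).1.
Proof. by have [g0 [h [_ _ E]]] := wfunP g; rewrite !E. Qed.

Lemma wact1 c : wact 1%g c = c.
Proof. by case: c => a [b|]. Qed.

Lemma wactM (g h : wreath) c : wact (g * h)%g c = wact g (wact h c).
Proof.
case: c => a [b|]; rewrite /wact /=; first by rewrite -surjective_pairing.
by congr pair; rewrite [LHS](_ : _ = (g (h (a, 0))).1) // (surjective_pairing (h _))
  (wreath_fst _ _ _ 0).
Qed.

Lemma wactK (g : wreath) : cancel (wact g) (wact g^-1%g).
Proof. by move=> c; rewrite -wactM mulVg wact1. Qed.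

Lemma wactVK (g : wreath) : cancel (wact g^-1%g) (wact g).
Proof. by move=> c; rewrite -wactM mulgV wact1. Qed.

Lemma plt_wact g c e : plt (wact g c) (wact g e) = plt c e.
Proof.
have [g0 [h [[/bij_inj ginj gm] hP E]]] := wfunP g.
case: c e => a [b|] [a' [b'|]]; rewrite /plt /wact /= !E /= gm ?(inj_eq ginj) //.
by case: eqP => // <-; have [_ ->] := hP a.
Qed.

Lemma plt_irr c : plt c c = false.
Proof. by case: c => a [b|]; rewrite /plt /= ltxx ?eqxx //= ltxx. Qed.

Lemma plt_trans : transitive plt.
Proof.
move=> [a x] [a' x'] [a'' x''] /orP[/= h|/andP[/= /eqP-> h]] /orP[/= h'|/andP[/= /eqP<- h']];
  rewrite /plt /= ?(lt_trans h h') ?h ?h' //.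
rewrite eqxx /= ltxx; move: x x' x'' h h' => [b|] [b'|] [b''|] //=; exact: lt_trans.
Qed.

Lemma plt_total c e : [|| c == e, plt c e | plt e c].
Proof.
case: c e => a x [a' x']; rewrite /plt /= xpair_eqE.
case: (ltgtP a a') => [_|_|_] //=; rewrite ?orbT //=.
by move: x x' => [b|] [b'|] //=; rewrite -[_ == _]/(b == b'); case: (ltgtP b b').
Qed.

Lemma plt_max (s : seq pnt) : s != [::] ->
  exists2 c, c \in s & {in s, forall e, plt c e = false}.
Proof.
elim: s => // c s IH _; case: (altP (s =P [::])) => [->|/IH[d ds dP]].
  by exists c; rewrite ?inE // => e; rewrite inE => /eqP ->; rewrite plt_irr.
have [cd|cd] := boolP (plt d c).
  exists c => [|e]; first by rewrite inE eqxx.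
  rewrite inE => /orP[/eqP->|es]; first exact: plt_irr.
  by apply/negbTE/negP => ce; move: (dP e es); rewrite (plt_trans cd ce).
exists d => [|e]; first by rewrite inE ds orbT.
by rewrite inE => /orP[/eqP->|/dP //]; apply: negbTE.
Qed.

(** The points of one fiber, and likewise all fibers, form a copy of the rationals on which [plt] is
    the usual order. Parametrizing them alike lets each cell argument be done once, with cuts of
    rational numbers. *)
Definition line (k : option rat) (t : rat) : pnt :=
  if k is Some a then (a, Some t) else (t, None).

Definition kind (c : pnt) : option rat := if c.2 is Some _ then Some c.1 else None.

Lemma lineP c : exists t, c = line (kind c) t.
Proof. by case: c => a [b|]; [exists b | exists a]. Qed.

Lemma line_inj k : injective (line k).
Proof. by case: k => [a|] t u []. Qed.

Lemma plt_line k t u : plt (line k t) (line k u) = (t < u).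
Proof. by case: k => [a|]; rewrite /plt /= ?ltxx ?eqxx //= andbF orbF. Qed.

Definition pclosed (C : seq pnt) : Prop :=
  forall a b, (a, Some b) \in C -> (a, None) \in C.

(** Guarantees that the pointwise stabilizer of [C] preserves [line k]: the fiber that carries the
    line must itself be fixed. *)
Definition based (k : option rat) (C : seq pnt) : bool :=
  if k is Some a then (a, None) \in C else true.

Definition wfix (g : wreath) (C : seq pnt) : Prop := {in C, forall c, wact g c = c}.

Definition pts (k : option rat) (C : seq pnt) : seq rat :=
  [seq v <- [seq c.1 | c <- C] ++ pmap snd C | line k v \in C].

Lemma mem_pts k C v : (v \in pts k C) = (line k v \in C).
Proof.
rewrite mem_filter andb_idr // mem_cat; case: k => [a|] /= vC.
  by apply/orP; right; rewrite mem_pmap; apply/mapP; exists (a, Some v).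
by apply/orP; left; apply/mapP; exists (v, None).
Qed.

(** With both comparisons recorded, each element of [P] is a cell by itself; the other cells are the
    open gaps of [P]. *)
Definition same_cut (P : seq rat) (t u : rat) : Prop :=
  {in P, forall v, (v < t) = (v < u) /\ (t < v) = (u < v)}.

(** By homogeneity some order automorphism sends [t] to [u] and fixes [pts k C]. It is applied
    inside the fiber over [a], or to the base with the fibers carried along rigidly; in the second
    case closedness puts every point of [C] over a fixed fiber. *)
Lemma line_move k C t u : pclosed C -> based k C -> same_cut (pts k C) t u ->
  exists m, wfix m C /\ wact m (line k t) = line k u.
Proof.
move=> Ccl kC tu.
have [|g [ag gP]] := @autQ_homogeneous ((t, u) :: [seq (v, v) | v <- pts k C]).
  move=> p q; rewrite !inE => /orP[/eqP->|/mapP[v vP ->]] /orP[/eqP->|/mapP[w wP ->]] //=.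
  - by rewrite !ltxx.
  - by have [] := tu w wP.
  - by have [] := tu v vP.
have gt : g t = u by apply: (gP (t, u)); rewrite inE eqxx.
have gv v : v \in pts k C -> g v = v.
  by move=> vP; apply: (gP (v, v)); rewrite inE; apply/orP; right; apply: map_f.
case: k kC tu gv {gP} => [a /= aC|_] tu gv.
  have wP : in_wreath (fun p => (p.1, if p.1 == a then g p.2 else p.2)).
    exists id, (fun x => if x == a then g else id); split; first exact: autQ_id.
      by move=> x; case: ifP => _ //; exact: autQ_id.
    by move=> x y /=; case: ifP.
  exists (Wreath wP); split; last by rewrite /wact /= eqxx gt.
  move=> [x [y|]] xC; rewrite /wact //=; case: eqP => // xa.
  by rewrite gv // mem_pts /= -xa.
have wP : in_wreath (fun p => (g p.1, p.2)).
  exists g, (fun _ => id); split=> // _; exact: autQ_id.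
exists (Wreath wP); split; last by rewrite /wact /= gt.
move=> [x y] xC; have gx : g x = x.
  by apply: gv; rewrite mem_pts /=; case: y xC => // y; apply: Ccl.
by case: y xC => [y|] xC; rewrite /wact /= gx.
Qed.

Lemma wfix_cut g k C t u : wfix g C -> wact g (line k t) = line k u ->
  same_cut (pts k C) t u.
Proof.
move=> gC gt v; rewrite mem_pts => vC.
by rewrite -!(plt_line k) -gt -{2 4}(gC _ vC) !plt_wact.
Qed.

Lemma wact_line g k C t : wfix g C -> based k C ->
  exists u, wact g (line k t) = line k u.
Proof.
case: k => [a|] gC /= aC; rewrite /wact /=; last by eexists.
exists (g (a, t)).2; congr pair.
by have := gC _ aC; rewrite /wact /= => -[ga]; rewrite (wreath_fst _ _ _ 0).
Qed.

(** Outside [P] the cell of [t] is an open interval and has no least element; each element of [P]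
    below [t] costs one passage to a midpoint. *)
Lemma cut_below (P : seq rat) t : t \notin P ->
  exists u, u < t /\ same_cut P t u.
Proof.
elim: P => [|p P IH]; first by exists (t - 1); split=> //; rewrite ltrBlDr ltrDl.
rewrite inE negb_or => /andP[tp /IH[u [ut uP]]].
have [pt|tp'] := ltP p t; last first.
  have tp2 : t < p by rewrite lt_neqAle tp.
  exists u; split=> // v; rewrite inE => /orP[/eqP->|]; last exact: uP.
  by rewrite tp2 (lt_trans ut tp2) !ltNge tp' (ltW (lt_trans ut tp2)).
have mt : Num.max p u < t by rewrite gt_max pt ut.
pose w := (Num.max p u + t) / 2%:R.
have [w1 w2] : Num.max p u < w /\ w < t by rewrite /w; split; lra.
move: w1; rewrite gt_max => /andP[pw uw].
exists w; split=> // v; rewrite inE => /orP[/eqP->|vP].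
  by rewrite pt pw !ltNge (ltW pt) (ltW pw).
have [E1 E2] := uP v vP; split.
  by apply/idP/idP => [|h]; [rewrite E1 => /lt_trans; apply | exact: lt_trans h w2].
apply/idP/idP => [h|h]; first exact: lt_trans w2 h.
by rewrite E2; exact: lt_trans uw h.
Qed.

Lemma same_cut_sym P t u : same_cut P t u -> same_cut P u t.
Proof. by move=> h v /h[-> ->]. Qed.

Lemma same_cut_trans P t u v : same_cut P t u -> same_cut P u v -> same_cut P t v.
Proof. by move=> h h' w wP; have [-> ->] := h w wP; apply: h'. Qed.

Lemma same_cutN P t u : same_cut P t u ->
  same_cut [seq - p | p <- P] (- t) (- u).
Proof. by move=> h _ /mapP[v vP ->]; rewrite !ltrN2; have [-> ->] := h v vP. Qed.

Lemma cut_above (P : seq rat) t : t \notin P ->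
  exists u, t < u /\ same_cut P t u.
Proof.
move=> tP; have [|u [ut /same_cutN]] := @cut_below [seq - p | p <- P] (- t).
  by rewrite (mem_map oppr_inj).
rewrite -map_comp (eq_map (g := id)) ?map_id => [h|v]; last by rewrite /= opprK.
by exists (- u); split; [rewrite ltrNr | rewrite opprK in h].
Qed.

Lemma wfixM g h C : wfix g C -> wfix h C -> wfix (g * h)%g C.
Proof. by move=> gC hC c cC; rewrite wactM hC // gC. Qed.

Lemma wfixV g C : wfix g C -> wfix g^-1%g C.
Proof. by move=> gC c cC; rewrite -{1}(gC c cC) wactK. Qed.

Lemma wfix_sub g (C C' : seq pnt) : {subset C <= C'} -> wfix g C' -> wfix g C.
Proof. by move=> s gC c /s; apply: gC. Qed.

Lemma wfix_cons g c C : wfix g (c :: C) <-> wact g c = c /\ wfix g C.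
Proof.
split=> [h|[gc gC] e]; last by rewrite inE => /orP[/eqP->|/gC].
by split=> [|e eC]; apply: h; rewrite inE ?eqxx ?eC ?orbT.
Qed.

Lemma wfix_cat g C C' : wfix g (C ++ C') <-> wfix g C /\ wfix g C'.
Proof.
split=> [h|[gc gC] e]; last by rewrite mem_cat => /orP[/gc|/gC].
by split=> e eC; apply: h; rewrite mem_cat eC ?orbT.
Qed.

Lemma wfix_conj g h C : wfix (h * g * h^-1)%g [seq wact h c | c <- C] <-> wfix g C.
Proof.
split=> gC c cC.
  by have := gC _ (map_f _ cC); rewrite !wactM wactK => /(can_inj (wactK h)).
by move/mapP: cC => [e eC ->]; rewrite !wactM wactK gC.
Qed.

Lemma wact_fst g a y : (wact g (a, y)).1 = (wact g (a, None)).1.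
Proof. by case: y => [b|] //=; rewrite /wact /= (wreath_fst _ _ _ 0). Qed.

Lemma wact_outer g a b : wact g (a, Some b) = (a, Some b) -> wact g (a, None) = (a, None).
Proof.
move=> h; have := congr1 fst h; rewrite wact_fst /= => ga.
by rewrite /wact /= ga.
Qed.

Lemma pclosed_map g C : pclosed C -> pclosed [seq wact g c | c <- C].
Proof.
move=> Ccl a b /mapP[[a' [b'|]] cC] //; rewrite /wact /= => -[-> _].
by apply/mapP; exists (a', None); [apply: Ccl cC | rewrite /wact /= (wreath_fst _ _ _ 0)].
Qed.

Lemma pclosed_cat C C' : pclosed C -> pclosed C' -> pclosed (C ++ C').
Proof. by move=> h h' a b; rewrite !mem_cat => /orP[/h->|/h'->]; rewrite ?orbT. Qed.

Lemma pclosed_cons k t C : pclosed C -> based k C -> pclosed (line k t :: C).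
Proof.
move=> Ccl kC a b; rewrite !inE => /orP[/eqP e|/Ccl ->]; last by rewrite orbT.
by case: k kC e => [a'|] //= aC [-> _]; rewrite aC orbT.
Qed.

Lemma based_kind c C : pclosed (c :: C) -> based (kind c) C.
Proof.
by case: c => a [b|] //= /(_ a b); rewrite !inE eqxx /= => /(_ isT) /orP[/eqP|].
Qed.

Lemma same_cut_sub (P P' : seq rat) t u :
  {subset P <= P'} -> same_cut P' t u -> same_cut P t u.
Proof. by move=> s h v /s; apply: h. Qed.

Lemma pts_sub k (C C' : seq pnt) : {subset C <= C'} -> {subset pts k C <= pts k C'}.
Proof. by move=> s v; rewrite !mem_pts => /s. Qed.

(** * Supports of points of smooth sets *)

Section Support.
Variables (X : hset GwrG).
Implicit Types (x : X).

Definition isupp x (S : seq pnt) : Prop :=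
  pclosed S /\ forall g : GwrG, hact g x = x <-> wfix g S.

(* If [v] fixes [x] and moves [c] down, while [Stab(A)] fixes [x], then both
   [Stab(A)] and [Stab(vA)] fix [x], and together they can move [c] anywhere in
   its cell over [A \ c]; the part of [vA] above [c] is fixed by [v]. *)
Lemma supp_drop x (A : seq pnt) (v : GwrG) c : pclosed A ->
  (forall g : GwrG, wfix g A -> hact g x = x) -> hact v x = x -> c \in A ->
  plt (wact v c) c -> {in A, forall e, plt c e -> wact v e = e} ->
  let B := [seq e <- A | e != c] in
  pclosed B /\ forall g : GwrG, wfix g B -> hact g x = x.
Proof.
move=> Acl Ax vx cA vc vfix B.
have Bcl : pclosed B.
  move=> a b; rewrite !mem_filter => /andP[abc abA]; rewrite (Acl _ _ abA) andbT.
  apply/eqP => ac; move: vc; rewrite -ac (@wact_outer v a b) ?plt_irr //.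
  by apply: vfix => //; rewrite -ac /plt /= eqxx orbT.
have BA : {subset B <= A} by move=> e; rewrite mem_filter => /andP[].
have AcB : {subset A <= c :: B}.
  by move=> e eA; rewrite inE mem_filter eA andbT orbN.
have cB : based (kind c) B.
  apply: based_kind => a b h; apply/AcB/(Acl a b); move: h.
  by rewrite inE => /orP[/eqP->|/BA].
split=> // g gB.
have [t ct] := lineP c; set k := kind c in ct cB.
have [u gu] := wact_line t gB cB.
have tu : same_cut (pts k B) t u := wfix_cut gB gu.
(* If [n] acts on [c] and on [B] as [g] does, then [n^-1 g] fixes [A] pointwise and hence [x]; so
   [g] fixes [x] when [n] does. *)
suff [n [nx nB nc]] : exists n : GwrG, [/\ hact n x = x, wfix n B & wact n c = line k u].
  rewrite -[in RHS]nx -[g in LHS](mulVKg n) hactM; congr hact; apply: Ax => e /AcB.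
  rewrite inE => /orP[/eqP->|eB]; first by rewrite wactM ct gu -nc -ct wactK.
  by rewrite wactM gB // -{1}(nB e eB) wactK.
pose C := [seq wact v e | e <- A] ++ B.
have Ccl : pclosed C by apply: pclosed_cat => //; apply: pclosed_map.
have CB : {subset B <= C} by move=> e eB; rewrite mem_cat eB orbT.
have kC : based k C.
  by move: cB; case: (k) => [a|] //=; apply: CB.
have Cx (m : GwrG) : wfix m C -> hact m x = x.
  move=> /wfix_cat[mA _].
  have := Ax (v^-1 * m * v)%g; rewrite !hactM vx => E.
  apply: (can_inj (@hactK _ _ v^-1%g)); rewrite E; first by rewrite -{2}vx hactK.
  by apply/(wfix_conj _ v); rewrite !mulgA mulgV mul1g mulgK.
have Clt w : w \in pts k C -> w \in pts k B \/ w < t.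
  rewrite mem_pts mem_cat => /orP[/mapP[e eA we]|]; last by rewrite -mem_pts; left.
  have [ce|] := boolP (plt c e).
    rewrite vfix // in we; left; rewrite mem_pts we mem_filter eA andbT.
    by apply: contraTneq ce => ->; rewrite plt_irr.
  move=> nce; right; rewrite -(plt_line k) we -ct.
  case/or3P: (plt_total c e) => [/eqP<- //|ce|ec]; first by rewrite ce in nce.
  by apply: plt_trans vc; rewrite plt_wact.
have tC : t \notin pts k C.
  apply/negP => /Clt[|]; last by rewrite ltxx.
  by rewrite mem_pts mem_filter -ct eqxx.
(* Downwards two moves are needed: the stabilizer of [C] pushes [t] slightly down, off the point [c]
   of [A], and from there the stabilizer of [A] reaches [u]. Upwards [C] has no obstacle beyond
   those in [B], so one move suffices. *)
have [ut|tu'] := ltP u t.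
  have [q [qt tq]] := cut_below tC.
  have [m [mC mt]] := line_move Ccl kC tq.
  have qu : same_cut (pts k A) q u.
    move=> w; rewrite mem_pts => /AcB; rewrite inE ct => /orP[/eqP/line_inj->|wB].
      by rewrite qt ut !ltNge (ltW qt) (ltW ut).
    rewrite -mem_pts in wB.
    have [<- <-] := tu w wB; have [|-> ->//] := tq w.
    exact: pts_sub wB.
  have [|n [nA nq]] := line_move Acl _ qu.
    by move: cB; case: (k) => [a|] //=; apply: BA.
  exists (n * m)%g; rewrite hactM wactM ct mt nq; split=> //.
    by rewrite Cx ?Ax.
  by apply: wfixM; [apply: wfix_sub nA | apply: wfix_sub mC].
have [|m [mC mt]] := @line_move k C t u Ccl kC.
  move=> w /Clt[/tu//|wt]; have wu := lt_le_trans wt tu'.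
  by rewrite wt wu !ltNge (ltW wt) (ltW wu).
exists m; split; [exact: Cx | exact: wfix_sub mC | by rewrite ct].
Qed.

Lemma wact_lt_inv (g : wreath) c : plt c (wact g c) -> plt (wact g^-1%g c) c.
Proof. by rewrite -(plt_wact g^-1%g) wactK. Qed.

Lemma supp_exists x : exists S, isupp x S.
Proof.
have [A0 A0x] := hopen x.
pose A1 : seq pnt := flatten [seq [:: (p.1, None);
  (p.1, Some p.2)] | p <- A0 : seq (rat * rat)].
have A1cl : pclosed A1.
  move=> a b /flattenP[_ /mapP[p pA ->]]; rewrite !inE => /orP[/eqP//|/eqP[-> _]].
  by apply/flattenP; eexists; [apply: map_f pA | rewrite inE eqxx].
have A1x (g : GwrG) : wfix g A1 -> hact g x = x.
  move=> gA; apply: A0x => -[a b] pA /=.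
  have : (a, Some b) \in A1.
    by apply/flattenP; eexists; [apply: map_f pA | rewrite !inE eqxx orbT].
  by move=> /gA; rewrite /wact /= => -[e1 e2]; rewrite (surjective_pairing (wfun g _)) e1 e2.
have [n] := ubnP (size A1); elim: n A1 A1cl A1x => // n IH A Acl Ax An.
pose M := [seq e <- A | `[< exists g : GwrG, hact g x = x /\ wact g e <> e >]].
have [M0|/plt_max[c]] := eqVneq M [::].
  exists A; split=> // g; split=> [gx e eA|]; last exact: Ax.
  apply: contrapT => ge; have : e \in M.
    by rewrite mem_filter eA andbT; apply/asboolP; exists g.
  by rewrite M0.
rewrite mem_filter => /andP[/asboolP[g [gx gc]] cA] cmax.
(* An element that moves [c] up is replaced by its inverse, which moves [c] down. *)
have [v [vx vc]] : exists v : GwrG, hact v x = x /\ plt (wact v c) c.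
  case/or3P: (plt_total (wact g c) c) => [/eqP//|h|h]; first by exists g.
  exists g^-1%g; split; last exact: wact_lt_inv.
  by rewrite -{1}gx hactK.
have [|Bcl Bx] := supp_drop Acl Ax vx cA vc.
  move=> e eA ce; apply: contrapT => ve; have /cmax : e \in M.
    by rewrite mem_filter eA andbT; apply/asboolP; exists v.
  by rewrite ce.
apply: IH Bcl Bx _; rewrite ltnS in An; apply: leq_trans An.
have : (0 < count_mem c A)%N by rewrite -has_count has_pred1.
by move=> h; rewrite size_filter -(count_predC (pred1 c) A) -[ltnLHS]add0n ltn_add2r.
Qed.

End Support.

(** If the fiber of [c] is not in [C], the line of [c] need not be stable, but then that fiber can
    be moved and takes [c] with it. *)
Lemma wfix_move C c : pclosed C -> c \notin C -> exists m, wfix m C /\ wact m c <> c.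
Proof.
move=> Ccl; have [t ->] := lineP c; set k := kind c.
have main k' t' : based k' C -> line k' t' \notin C ->
    exists m, wfix m C /\ wact m (line k' t') <> line k' t'.
  move=> kC; rewrite -mem_pts => /cut_below[u [ut tu]].
  have [m [mC mt]] := line_move Ccl kC tu.
  by exists m; split=> //; rewrite mt => /line_inj E; rewrite E ltxx in ut.
have [kC|] := boolP (based k C); first exact: main.
case: k => [a|] //= aC _.
have [m [mC mt]] := main None a isT aC; exists m; split=> // E.
exact/mt/(wact_outer E).
Qed.

(** An element of [C] outside [C'] could be moved by the stabilizer of [C']. This makes supports
    unique, and smaller for larger stabilizers. *)
Lemma supp_subset (C C' : seq pnt) : pclosed C' ->
  (forall g, wfix g C' -> wfix g C) -> {subset C <= C'}.
Proof.
move=> Ccl h c cC; apply: contrapT => /negP /(wfix_move Ccl)[m [/h mC]]; apply.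
exact: mC.
Qed.

(** Lists stand for finite sets and unions are formed by [++], so duplicates must not count. *)
Definition psz (C : seq pnt) : nat := size (undup C).
Definition psgn (C : seq pnt) : int := (-1) ^+ psz C.

Lemma psgn_eq (C C' : seq pnt) : C =i C' -> psgn C = psgn C'.
Proof.
move=> E; rewrite /psgn /psz (@perm_size _ (undup C) (undup C')) //.
by apply: uniq_perm; rewrite ?undup_uniq // => c; rewrite !mem_undup.
Qed.

Lemma psgn_sq C : psgn C * psgn C = 1.
Proof. by rewrite /psgn -signr_odd; case: odd; rewrite ?mulrNN mulr1. Qed.

Lemma psgn_cons c C : psgn (c :: C) = (if c \in C then 1 else -1) * psgn C.
Proof. by rewrite /psgn /psz /=; case: ifP => _; rewrite ?mul1r // exprS. Qed.

Lemma psgn_map g C : psgn [seq wact g c | c <- C] = psgn C.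
Proof.
by rewrite /psgn /psz undup_map_inj ?size_map //; apply: can_inj (wactK g).
Qed.

(** The order [plt] is total and invariant, so a point that is moved drifts strictly in one
    direction and never returns. *)
Lemma wact_iter_fix (g : wreath) n c : (0 < n)%N -> wact (g ^+ n)%g c = c -> wact g c = c.
Proof.
have up (h : wreath) m e : plt e (wact h e) -> plt e (wact (h ^+ m.+1)%g e).
  move=> he; elim: m => [|m IH] //; rewrite expgS wactM.
  by apply: plt_trans he _; rewrite plt_wact.
case: n => // n _ E; case/or3P: (plt_total (wact g c) c) => [/eqP//|/= lt|/(up _ n)];
  last first.
  by rewrite E plt_irr.
have : plt c (wact g^-1%g c) by rewrite -(plt_wact g) wactVK.
by move=> /(up _ n); rewrite expVgn -{2}E wactK plt_irr.
Qed.

Lemma hact_torsion_free (X : hset GwrG) (x : X) (g : GwrG) n : (0 < n)%N ->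
  hact (g ^+ n)%g x = x -> hact g x = x.
Proof.
move=> n0; have [S [_ SP]] := supp_exists x => /SP h; apply/SP => c cS.
by apply: wact_iter_fix n0 _; apply: h.
Qed.

(** * Euler characteristic of cells *)

Lemma same_cut_refl P t : same_cut P t t.
Proof. by []. Qed.

Lemma same_cut_cons e P u r : same_cut (e :: P) u r <->
  [/\ (e < u) = (e < r), (u < e) = (r < e) & same_cut P u r].
Proof.
split=> [h|[h1 h2 h] v]; last by rewrite inE => /orP[/eqP->|/h].
have [|h1 h2] := h e; first by rewrite inE eqxx.
by split=> // v vP; apply: h; rewrite inE vP orbT.
Qed.

Lemma same_cut_mem P u r : r \in P -> same_cut P u r -> u = r.
Proof. by move=> rP /(_ r rP); rewrite !ltxx; case: ltgtP => // ? []. Qed.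

Lemma same_cut_between P u u' e :
  same_cut P u u' -> u <= e <= u' -> same_cut P u e.
Proof.
move=> h /andP[ue eu] v /h[h1 h2]; split; apply/idP/idP.
- by move=> vu; apply: lt_le_trans vu ue.
- by move=> ve; rewrite h1; apply: lt_le_trans ve eu.
- by rewrite h2; apply: le_lt_trans eu.
- exact: le_lt_trans ue.
Qed.

(** Cells are convex: an [e] between [u] and [u'] would lie in their cell. *)
Lemma same_cut_side P u u' e : same_cut P u u' -> ~ same_cut P u e ->
  (e < u) = (e < u') /\ (u < e) = (u' < e).
Proof.
move=> h ne; have ne' : ~ same_cut P u' e.
  by move=> h'; apply: ne; apply: same_cut_trans h'.
have ue : u != e by apply/eqP => E; apply: ne; rewrite -E; apply: same_cut_refl.
have ue' : u' != e by apply/eqP => E; apply: ne'; rewrite -E; apply: same_cut_refl.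
have [lt|lt|/eqP] := ltgtP u e; last by rewrite (negbTE ue).
  have [//|lt'|/eqP] := ltgtP u' e; last by rewrite (negbTE ue').
  by case: ne; apply: same_cut_between h _; rewrite !ltW.
have [lt'|//|/eqP] := ltgtP u' e; last by rewrite (negbTE ue').
by case: ne'; apply: same_cut_between (same_cut_sym h) _; rewrite !ltW.
Qed.

(* Euler characteristic with compact support: points count [1], gaps [-1], and
   an open interval has total [-1] however it is subdivided. *)
Lemma cells (P Q : seq rat) t : t \notin P -> exists R : seq rat,
  [/\ uniq R, {in R, forall r, same_cut P t r},
      forall u, same_cut P t u -> exists2 r, r \in R & same_cut (Q ++ P) u r,
      {in R &, forall r r', same_cut (Q ++ P) r r' -> r = r'} &
      \sum_(r <- R) (if r \in Q ++ P then 1 else -1) = -1 :> int].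
Proof.
move=> tP; elim: Q => [|e Q [R [Ru RJ Rs Ri RS]]] /=.
  exists [:: t]; split=> //.
  - by move=> r; rewrite inE => /eqP->; apply: same_cut_refl.
  - by move=> u tu; exists t; [rewrite inE | apply: same_cut_sym].
  - by move=> r r'; rewrite !inE => /eqP-> /eqP->.
  - by rewrite big_seq1 (negbTE tP).
set P1 := Q ++ P in Rs Ri RS *.
have P1P : {subset P <= P1} by move=> v vP; rewrite mem_cat vP orbT.
have [eP|eP] := boolP (e \in P1).
  have E u r : same_cut (e :: P1) u r <-> same_cut P1 u r.
    by rewrite same_cut_cons; split=> [[]|h] //; have [] := h e eP.
  exists R; split=> // [u /Rs[r rR ur]|r r' rR r'R /E|].
  - by exists r => //; apply/E.
  - exact: Ri.
  - by rewrite -RS; apply: eq_bigr => r _; rewrite inE; case: eqP => // ->; rewrite eP.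
have [eJ|eJ] := pselect (same_cut P t e); last first.
  have side u r : same_cut P t u -> same_cut P1 u r -> same_cut (e :: P1) u r.
    move=> tu ur; apply/same_cut_cons; have [||-> ->] := @same_cut_side P u r e => //.
      exact: same_cut_sub ur.
    by move=> ue; apply: eJ; apply: same_cut_trans ue.
  exists R; split=> // [u tu|r r' rR r'R /same_cut_cons[_ _]|].
  - by have [r rR ur] := Rs u tu; exists r => //; apply: side.
  - exact: Ri.
  - rewrite -RS big_seq [RHS]big_seq; apply: eq_bigr => r rR; rewrite inE.
    by case: eqP => // re; case: eJ; rewrite -re; apply: RJ.
have [r0 r0R er0] := Rs e eJ.
have [a [ae ea]] := cut_below eP; have [b [eb be]] := cut_above eP.
have notP v : same_cut P1 e v -> v \notin P1.
  by move=> ev; apply: contra eP => vP; rewrite (same_cut_mem vP ev).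
have remP r : (r \in rem r0 R) = (r != r0) && (r \in R) by rewrite mem_rem_uniq // inE.
have notrem v : same_cut P1 e v -> v \notin rem r0 R.
  move=> ev; rewrite remP; apply/negP => /andP[/eqP h vR]; apply: h.
  by apply: Ri => //; apply: same_cut_trans er0; apply: same_cut_sym.
have ee : same_cut P1 e e by apply: same_cut_refl.
have ab := lt_trans ae eb.
(* The new cut [e] splits the gap of [r0] into the gap of [a], the point [e] and the gap of [b]; the
   contributions [-1 + 1 - 1] replace the old [-1]. *)
exists [:: e, a, b & rem r0 R]; split.
- rewrite /= !inE !negb_or (gt_eqF ae) (lt_eqF eb) (lt_eqF ab) /=.
  by rewrite !notrem //= rem_uniq.
- move=> r; rewrite !inE => /or4P[/eqP->|/eqP->|/eqP->|]; last first.
    by rewrite remP => /andP[_ /RJ].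
  + by apply: same_cut_trans eJ _; apply: same_cut_sub be.
  + by apply: same_cut_trans eJ _; apply: same_cut_sub ea.
  + exact: eJ.
- move=> u tu; have [r rR ur] := Rs u tu.
  have [rr0|rr0] := eqVneq r r0.
    have eu : same_cut P1 e u.
      by apply: same_cut_trans er0 _; rewrite -rr0; apply: same_cut_sym.
    have ue := same_cut_sym eu.
    have [lt|lt|->] := ltgtP u e.
    + exists a; first by rewrite !inE eqxx orbT.
      apply/same_cut_cons; split; last exact: same_cut_trans ue ea.
        by rewrite !ltNge (ltW lt) (ltW ae).
      by rewrite lt ae.
    + exists b; first by rewrite !inE eqxx !orbT.
      apply/same_cut_cons; split; last exact: same_cut_trans ue be.
        by rewrite lt eb.
      by rewrite !ltNge (ltW lt) (ltW eb).
    + by exists e; [rewrite inE eqxx | apply: same_cut_refl].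
  exists r; first by rewrite !inE remP rr0 rR !orbT.
  apply/same_cut_cons; have [||-> ->] := @same_cut_side P1 u r e => //.
  move=> ue; case/eqP: rr0; apply: Ri => //.
  by apply: same_cut_trans (same_cut_sym ur) _; apply: same_cut_trans er0.
- have main r r' : r \in [:: e, a, b & rem r0 R] -> r' \in [:: e, a, b & rem r0 R] ->
    same_cut (e :: P1) r r' -> r' \in rem r0 R -> r = r'.
    move=> rR _ /same_cut_cons[_ _ rr'] r'R; move: rR; rewrite !inE.
    case/or4P => [/eqP E|/eqP E|/eqP E|]; last first.
      by move: r'R; rewrite !remP => /andP[_ ?] /andP[_ ?]; apply: Ri.
    1-3: suff : r' \notin rem r0 R by rewrite r'R.
    1-3: by apply: notrem; rewrite E in rr'; apply: same_cut_trans rr'.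
  move=> r r' rR r'R rr'; have rr := same_cut_sym rr'.
  have [|nr'] := boolP (r' \in rem r0 R); first exact: main.
  have [|nr] := boolP (r \in rem r0 R); first by move=> h; rewrite (main r' r).
  move: rR r'R rr' {rr}; rewrite !inE (negbTE nr) (negbTE nr') !orbF.
  by case/or3P => /eqP-> /or3P[]/eqP-> /same_cut_cons[];
    rewrite ?ltxx ?ae ?eb ?(lt_gtF ae) ?(lt_gtF eb).
- move: RS; rewrite (perm_big _ (perm_to_rem r0R)) /= big_cons (negbTE (notP _ er0)).
  rewrite !big_cons !inE eqxx (lt_eqF ae) (gt_eqF eb) /=.
  rewrite (negbTE (notP _ ea)) (negbTE (notP _ be)) => <-.
  rewrite addrA addrN add0r; congr (_ + _); rewrite big_seq [RHS]big_seq.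
  apply: eq_bigr => r rR; rewrite inE; case: eqP => // re.
  by move: (notrem e ee); rewrite -re rR.
Qed.

(* The translates [r x], for [r] in [R], represent the [Stab(A')]-orbits on
   [Stab(A) x]. *)
Definition orbit_list (T : Type) (act : GwrG -> T -> T) (x : T) (A A' : seq pnt)
    (R : seq GwrG) : Prop :=
  [/\ uniq R, {in R, forall g, wfix g A},
      forall g : GwrG, wfix g A -> exists2 r, r \in R &
        exists h : GwrG, wfix h A' /\ act h (act g x) = act r x &
      forall r r' (h : GwrG), r \in R -> r' \in R -> wfix h A' ->
        act h (act r x) = act r' x -> r = r'].

(** The orbits are the subcells that [A'] cuts out of the cell of [t]. Adjoining a representative to
    [A'] flips the sign exactly when it is not already in [A'], so the sum is [psgn A'] times the
    Euler characteristic [-1] of the cell. *)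
Lemma orbit_list_line k t A A' : pclosed A -> pclosed A' -> {subset A <= A'} ->
  based k A -> line k t \notin A ->
  exists R, orbit_list wact (line k t) A A' R /\
    \sum_(r <- R) psgn (wact r (line k t) :: A') = - psgn A'.
Proof.
move=> Acl A'cl AA' kA; rewrite -mem_pts => tA.
have kA' : based k A' by case: k kA {tA} => [a|] //=; apply: AA'.
have ptA v : v \in pts k A' -> v \in pts k A' ++ pts k A by rewrite mem_cat => ->.
have Apt v : v \in pts k A' ++ pts k A -> v \in pts k A'.
  by rewrite mem_cat => /orP[//|]; apply: pts_sub.
have [R [Ru RJ Rs Ri RS]] := cells (pts k A') tA.
have [f fP] : {f : rat -> GwrG & forall u, same_cut (pts k A) t u ->
    wfix (f u) A /\ wact (f u) (line k t) = line k u}.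
  apply: (@choice _ _ (fun u (g : GwrG) => same_cut (pts k A) t u ->
    wfix g A /\ wact g (line k t) = line k u)) => u.
  have [tu|ntu] := pselect (same_cut (pts k A) t u); last by exists 1%g.
  by have [m mP] := line_move Acl kA tu; exists m.
have fR u : u \in R -> wfix (f u) A /\ wact (f u) (line k t) = line k u.
  by move=> /RJ; apply: fP.
have finj : {in R &, injective f}.
  move=> u v uR vR E; apply: (@line_inj k).
  by rewrite -(fR u uR).2 -(fR v vR).2 E.
exists [seq f u | u <- R]; split; first split.
- by rewrite map_inj_in_uniq.
- by move=> _ /mapP[u uR ->]; exact: (fR u uR).1.
- move=> g gA; have [u gu] := wact_line t gA kA.
  have [r rR ur] := Rs u (wfix_cut gA gu); exists (f r); first exact: map_f.
  have [h [hA hu]] := line_move A'cl kA' (same_cut_sub ptA ur).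
  by exists h; split=> //; rewrite gu hu (fR r rR).2.
- move=> _ _ h /mapP[u uR ->] /mapP[v vR ->] hA.
  rewrite (fR u uR).2 (fR v vR).2 => /(wfix_cut hA) uv.
  by congr f; apply: Ri => //; apply: same_cut_sub uv.
have {}RS : _ = - GRing.one int := RS.
rewrite big_map -[RHS]mulN1r -RS mulr_suml big_seq [RHS]big_seq.
apply: eq_bigr => u uR; rewrite psgn_cons (fR u uR).2 -mem_pts; congr (_ * _).
by congr (if _ then _ else _); apply/idP/idP => [/ptA|/Apt].
Qed.

Lemma psgn_subset (C C' : seq pnt) : {subset C <= C'} -> psgn (C ++ C') = psgn C'.
Proof.
move=> s; apply: psgn_eq => c; rewrite mem_cat; apply/orP/idP => [[/s//|//]|]; by right.
Qed.

(** Induction on the number of elements of [S] outside [A]. For one such [c], the orbits are sorted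
    by the position [g c], which [orbit_list_line] counts; over each position the induction
    hypothesis counts the rest, with [g c] adjoined to both sets. Adjoining [c] to [A] costs one
    sign, the cell of [c] costs another, and they cancel. *)
Lemma orbit_list_supp (X : hset GwrG) (x : X) A A' S : isupp x S ->
  pclosed A -> pclosed A' -> {subset A <= A'} -> {subset A <= S} ->
  exists R, orbit_list (@hact GwrG X) x A A' R /\
    \sum_(r <- R) psgn ([seq wact r c | c <- S] ++ A') = psgn S * psgn A * psgn A'.
Proof.
have [n] := ubnP (size (undup [seq c <- S | c \notin A])).
elim: n x A A' S => // n IH x A A' S; rewrite ltnS => Sn [Scl Sx] Acl A'cl AA' AS.
have [SA|] := boolP (all (mem A) S).
  have {SA}SA : {subset S <= A} by move=> c cS; apply: (allP SA).
  have fixx (g : GwrG) : wfix g A -> hact g x = x.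
    by move=> gA; apply/Sx; apply: wfix_sub gA.
  exists [:: 1%g]; split; first split=> //.
  - by move=> g; rewrite inE => /eqP-> c _; rewrite wact1.
  - move=> g gA; exists 1%g; rewrite ?inE //; exists 1%g; split.
      by move=> c _; rewrite wact1.
    by rewrite !hact1 fixx.
  - by move=> r r' h; rewrite !mem_seq1 => /eqP er /eqP er'; rewrite er er'.
  rewrite big_seq1 (eq_map (g := id)) ?map_id; last exact: wact1.
  rewrite psgn_subset; last by move=> c /SA/AA'.
  rewrite (@psgn_eq S A) ?psgn_sq ?mul1r // => c.
  by apply/idP/idP => [/SA|/AS].
move=> /allPn[c0 c0S c0A].
(* A point is chosen only if its fiber is already in [A], and otherwise the fiber itself, so that
   [A] stays closed once [c] is adjoined. *)
have [c [cS cA cbase]] : exists c, [/\ c \in S, c \notin A & based (kind c) A].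
  case: c0 c0S c0A => a [b|] c0S c0A; last by exists (a, None).
  have [aA|aA] := boolP ((a, None) \in A); first by exists (a, Some b).
  by exists (a, None); split=> //; apply: Scl c0S.
have [t ct] := lineP c; move: (kind c) ct cbase => k ct cbase; subst c.
set c := line k t in cS cA.
have [R1 [[R1u R1A R1s R1i] R1S]] := orbit_list_line Acl A'cl AA' cbase cA.
pose P g R := orbit_list (@hact GwrG X) (hact g x) (wact g c :: A) (wact g c :: A') R /\
    \sum_(r <- R) psgn ([seq wact r d | d <- [seq wact g e | e <- S]] ++ wact g c :: A')
     = psgn S * psgn (c :: A) * psgn (wact g c :: A').
have [f fP] : {f : GwrG -> seq GwrG & forall g, wfix g A -> P g (f g)}.
  apply: (@choice _ _ (fun (g : GwrG) R => wfix g A -> P g R)) => g.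
  have [gA|ngA] := pselect (wfix g A); last by exists [::].
  have [u gu] := wact_line t gA cbase.
  have gmem e : e \in S -> wact g e \in [seq wact g e | e <- S] by apply: map_f.
  have A'k : based k A' by case: (k) cbase => [a|] //=; apply: AA'.
  have gAe e : e \in A -> e \in [seq wact g e | e <- S].
    by move=> eA; rewrite -(gA e eA); apply/gmem/AS.
  have [|||||| R RP] := IH (hact g x) (wact g c :: A) (wact g c :: A') [seq wact g e | e <- S].
  - apply: leq_trans Sn.
    have -> : [seq d <- [seq wact g e | e <- S] | d \notin wact g c :: A] =
              [seq wact g e | e <- S & e \notin c :: A].
      rewrite filter_map; congr map; apply: eq_filter => e /=.
      rewrite !inE (inj_eq (can_inj (wactK g))); congr (~~ (_ || _)).
      apply/idP/idP => [eA|eA]; last by rewrite gA.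
      by rewrite -(wactK g e) (wfixV gA).
    rewrite undup_map_inj ?size_map; last exact: can_inj (wactK g).
    have -> : [seq e <- S | e \notin c :: A] =
              [seq e <- [seq e <- S | e \notin A] | e != c].
      by rewrite -filter_predI; apply: eq_filter => e /=; rewrite inE negb_or.
    rewrite -filter_undup size_filter -(count_predC (pred1 c) (undup _)).
    rewrite -[ltnLHS]add0n ltn_add2r -has_count has_pred1 mem_undup mem_filter.
    by rewrite cA.
  - split; first exact: pclosed_map.
    move=> h; have -> : hact h (hact g x) = hact g x <-> hact (g^-1 * h * g)%g x = x.
      rewrite !hactM; split=> [->|E]; first by rewrite hactK.
      by rewrite -[X in X = _](hactVK g) E.
    rewrite Sx -(wfix_conj _ g).
    by have -> : (g * (g^-1 * h * g) * g^-1 = h)%g by rewrite !mulgA mulgV mul1g mulgK.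
  - by rewrite gu; apply: pclosed_cons.
  - by rewrite gu; apply: pclosed_cons.
  - by move=> e; rewrite !inE => /orP[->//|/AA'->]; rewrite orbT.
  - by move=> e; rewrite inE => /orP[/eqP->|/gAe//]; apply: gmem.
  exists R => _; rewrite /P.
  have E : psgn (c :: A) = psgn (wact g c :: A).
    have -> : wact g c :: A = [seq wact g e | e <- c :: A].
      by congr cons; rewrite -[LHS]map_id; apply/eq_in_map => e eA; rewrite gA.
    by rewrite psgn_map.
  by rewrite E -(psgn_map g S).
have fR g : g \in R1 -> P g (f g) by move=> /R1A; apply: fP.
(* First [g] places [c]; then [r], which fixes [g c], places the rest of [x]. *)
exists [seq (r * g)%g | g <- R1, r <- f g]; split; first split.
- apply: allpairs_uniq_dep => //.
    by move=> g gR; have [[]] := fR g gR.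
  move=> [g r] [g' r'] /allpairsPdep[g1 [r1 [gR rR E1]]] /allpairsPdep[g1' [r1' [gR'
    rR' E1']]] /= E.
  have [/= Eg Er] := (congr1 tag E1, congr1 (fun p : {_ : GwrG & GwrG} => tagged p) E1).
  have [/= Eg' Er'] := (congr1 tag E1', congr1 (fun p : {_ : GwrG & GwrG} => tagged p) E1').
  move: gR rR gR' rR'; rewrite -{}Eg -{}Er -{}Eg' -{}Er' => gR rR gR' rR' {E1 E1' g1 r1
    g1' r1'}.
  have rc : wact r (wact g c) = wact g c.
    have [[_ rA _ _] _] := fR g gR; apply: (rA r rR); exact: mem_head.
  have rc' : wact r' (wact g' c) = wact g' c.
    have [[_ rA _ _] _] := fR g' gR'; apply: (rA r' rR'); exact: mem_head.
  have gg' : g = g'.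
    apply: (R1i g g' 1%g) => //; first by move=> d _; rewrite wact1.
    by rewrite wact1 -rc -rc' -!wactM E.
  by subst; rewrite (mulIg _ _ _ E).
- move=> _ /allpairsPdep[g [r [gR rR ->]]]; apply: wfixM; last exact: R1A.
  have [[_ rA _ _] _] := fR g gR.
  by have /wfix_cons[] := rA r rR.
- move=> g gA; have [g1 g1R [h [hA hg]]] := R1s g gA.
  have [[_ _ fs _] _] := fR g1 g1R.
  have [|r rR [h' [h'A h'r]]] := fs (h * g * g1^-1)%g.
    apply/wfix_cons; split; first by rewrite !wactM wactK.
    apply: wfixM; last exact/wfixV/R1A.
    by apply: wfixM => //; apply: wfix_sub hA.
  exists (r * g1)%g; first by apply/allpairsPdep; exists g1, r.
  exists (h' * h)%g; split.
    by apply: wfixM => //; have /wfix_cons[] := h'A.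
  by rewrite !hactM -h'r !hactM hactK.
- move=> _ _ h /allpairsPdep[g [r [gR rR ->]]] /allpairsPdep[g' [r' [gR' rR' ->]]] hA E.
  have [[_ rA _ ri] _] := fR g gR; have [[_ rA' _ _] _] := fR g' gR'.
  have rc : wact r (wact g c) = wact g c by apply: (rA r rR); exact: mem_head.
  have rc' : wact r' (wact g' c) = wact g' c by apply: (rA' r' rR'); exact: mem_head.
  (* Whatever fixes [x] fixes the point [c] of its support; hence translates of [x] in one orbit
     have their positions of [c] in one orbit, and [g = g']. *)
  have hc : wact h (wact g c) = wact g' c.
    have /Sx/(_ c cS) : hact ((r' * g')^-1 * (h * (r * g)))%g x = x.
      by rewrite hactM hactM E hactK.
    rewrite wactM => /(congr1 (wact (r' * g')%g)); rewrite wactVK !wactM rc rc'.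
    by [].
  have gg' : g = g' by apply: R1i hc.
  subst g'; congr (_ * _)%g; apply: (ri r r' h) => //.
    by apply/wfix_cons.
  by move: E; rewrite !hactM.
rewrite big_allpairs_dep /=.
have E g : g \in R1 -> \sum_(r <- f g) psgn ([seq wact (r * g)%g e | e <- S] ++ A') =
    - (psgn S * psgn A) * psgn (wact g c :: A').
  move=> gR; have [[_ rA _ _] /= S1] := fR g gR.
  have -> : - (psgn S * psgn A) * psgn (wact g c :: A') =
      psgn S * psgn (c :: A) * psgn (wact g c :: A').
    by rewrite (psgn_cons c A) (negbTE cA); ring.
  rewrite -S1 big_seq [RHS]big_seq; apply: eq_bigr => r rR.
  have -> : [seq wact r d | d <- [seq wact g e | e <- S]] = [seq wact (r * g)%g e | e <- S].
    by rewrite -map_comp; apply: eq_map => e /=; rewrite wactM.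
  apply: psgn_eq => e; rewrite !mem_cat inE; case: eqP => // ->.
  have -> // : wact g c \in [seq wact (r * g)%g e0 | e0 <- S].
  apply/mapP; exists c => //; rewrite wactM; symmetry.
  by apply: (rA r rR); apply: mem_head.
rewrite big_seq (eq_bigr _ E) -big_seq -mulr_sumr R1S; ring.
Qed.

(** * Measures with values 1 and -1 *)

Section Pushforward.
Variable H : permGroup.
Implicit Types X Y Z : hset H.

(** Says that sending [x] to [y] extends to an equivariant map from the orbit of [x] to that of
    [y]. *)
Definition stab_le X Y (x : X) (y : Y) : Prop :=
  forall g : H, hact g x = x -> hact g y = y.

(** A measure with values [1] and [-1] whose value on a map [Y -> X] of
    transitive sets is [sgn y * sgn x]. *)
Record orbit_sign := OrbitSign {
  sgn : forall X, X -> int;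
  sgn_sq : forall X (x : X), sgn x * sgn x = 1;
  sgn_stab : forall X Y (x : X) (y : Y), stab_le x y -> stab_le y x -> sgn x = sgn y;
  sgn_hact : forall X (g : H) (x : X), sgn (hact g x) = sgn x;
  sgn_fib : forall X Y X' (x : X) (y : Y) (x' : X'), stab_le x y -> stab_le x' y ->
    exists R : seq H, [/\ uniq R, {in R, forall r, hact r y = y},
      forall g : H, hact g y = y -> exists2 r, r \in R &
        exists h : H, hact h x' = x' /\ hact h (hact g x) = hact r x,
      forall r r' h : H, r \in R -> r' \in R -> hact h x' = x' ->
        hact h (hact r x) = hact r' x -> r = r' &
      \sum_(r <- R) sgn ((hact r x, x') : hprod X X') = sgn x * sgn y * sgn x'] }.

End Pushforward.

Definition supp (X : hset GwrG) (x : X) : seq pnt := projT1 (cid (supp_exists x)).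

Lemma suppP (X : hset GwrG) (x : X) : isupp x (supp x).
Proof. by rewrite /supp; case: cid. Qed.

Lemma isupp_sub (X Y : hset GwrG) (x : X) (y : Y) S T :
  isupp x S -> isupp y T -> stab_le x y -> {subset T <= S}.
Proof.
move=> [Scl SP] [Tcl TP] xy; apply: supp_subset => // g /SP /xy; exact: (TP g).1.
Qed.

Lemma isupp_psgn (X : hset GwrG) (x : X) S : isupp x S -> psgn (supp x) = psgn S.
Proof.
move=> SP; apply: psgn_eq => c; apply/idP/idP; exact: (isupp_sub SP (suppP x)) ||
  exact: (isupp_sub (suppP x) SP).
Qed.

Lemma isupp_hact (X : hset GwrG) (g : GwrG) (x : X) S : isupp x S ->
  isupp (hact g x) [seq wact g c | c <- S].
Proof.
move=> [Scl SP]; split; first exact: pclosed_map.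
move=> h; have -> : hact h (hact g x) = hact g x <-> hact (g^-1 * h * g)%g x = x.
  rewrite !hactM; split=> [->|E]; first by rewrite hactK.
  by rewrite -[X in X = _](hactVK g) E.
rewrite SP -(wfix_conj _ g).
by have -> : (g * (g^-1 * h * g) * g^-1 = h)%g by rewrite !mulgA mulgV mul1g mulgK.
Qed.

Lemma isupp_pair (X Y : hset GwrG) (x : X) (y : Y) S T : isupp x S -> isupp y T ->
  isupp ((x, y) : hprod X Y) (S ++ T).
Proof.
move=> [Scl SP] [Tcl TP]; split; first exact: pclosed_cat.
move=> g; rewrite wfix_cat -SP -TP /=.
by split=> [[-> ->]|[-> ->]].
Qed.

(** The pairs [(r x, x')] represent the orbits on the fiber product of the orbits of [x] and [x']
    over that of [y]. Multiplied by the sign of [x'], the sum becomes the fiber product axiom of a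
    measure. *)
Lemma supp_sgn_fib (X Y X' : hset GwrG) (x : X) (y : Y) (x' : X') :
  stab_le x y -> stab_le x' y ->
    exists R : seq GwrG, [/\ uniq R, {in R, forall r, hact r y = y},
      forall g : GwrG, hact g y = y -> exists2 r, r \in R &
        exists h : GwrG, hact h x' = x' /\ hact h (hact g x) = hact r x,
      forall r r' h : GwrG, r \in R -> r' \in R -> hact h x' = x' ->
        hact h (hact r x) = hact r' x -> r = r' &
      \sum_(r <- R) psgn (supp ((hact r x, x') : hprod X X')) =
        psgn (supp x) * psgn (supp y) * psgn (supp x')].
Proof.
move=> xy x'y; have [Scl SP] := suppP x; have [Acl AP] := suppP y.
have [A'cl A'P] := suppP x'.
have [|| R [[Ru RA Rs Ri] RS]] := orbit_list_supp (suppP x) Acl A'cl.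
- exact: isupp_sub (suppP x') (suppP y) x'y.
- exact: isupp_sub (suppP x) (suppP y) xy.
exists R; split=> //.
- by move=> r /RA/AP.
- by move=> g /AP/Rs[r rR [h [/A'P hx' hr]]]; exists r => //; exists h.
- by move=> r r' h rR r'R /A'P hx'; apply: Ri.
rewrite -RS; apply: eq_bigr => r _; apply: isupp_psgn.
exact: isupp_pair (isupp_hact r (suppP x)) (suppP x').
Qed.

Lemma psgn_supp_stab (X Y : hset GwrG) (x : X) (y : Y) :
  stab_le x y -> stab_le y x -> psgn (supp x) = psgn (supp y).
Proof.
move=> xy yx; apply: psgn_eq => c.
by apply/idP/idP; apply: isupp_sub; try exact: suppP.
Qed.

Lemma psgn_supp_hact (X : hset GwrG) (g : GwrG) (x : X) :
  psgn (supp (hact g x)) = psgn (supp x).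
Proof. by rewrite (isupp_psgn (isupp_hact g (suppP x))) psgn_map. Qed.

Definition wreath_sign : orbit_sign GwrG :=
  @OrbitSign GwrG (fun X x => psgn (supp x)) (fun X x => psgn_sq (supp x))
    psgn_supp_stab psgn_supp_hact supp_sgn_fib.

Local Open Scope classical_set_scope.

(** * Push-forward twisted by signs *)

Section Pushforward.
Variable H : permGroup.
Implicit Types X Y Z : fhset H.

Lemma orb_sym (X : hset H) (x y : X) : orb x y -> orb y x.
Proof. by case=> g ->; exists g^-1%g; rewrite hactK. Qed.

Lemma orb_trans (X : hset H) (y x z : X) : orb x y -> orb y z -> orb x z.
Proof. by case=> g -> [h ->]; exists (h * g)%g; rewrite hactM. Qed.

(** Numbering the orbits turns finitely supported sums over [orbit X] into big operators over
    ordinals, with representatives fixed once and for all. *)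
Lemma orbit_enum X : {n : nat & {r : 'I_n -> X & {c : X -> 'I_n |
  [/\ forall x, orb x (r (c x)), forall g x, c (hact g x) = c x & forall i, c (r i) = i]}}}.
Proof.
have /finite_seqP/cid[S0 S0E] := fhP X; pose S := undup S0.
have SE O : O \in S.
  by rewrite mem_undup; have : [set: orbit X] O by []; rewrite S0E.
have cP x : (index (orbit_of x) S < size S)%N by rewrite index_mem.
exists (size S), (fun i => orepr (tnth (in_tuple S) i)), (fun x => Ordinal (cP x)).
have ooE (O : orbit X) : orbit_of (orepr O) = O by apply: orbit_inj; rewrite /= -oreprE.
split.
- move=> x; rewrite (tnth_nth (orbit_of x)) /= nth_index //.
  by have /= -> := oreprE (orbit_of x); apply: orb_refl.
- by move=> g x; apply: val_inj; rewrite /= orbit_of_hact.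
- move=> i; apply: val_inj; rewrite /= ooE (tnth_nth (tnth (in_tuple S) i)) /=.
  by rewrite index_uniq ?undup_uniq.
Qed.

Definition nor X : nat := projT1 (orbit_enum X).
Definition orep X : 'I_(nor X) -> X := projT1 (projT2 (orbit_enum X)).
Definition ocl X : X -> 'I_(nor X) := sval (projT2 (projT2 (orbit_enum X))).

Lemma orep_ocl X (x : X) : orb x (orep (ocl x)).
Proof. by have [h _ _] := svalP (projT2 (projT2 (orbit_enum X))); apply: h. Qed.

Lemma ocl_hact X (g : H) (x : X) : ocl (hact g x) = ocl x.
Proof. by have [_ h _] := svalP (projT2 (projT2 (orbit_enum X))); apply: h. Qed.

Lemma oclK X (i : 'I_(nor X)) : ocl (orep i) = i.
Proof. by have [_ _ h] := svalP (projT2 (projT2 (orbit_enum X))); apply: h. Qed.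

Lemma oclP X (x y : X) : orb x y <-> ocl x = ocl y.
Proof.
split=> [[g ->]|E]; first by rewrite ocl_hact.
by apply: orb_trans (orep_ocl x) _; rewrite E; apply/orb_sym/orep_ocl.
Qed.

Lemma ocl_map X Y (f : hmap X Y) (x x' : X) : ocl x = ocl x' -> ocl (f x) = ocl (f x').
Proof. by move=> /oclP[g ->]; rewrite hfunP ocl_hact. Qed.

Lemma fsbig_orbit (V : nmodType) X (P : orbit X -> Prop) (F : orbit X -> V) :
  \sum_(O \in [set O | P O]) F O =
  \sum_(i < nor X | `[< P (orbit_of (orep i)) >]) F (orbit_of (orep i)).
Proof.
pose s := [seq orbit_of (orep i) | i <- enum 'I_(nor X) & `[< P (orbit_of (orep i)) >]].
have -> : [set O | P O] = [set` s].
  apply/seteqP; split=> O /=.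
    move=> PO; have E : orbit_of (orep (ocl (orepr O))) = O.
      by apply: orbit_inj; rewrite /= -(orb_eq (orep_ocl (orepr O))) -oreprE.
    apply/mapP; exists (ocl (orepr O)); last by rewrite E.
    by rewrite mem_filter mem_enum andbT; apply/asboolP; rewrite E.
  by move=> /mapP[i]; rewrite mem_filter => /andP[/asboolP Pi _] ->.
have us : uniq s.
  rewrite map_inj_in_uniq ?filter_uniq -?enumT ?enum_uniq // => i j _ _ E.
  rewrite -(oclK i) -(oclK j); apply/oclP; move/(congr1 (@oset _ _)): E => /= ->.
  exact: orb_refl.
by rewrite -fsbig_seq // big_map big_filter big_enum_cond.
Qed.

Definition hinv (T : Type) X (phi : X -> T) : Prop := forall (g : H) x, phi (hact g x) = phi x.

Lemma hinv_ocl T X (phi : X -> T) x x' : hinv phi -> ocl x = ocl x' -> phi x = phi x'.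
Proof. by move=> i /oclP[g ->]. Qed.

Variable s : orbit_sign H.

Section Ring.
Variable R : comNzRingType.

Definition rsgn (X : hset H) (x : X) : R := (sgn s x)%:~R.

Lemma rsgn_sq (X : hset H) (x : X) : rsgn x * rsgn x = 1.
Proof. by rewrite /rsgn -intrM sgn_sq. Qed.

Lemma rsgn_hact (X : hset H) (g : H) (x : X) : rsgn (hact g x) = rsgn x.
Proof. by rewrite /rsgn sgn_hact. Qed.

Lemma rsgn_ocl X (x x' : X) : ocl x = ocl x' -> rsgn x = rsgn x'.
Proof. by apply: hinv_ocl => g y; rewrite rsgn_hact. Qed.

Definition isum X (phi : X -> R) : R := \sum_i phi (orep i) * rsgn (orep i).

(** The weight of an orbit over another is a product of two signs, and the sign of the target is
    taken out of the sum. *)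
Definition pushf X Y (f : hmap X Y) (phi : X -> R) (y : Y) : R :=
  rsgn y * \sum_(i < nor X | ocl (f (orep i)) == ocl y) phi (orep i) * rsgn (orep i).

Lemma eq_pushf X Y (f : hmap X Y) (phi psi : X -> R) : phi =1 psi ->
  pushf f phi =1 pushf f psi.
Proof. by move=> E y; congr (_ * _); apply: eq_bigr => i _; rewrite E. Qed.

Lemma eq_pushf_map X Y (f g : hmap X Y) (phi : X -> R) : f =1 g ->
  pushf f phi =1 pushf g phi.
Proof. by move=> E y; congr (_ * _); apply: eq_bigl => i; rewrite E. Qed.

Lemma eq_isum X (phi psi : X -> R) : phi =1 psi -> isum phi = isum psi.
Proof. by move=> E; apply: eq_bigr => i _; rewrite E. Qed.

Lemma pushf_hinv X Y (f : hmap X Y) (phi : X -> R) : hinv (pushf f phi).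
Proof. by move=> g y; rewrite /pushf rsgn_hact ocl_hact. Qed.

Lemma pushf_comp X Y Z (g : hmap Y Z) (f : hmap X Y) (phi : X -> R) z :
  pushf g (pushf f phi) z = pushf (hmap_comp g f) phi z.
Proof.
rewrite /pushf; congr (_ * _).
under eq_bigr => j _.
  rewrite mulrC mulrA rsgn_sq mul1r; over.
rewrite (exchange_big_dep (fun i => ocl (g (f (orep i))) == ocl z)) /=; last first.
  by move=> j i /eqP <- /eqP E; apply/eqP; apply: ocl_map; rewrite E.
apply: eq_bigr => i /eqP iz; rewrite (big_pred1 (ocl (f (orep i)))) // => j /=.
apply/andP/eqP => [[_ /eqP->]|->]; rewrite oclK //; split=> //.
by rewrite -iz; apply/eqP/ocl_map; rewrite oclK.
Qed.

Lemma pushf_proj X Y (f : hmap X Y) (phi : X -> R) (psi : Y -> R) y : hinv psi ->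
  pushf f (fun x => psi (f x) * phi x) y = psi y * pushf f phi y.
Proof.
move=> psiP; rewrite /pushf mulrCA; congr (_ * _); rewrite mulr_sumr.
by apply: eq_bigr => i /eqP /(hinv_ocl psiP) ->; rewrite mulrA.
Qed.

Lemma isum_pushf X Y (f : hmap X Y) (phi : X -> R) : isum (pushf f phi) = isum phi.
Proof.
rewrite /isum /pushf; under eq_bigr => j _.
  rewrite mulrC mulrA rsgn_sq mul1r; over.
rewrite (exchange_big_dep predT) //=; apply: eq_bigr => i _.
by rewrite (big_pred1 (ocl (f (orep i)))) // => j /=; rewrite oclK eq_sym.
Qed.

Lemma rsgn_inj X Y (f : hmap X Y) x : injective f -> rsgn (f x) = rsgn x.
Proof.
move=> fI; congr (_%:~R); apply: sgn_stab => g; last by move=> E; rewrite -hfunP E.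
by rewrite -hfunP => /fI.
Qed.

(** An injective equivariant map preserves stabilizers, hence signs, and the two sign factors
    cancel. *)
Lemma pushf_inj X Y (f : hmap X Y) (phi : X -> R) x : hinv phi -> injective f ->
  pushf f phi (f x) = phi x.
Proof.
move=> phiP fI; rewrite /pushf (big_pred1 (ocl x)) => [|i /=].
  have E : ocl (orep (ocl x)) = ocl x by rewrite oclK.
  rewrite (hinv_ocl phiP E) (rsgn_ocl E) (rsgn_inj _ fI) mulrC -mulrA.
  by rewrite rsgn_sq mulr1.
apply/eqP/eqP => [/oclP[g]|->]; last by apply: ocl_map; rewrite oclK.
rewrite -hfunP => /fI E; rewrite E ocl_hact oclK //.
Qed.

Lemma pushf_notin X Y (f : hmap X Y) (phi : X -> R) y : (forall x, f x <> y) ->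
  pushf f phi y = 0.
Proof.
move=> nf; rewrite /pushf big_pred0 ?mulr0 // => i; apply/eqP => /oclP[g E].
by apply: (nf (hact g (orep i))); rewrite hfunP.
Qed.

Lemma pushf_support X Y Z (f : hmap X Y) (j : hmap Z X) (phi : X -> R) y :
  hinv phi -> injective j -> (forall x, phi x != 0 -> exists z, j z = x) ->
  pushf f phi y = pushf (hmap_comp f j) (phi \o j) y.
Proof.
move=> phiP jI phi0; have phijP : hinv (phi \o j) by move=> g z /=; rewrite hfunP phiP.
rewrite -pushf_comp; apply: eq_pushf => x.
have [[z <-]|nz] := pselect (exists z, j z = x); first by rewrite pushf_inj.
rewrite pushf_notin; last by move=> z zx; apply: nz; exists z.
by apply/eqP; apply: contrapT => /negP /phi0.
Qed.

End Ring.

(** Cartesian squares are described elementwise, so that base change applies to concrete products of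
    factors and not only to [hfib]. *)
Definition pullback (X Y X' Y' : hset H) (f : hmap X Y) (q : hmap Y' Y)
    (q' : hmap X' X) (f' : hmap X' Y') : Prop :=
  [/\ forall z, f (q' z) = q (f' z),
      forall x y', f x = q y' -> exists z, q' z = x /\ f' z = y' &
      forall z z', q' z = q' z' -> f' z = f' z' -> z = z'].

(** Each [r] given by [sgn_fib] determines a unique point of [X'] over [(r x, y')]. It has the
    stabilizer of that pair, hence its sign, and these points meet each orbit of the sum exactly
    once. *)
Lemma fib_sum X Y X' Y' (f : hmap X Y) (q : hmap Y' Y) (q' : hmap X' X)
    (f' : hmap X' Y') x y' : pullback f q q' f' -> f x = q y' ->
  \sum_(l < nor X' | (ocl (q' (orep l)) == ocl x) && (ocl (f' (orep l)) == ocl y'))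
     sgn s (orep l) = sgn s x * sgn s (f x) * sgn s y'.
Proof.
move=> [sq ex un] xy'.
have [||R [Ru Ry Rs Ri <-]] := @sgn_fib _ s X Y Y' x (f x) y'.
- by move=> g gx; rewrite -hfunP gx.
- by move=> g gx; rewrite xy' -hfunP gx.
have zP r : exists z, r \in R -> q' z = hact r x /\ f' z = y'.
  have [rR|nr] := boolP (r \in R).
    have [|z zP] := ex (hact r x) y'; last by exists z.
    by rewrite hfunP Ry.
  by have [z _] := ex x y' xy'; exists z.
have [z zE] := choice zP.
have uz : uniq [seq ocl (z r) | r <- R].
  rewrite map_inj_in_uniq // => r r' rR r'R /oclP[h E].
  have [qr fr] := zE r rR; have [qr' fr'] := zE r' r'R.
  apply: (Ri r r' h) => //; first by rewrite -fr -hfunP -E fr'.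
  by rewrite -qr -qr' -hfunP -E.
rewrite [RHS](_ : _ = \sum_(r <- R) sgn s (orep (ocl (z r)))); last first.
  rewrite big_seq [RHS]big_seq; apply: eq_bigr => r rR.
  have [qr fr] := zE r rR.
  have [g ->] := orep_ocl (z r); rewrite sgn_hact.
  apply: sgn_stab => h /=; last by move=> E; rewrite -qr -fr -!hfunP E.
  by move=> [E1 E2]; apply: un; rewrite hfunP ?qr ?fr.
rewrite -(big_map (fun r => ocl (z r)) predT (fun l => sgn s (orep l))) /=.
rewrite -big_filter; apply: perm_big; apply: uniq_perm => //.
  by rewrite filter_uniq // index_enum_uniq.
move=> l; rewrite mem_filter mem_index_enum andbT; apply/andP/mapP.
  move=> [/eqP/esym /oclP[g gx] /eqP/esym /oclP[g' gy]].
  have [|r rR [h [hy hr]]] := Rs (g'^-1 * g)%g.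
    by rewrite hactM -hfunP -gx sq gy hfunP -xy' hactK.
  exists r => //; have [qr fr] := zE r rR.
  rewrite -(oclK l) -(ocl_hact (h * g'^-1)%g); congr ocl; apply: un.
    by rewrite hfunP qr gx -hr !hactM.
  by rewrite hfunP fr gy !hactM hactK.
move=> [r rR ->]; have [qr fr] := zE r rR.
split; apply/eqP.
  transitivity (ocl (q' (z r))); first by apply: ocl_map; rewrite oclK.
  by rewrite qr ocl_hact.
transitivity (ocl (f' (z r))); first by apply: ocl_map; rewrite oclK.
by rewrite fr.
Qed.

(** The orbits of [X'] over that of [y'] are grouped by their image in [X], and [fib_sum] evaluates
    each group. No other law of [pushf] uses [sgn_fib]. *)
Lemma pushf_bc (R : comNzRingType) X Y X' Y' (f : hmap X Y) (q : hmap Y' Y)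
    (q' : hmap X' X) (f' : hmap X' Y') (phi : X -> R) y' :
  pullback f q q' f' -> hinv phi ->
  pushf f phi (q y') = pushf f' (phi \o q') y'.
Proof.
move=> pb phiP; have [sq _ _] := pb; rewrite /pushf.
transitivity (rsgn R y' * \sum_(i < nor X | ocl (f (orep i)) == ocl (q y'))
   phi (orep i) * (\sum_(l < nor X' | (ocl (q' (orep l)) == i) &&
     (ocl (f' (orep l)) == ocl y')) rsgn R (orep l))).
  rewrite !mulr_sumr; apply: eq_bigr => i /eqP/esym/oclP[g E].
  have fx : f (hact g^-1%g (orep i)) = q y' by rewrite hfunP E hactK.
  have := fib_sum pb fx; rewrite ocl_hact oclK => S.
  have -> : \sum_(l < nor X' | (ocl (q' (orep l)) == i) &&
     (ocl (f' (orep l)) == ocl y')) rsgn R (orep l) =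
     (\sum_(l < nor X' | (ocl (q' (orep l)) == i) &&
     (ocl (f' (orep l)) == ocl y')) sgn s (orep l))%:~R by rewrite raddf_sum.
  rewrite S fx !intrM sgn_hact -!/(rsgn R _).
  rewrite mulrCA [RHS]mulrCA; congr (_ * _).
  by rewrite mulrC [RHS]mulrC -!mulrA rsgn_sq mulr1 mulrC.
congr (_ * _); under eq_bigr => i _ do rewrite mulr_sumr.
rewrite (exchange_big_dep (fun l => ocl (f' (orep l)) == ocl y')) /=; last first.
  by move=> i l _ /andP[].
apply: eq_bigr => l /eqP lE; rewrite (big_pred1 (ocl (q' (orep l)))) => [|i /=].
  by rewrite (@hinv_ocl _ _ phi _ (q' (orep l))) // oclK.
rewrite lE eqxx andbT [RHS]eq_sym; apply/andP/idP => [[]//|/eqP <-]; split=> //.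
apply/eqP; transitivity (ocl (f (q' (orep l)))); first by apply: ocl_map; rewrite oclK.
by rewrite sq; apply: ocl_map.
Qed.

End Pushforward.

(** * The measure attached to an orbit sign *)

Section Measure.
Variables (H : permGroup) (olH : oligomorphic H) (s : orbit_sign H).

Definition tsgn (X : thset H) : int := sgn s (projT1 (cid (thP X))).

Lemma tsgnE (X : thset H) (x : X) : tsgn X = sgn s x.
Proof.
rewrite /tsgn; case: cid => y yP /=; have [g ->] := yP x.
by rewrite sgn_hact.
Qed.

Lemma tsgn_sq (X : thset H) : tsgn X * tsgn X = 1.
Proof. by rewrite /tsgn sgn_sq. Qed.

Lemma tsgn_orbit (X : hset H) (O : orbit X) (x : X) : oset O x ->
  tsgn (orbit_th O) = sgn s x.
Proof.
move=> Ox; rewrite (@tsgnE (orbit_th O) (exist _ x Ox)).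
apply: sgn_stab => g; last by move=> gx; apply: eq_exist.
by move/(congr1 sval).
Qed.

Definition sign_mval (Y X : thset H) (f : hmap Y X) : int := tsgn Y * tsgn X.

Lemma sign_measure_iso (Y X : thset H) (f : hmap Y X) : hiso f -> sign_mval f = 1.
Proof.
move=> [g [fK gK]]; have [y _] := thP Y.
rewrite /sign_mval (tsgnE y) (tsgnE (f y)) -[RHS](sgn_sq s y); congr (_ * _).
apply: sgn_stab => h; last by rewrite -hfunP => ->.
by rewrite -hfunP => /(can_inj fK).
Qed.

Lemma sign_measure_comp (Z Y X : thset H) (g : hmap Y X) (f : hmap Z Y) :
  @sign_mval Z X (hmap_comp g f) = sign_mval g * sign_mval f.
Proof.
by rewrite /sign_mval -[LHS]mulr1 -(tsgn_sq Y); ring.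
Qed.

(** This is [fib_sum] for the fiber product square: as [Y] and [X'] are transitive, its two
    filtering conditions hold for every orbit. *)
Lemma sign_measure_fib (Y X X' : thset H) (f : hmap Y X) (g : hmap X' X) :
  sign_mval f = \sum_(O \in [set: orbit (hfib f g)])
      @sign_mval (orbit_th O) X' (hmap_comp (hfib_snd f g) (orbit_incl O)).
Proof.
pose FY := FHSet (finitary_transitive Y).
pose FX := FHSet (finitary_transitive X).
pose FX' := FHSet (finitary_transitive X').
pose P := FHSet (finitary_hfib f g olH (fhP FY) (fhP FX')).
rewrite /sign_mval -[RHS]/(\sum_(O \in [set O : orbit P | True]) _) fsbig_orbit.
have [y0 y0P] := thP Y; have [x0 x0P] := thP X'.
have [h hE] : orb (g x0) (f y0).
  have [x xP] := thP X; apply: orb_trans (orb_sym (xP _)) (xP _).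
have yE : f (hact h^-1%g y0) = g x0 by rewrite hfunP hE hactK.
have pb : @pullback H FY FX P FX' f g
    (hmap_comp (hfst Y X') (hincl (@fib_stable _ _ _ _ f g))) (hfib_snd f g).
  split=> [[[y x] /= yx] //|y x yx|[[y x] /= yx] [[y' x'] /= yx'] /= e e'].
    by exists (exist _ (y, x) yx).
  by apply: eq_exist; rewrite e e'.
have S := fib_sum s pb yE.
rewrite sgn_hact yE in S.
rewrite (tsgnE y0) (tsgnE (g x0)).
transitivity ((sgn s y0 * sgn s (g x0) * sgn s x0) * sgn s x0).
  by rewrite -!mulrA sgn_sq mulr1.
rewrite -S mulr_suml; apply: eq_big => [l|l _].
  rewrite [RHS]asboolT //; apply/andP; split; apply/eqP/oclP => /=.
    have [k /= ->] := y0P (hfun (hmap_comp (hfst Y X') (hincl (@fib_stable _ _ _ _ f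
      g))) (orep l)).
    by exists (h^-1 * k^-1)%g; rewrite hactM hactK.
  by have [k /= ->] := x0P (hfun (hfib_snd f g) (orep l)); exists k^-1%g; rewrite hactK.
rewrite (tsgnE x0) (tsgn_orbit (O := orbit_of (orep l)) (x := orep l)) //.
exact: orb_refl.
Qed.

Definition sign_measure : measure H int :=
  @Measure H int sign_mval sign_measure_iso sign_measure_comp sign_measure_fib.

Lemma sign_measure_regular : regular sign_measure.
Proof.
move=> Y X f; apply/GRing.unitrP; exists (sign_mval f).
rewrite /= /sign_mval mulrACA !tsgn_sq; by split; rewrite ?mulr1.
Qed.

Lemma push_sign (k : fieldType) (X Y : fhset H) (f : hmap X Y) (phi : invfun k X) y :
  push (measure_intr olH k sign_measure) f phi y = pushf s f (phi : X -> k) y :> k.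
Proof.
have cond i : `[< orbit_image f (orbit_of (orep i)) = orbit_of y >] =
    (ocl (f (orep i)) == ocl y).
  apply/asboolP/eqP => [/(congr1 (@oset _ _)) /= E|E].
    apply/esym/oclP; rewrite -[orb y]E; exists (orep i) => //; exact: orb_refl.
  apply: orbit_inj => /=; apply/seteqP; split=> z /=.
    by move=> [_ [g ->] <-]; rewrite hfunP; apply/oclP; rewrite ocl_hact.
  move=> /oclP; rewrite -E => /oclP[g ->].
  by exists (hact g (orep i)); [exists g | rewrite hfunP].
rewrite /push /= fsbig_orbit /pushf mulr_sumr; apply: eq_big => [i|i].
  exact: cond.
rewrite cond => /eqP iy.
have Oo : oset (orbit_of (orep i)) (orepr (orbit_of (orep i))).
  by rewrite oreprE; apply: orb_refl.
have [g oE] := Oo.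
rewrite oE invfunP /= /sign_mval (tsgn_orbit (O := orbit_of (orep i)) (x := orep i));
  last first.
  exact: orb_refl.
rewrite (tsgn_orbit (x := f (orep i))); last by exists (orep i) => //; exact: orb_refl.
by rewrite intrM -(rsgn_ocl s k iy) /rsgn; ring.
Qed.

End Measure.

(** * The category of permutation modules *)

Section PermCategory.
Variables (H : permGroup) (olH : oligomorphic H) (s : orbit_sign H) (k : fieldType).
Implicit Types W X Y Z : fhset H.

Let mu := measure_intr olH k (sign_measure olH s).
Notation "X ** Y" := (fprod olH X Y) (at level 40, left associativity).
Notation "B \oo A" := (mat_comp mu B A) (at level 50).
Notation "A \ox B" := (mat_tens olH A B) (at level 45).

Lemma invfun_hinv X (phi : invfun k X) : hinv (phi : X -> k).
Proof. by move=> g x; apply: invfunP. Qed.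

Lemma matP X Y (A B : mat k X Y) : (forall y x, A (y, x) = B (y, x)) -> A = B.
Proof. by move=> E; apply: val_inj; apply/funext => -[y x]; apply: E. Qed.

Lemma mat_compE X Y Z (B : mat k Y Z) (A : mat k X Y) p :
  (B \oo A) p = @pushf H s k (Z ** Y ** X) (Z ** X) (proj13 X Y Z)
    (fun t => (B (t.1.1, t.1.2) : k) * A (t.1.2, t.2)) p :> k.
Proof. exact: (@push_sign H olH s k (Z ** Y ** X) (Z ** X)). Qed.

Lemma pushf_linear X Y (f : hmap X Y) (a : k) (phi psi : X -> k) y :
  pushf s f (fun x => a * phi x + psi x) y = a * pushf s f phi y + pushf s f psi y.
Proof.
rewrite /pushf mulrCA -mulrDr; congr (_ * _); rewrite mulr_sumr -big_split /=.
by apply: eq_bigr => i _; rewrite mulrDl mulrA.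
Qed.

Lemma matDE X Y (A B : mat k X Y) (a : k) p : (a *: A + B) p = a * A p + B p :> k.
Proof. by []. Qed.

Lemma mat_comp_linearl X Y Z (A : mat k X Y) : linear (fun B : mat k Y Z => B \oo A).
Proof.
move=> a B B'; apply: matP => z x.
transitivity (a * (B \oo A) (z, x) + (B' \oo A) (z, x) : k); last by [].
rewrite !mat_compE -pushf_linear; apply: eq_pushf => t.
by rewrite [X in X * _](matDE B B') mulrDl mulrA.
Qed.

Lemma mat_comp_linearr X Y Z (B : mat k Y Z) : linear (fun A : mat k X Y => B \oo A).
Proof.
move=> a A A'; apply: matP => z x.
transitivity (a * (B \oo A) (z, x) + (B \oo A') (z, x) : k); last by [].
rewrite !mat_compE -pushf_linear; apply: eq_pushf => t.
by rewrite [X in _ * X](matDE A A') mulrDr mulrCA.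
Qed.

Lemma mat_tens_linearl X X' Y Y' (B : mat k Y Y') :
  linear (fun A : mat k X X' => A \ox B).
Proof.
move=> a A A'; apply: matP => z x.
transitivity (a * (A \ox B) (z, x) + (A' \ox B) (z, x) : k); last by [].
by rewrite /= [X in X * _](matDE A A') mulrDl mulrA.
Qed.

Lemma mat_tens_linearr X X' Y Y' (A : mat k X X') :
  linear (fun B : mat k Y Y' => A \ox B).
Proof.
move=> a B B'; apply: matP => z x.
transitivity (a * (A \ox B) (z, x) + (A \ox B') (z, x) : k); last by [].
by rewrite /= [X in _ * X](matDE B B') mulrDr mulrCA.
Qed.

Lemma mat_hinv3 X Y Z (B : mat k Y Z) (A : mat k X Y) :
  @hinv H k (Z ** Y ** X) (fun t => (B (t.1.1, t.1.2) : k) * A (t.1.2, t.2)).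
Proof. by move=> g [[z y] x]; apply: (invfunP (mat_mul3 B A) g (z, y, x)). Qed.

(** A function supported on the image of a section is pushed forward without any summation. Graph
    matrices, being indicators, lead to such functions. *)
Lemma pushf_section X Y (f : hmap X Y) (j : hmap Y X) (phi : X -> k) y :
  hinv phi -> cancel j f -> (forall x, phi x != 0 -> j (f x) = x) ->
  pushf s f phi y = phi (j y).
Proof.
move=> phiP jK phi0; rewrite (@pushf_support _ s k _ _ _ _ j) //.
- rewrite (@eq_pushf_map _ _ _ _ _ _ (hmap_id Y)) //.
  by rewrite (@pushf_inj _ s k Y Y (hmap_id Y)) // => g z /=; rewrite hfunP phiP.
- exact: can_inj jK.
- by move=> x /phi0 <-; exists (f x).
Qed.

Lemma mat_comp_graphr X Y Z (A : mat k Y Z) (f : hmap X Y) z x :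
  (A \oo graph_mat k f) (z, x) = A (z, f x).
Proof.
rewrite mat_compE.
pose j : hmap (Z ** X) (Z ** Y ** X) :=
  hpair (hpair (hfst Z X) (hmap_comp f (hsnd Z X))) (hsnd Z X).
rewrite (@pushf_section _ _ _ j); first by rewrite /= asboolT ?mulr1.
- exact: mat_hinv3.
- by case.
- by move=> [[z' y'] x'] /=; case: asboolP => [->|_] //; rewrite mulr0 eqxx.
Qed.

Lemma mat_comp_graphl X Y Z (A : mat k X Y) (f : hmap Y Z) (f' : hmap Z Y) z x :
  cancel f f' -> cancel f' f ->
  (graph_mat k f \oo A) (z, x) = A (f' z, x).
Proof.
move=> fK f'K; rewrite mat_compE.
pose j : hmap (Z ** X) (Z ** Y ** X) :=
  hpair (hpair (hfst Z X) (hmap_comp f' (hfst Z X))) (hsnd Z X).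
rewrite (@pushf_section _ _ _ j); first by rewrite /= asboolT ?mul1r ?f'K.
- exact: mat_hinv3.
- by case.
- by move=> [[z' y'] x'] /=; case: asboolP => [->|_]; rewrite ?fK // mul0r eqxx.
Qed.

Lemma graph_mat_ext X Y (f g : hmap X Y) : f =1 g -> graph_mat k f = graph_mat k g.
Proof. by move=> E; apply: matP => y x /=; rewrite E. Qed.

Lemma graph_mat_comp X Y Z (g : hmap Y Z) (f : hmap X Y) :
  graph_mat k g \oo graph_mat k f = @graph_mat H k X Z (hmap_comp g f).
Proof. by apply: matP => z x; rewrite mat_comp_graphr. Qed.

Definition hmap_prod (X X' Y Y' : hset H) (f : hmap X X') (g : hmap Y Y') :
    hmap (hprod X Y) (hprod X' Y') :=
  hpair (hmap_comp f (hfst X Y)) (hmap_comp g (hsnd X Y)).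

Lemma graph_mat_tens X X' Y Y' (f : hmap X X') (g : hmap Y Y') :
  graph_mat k f \ox graph_mat k g = @graph_mat H k (X ** Y) (X' ** Y') (hmap_prod f g).
Proof.
apply: matP => -[x' y'] [x y] /=; rewrite -natrM mulnb; congr (nat_of_bool _)%:R.
by apply/andP/asboolP => [[/asboolP-> /asboolP->]|[-> ->]] //; split; apply/asboolP.
Qed.

(** Both bracketings are the push-forward of the triple product on [T]: the inner composite is
    recovered by base change along a projection, and the outer factor is taken out by the projection
    formula. *)
Lemma mat_compA W X Y Z (C : mat k Y Z) (B : mat k X Y) (A : mat k W X) :
  C \oo (B \oo A) = (C \oo B) \oo A.
Proof.
pose T := Z ** Y ** X ** W.
pose phi (t : T) : k := (C (t.1.1.1, t.1.1.2) : k) * B (t.1.1.2, t.1.2) * A (t.1.2, t.2).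
pose z : hmap T Z := hmap_comp (hfst Z Y) (hmap_comp (hfst (Z ** Y) X) (hfst (Z ** Y ** X) W)).
pose y : hmap T Y := hmap_comp (hsnd Z Y) (hmap_comp (hfst (Z ** Y) X) (hfst (Z ** Y ** X) W)).
pose x : hmap T X := hmap_comp (hsnd (Z ** Y) X) (hfst (Z ** Y ** X) W).
pose w : hmap T W := hsnd (Z ** Y ** X) W.
pose zw : hmap T (Z ** W) := hpair z w.
transitivity (@mkinv H k (Z ** W) (pushf s zw phi) (@pushf_hinv H s k T _ zw phi)).
  apply: matP => z0 w0; rewrite mat_compE -[RHS]/(pushf s zw phi (z0, w0)).
  pose f1 : hmap T (Z ** Y ** W) := hpair (hpair z y) w.
  rewrite (@eq_pushf_map _ _ _ _ _ zw (hmap_comp (proj13 W Y Z) f1)) //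
    -(@pushf_comp H s k T (Z ** Y ** W) (Z ** W) (proj13 W Y Z) f1).
  apply: eq_pushf => -[[z1 y1] w1].
  rewrite (@eq_pushf H s k T _ f1 _ (fun t : T => (C ((f1 t).1.1, (f1 t).1.2) : k) *
      (B (y t, x t) * A (x t, w t)))); last by move=> t; rewrite /phi mulrA.
  rewrite (@pushf_proj _ s _ T _ f1 (fun t => (B (y t, x t) : k) * A (x t, w t))
     (fun t => C (t.1.1, t.1.2))); last first.
    by move=> g [[z2 y2] w2]; apply: (invfunP C g (z2, y2)).
  congr (_ * _); rewrite mat_compE.
  pose q : hmap (Z ** Y ** W) (Y ** W) :=
    hpair (hmap_comp (hsnd Z Y) (hfst (Z ** Y) W)) (hsnd (Z ** Y) W).
  apply: (@pushf_bc H s k (Y ** X ** W) (Y ** W) T (Z ** Y ** W) _ q (hpair (hpair y x)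
    w) f1 _ (z1, y1, w1)).
    split=> //.
    - move=> [[y2 x2] w2] [[z2 y3] w3] /= [-> ->].
      by exists (z2, y3, x2, w3).
    - by move=> [[[z2 y2] x2] w2] [[[z3 y3] x3] w3] /= [-> -> ->] [->].
  exact: mat_hinv3.
symmetry; apply: matP => z0 w0; rewrite mat_compE -[RHS]/(pushf s zw phi (z0, w0)).
pose f1 : hmap T (Z ** X ** W) := hpair (hpair z x) w.
rewrite (@eq_pushf_map _ _ _ _ _ zw (hmap_comp (proj13 W X Z) f1)) //
  -(@pushf_comp H s k T (Z ** X ** W) (Z ** W) (proj13 W X Z) f1).
apply: eq_pushf => -[[z1 x1] w1].
rewrite (@eq_pushf H s k T _ f1 _ (fun t : T => (A ((f1 t).1.2, (f1 t).2) : k) *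
    ((C (z t, y t) : k) * B (y t, x t)))); last by move=> t; rewrite /phi mulrC.
rewrite (@pushf_proj _ s _ T _ f1 (fun t => (C (z t, y t) : k) * B (y t, x t))
   (fun t => A (t.1.2, t.2))); last first.
  by move=> g [[z2 x2] w2]; apply: (invfunP A g (x2, w2)).
rewrite mulrC; congr (_ * _); rewrite mat_compE.
pose q : hmap (Z ** X ** W) (Z ** X) := hfst (Z ** X) W.
apply: (@pushf_bc H s k (Z ** Y ** X) (Z ** X) T (Z ** X ** W) _ q (hpair (hpair z y)
  x) f1 _ (z1, x1, w1)).
  split=> //.
  - move=> [[z2 y2] x2] [[z3 x3] w3] /= [-> ->].
    by exists (z3, y2, x3, w3).
  - by move=> [[[z2 y2] x2] w2] [[[z3 y3] x3] w3] /= [-> -> ->] [->].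
exact: mat_hinv3.
Qed.

(** Fubini: the push-forward from [T] factors through [S]; [f1] sums over [X'] while [phi] is
    constant, and [f2] then sums over [Y']. *)
Lemma mat_tens_comp X X' X'' Y Y' Y'' (B : mat k X' X'') (A : mat k X X')
    (B' : mat k Y' Y'') (A' : mat k Y Y') :
  (B \oo A) \ox (B' \oo A') = (B \ox B') \oo (A \ox A').
Proof.
pose T := (X'' ** Y'') ** (X' ** Y') ** (X ** Y).
pose S := (X'' ** Y'') ** Y' ** (X ** Y).
apply: matP => -[x2 y2] [x0 y0]; rewrite [RHS]mat_compE.
transitivity (((B \oo A) (x2, x0) : k) * (B' \oo A') (y2, y0)); first by [].
pose f1 : hmap T S := hpair (hpair (hmap_comp (hfst _ _) (hfst _ _))
  (hmap_comp (hsnd X' Y') (hmap_comp (hsnd _ _) (hfst _ _)))) (hsnd _ _).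
pose f2 : hmap S ((X'' ** Y'') ** (X ** Y)) := hpair (hmap_comp (hfst _ _) (hfst _ _))
  (hsnd _ _).
rewrite (@eq_pushf_map H s k T ((X'' ** Y'') ** (X ** Y))
  (proj13 (X ** Y) (X' ** Y') (X'' ** Y'')) (hmap_comp f2 f1)) //
  -(@pushf_comp H s k T S ((X'' ** Y'') ** (X ** Y)) f2 f1).
pose phi (t : S) : k := (B' (t.1.1.2, t.1.2) : k) * A' (t.1.2, t.2.2).
have phiP : hinv phi.
  by move=> g [[[x3 y3] y1] [x y]];
    rewrite /phi /= -(invfunP B' g (y3, y1)) -(invfunP A' g (y1, y)).
pose psi (t : T) : k := (B (t.1.1.1, t.1.2.1) : k) * A (t.1.2.1, t.2.1).
rewrite (@eq_pushf _ _ _ _ _ f2 _ (fun t => ((B \oo A) ((f2 t).1.1, (f2 t).2.1) : k) * phi t)).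
  rewrite (@pushf_proj H s k S _ f2 phi (fun t => (B \oo A) (t.1.1, t.2.1))); last first.
    by move=> g [[x3 y3] [x1 y1]]; apply: (invfunP (B \oo A) g (x3, x1)).
  congr (_ * _); rewrite mat_compE.
  pose q : hmap ((X'' ** Y'') ** (X ** Y)) (Y'' ** Y) :=
    hpair (hmap_comp (hsnd _ _) (hfst _ _)) (hmap_comp (hsnd _ _) (hsnd _ _)).
  apply: (@pushf_bc H s k (Y'' ** Y' ** Y) (Y'' ** Y) S ((X'' ** Y'') ** (X ** Y)) _ q
    (hpair (hpair (hmap_comp (hsnd _ _) (hmap_comp (hfst _ _) (hfst _ _)))
     (hmap_comp (hsnd _ _) (hfst _ _))) (hmap_comp (hsnd _ _) (hsnd _ _))) f2 _ ((x2,
       y2), (x0, y0))).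
    split=> //.
    - move=> [[a b] c] [[x3 y3] [x1 y1]] /= [-> ->].
      by exists ((x3, y3), b, (x1, y1)).
    - by move=> [[[x3 y3] b] [x1 y1]] [[[x3' y3'] b'] [x1' y1']] /= [-> -> ->] [-> ->].
  exact: mat_hinv3.
move=> [[[x3 y3] y1] [x1 y]].
rewrite (@eq_pushf _ _ _ _ _ f1 _ (fun t => phi (f1 t) * psi t)); last first.
  by move=> t; rewrite /phi /psi /=; ring.
rewrite (@pushf_proj H s k T S f1 psi phi) // [RHS]mulrC; congr (_ * _);
  rewrite mat_compE; symmetry.
pose q : hmap S (X'' ** X) :=
  hpair (hmap_comp (hfst _ _) (hmap_comp (hfst _ _) (hfst _ _))) (hmap_comp (hfst _ _)
    (hsnd _ _)).
apply: (@pushf_bc H s k (X'' ** X' ** X) (X'' ** X) T S _ q (hpair (hpair (hmap_comp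
  (hfst _ _) (hmap_comp (hfst _ _) (hfst _ _)))
     (hmap_comp (hfst _ _) (hmap_comp (hsnd _ _) (hfst _ _)))) (hmap_comp (hfst _ _)
       (hsnd _ _))) f1 _ ((x3, y3), y1, (x1, y))).
  split=> //.
  - move=> [[a b] c] [[[x4 y4] y5] [x6 y6]] /= [-> ->].
    by exists ((x4, y4), (b, y5), (x6, y6)).
  - by move=> [[[? ?] [? ?]] [? ?]] [[[? ?] [? ?]] [? ?]] /= [-> -> ->] [-> -> ->].
exact: mat_hinv3.
Qed.

Local Ltac graph_ext := lazymatch goal with
  |- @graph_mat _ _ ?X ?Y _ = _ => apply: (@graph_mat_ext X Y) end.

(** The structure maps are graphs of bijections, so the coherence laws become equalities of
    functions on tuples. *)
Lemma perm_smc : linear_smc (perm olH mu).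
Proof.
split=> /=.
- exact: mat_compA.
- by move=> X Y f; apply: matP => y x; rewrite (@mat_comp_graphl _ _ _ _ _ (hmap_id Y)).
- by move=> X Y f; apply: matP => y x; rewrite mat_comp_graphr.
- by move=> X Y Z f; apply: mat_comp_linearl.
- by move=> X Y Z f; apply: mat_comp_linearr.
- by move=> X Y; rewrite graph_mat_tens; graph_ext => -[].
- by move=> *; apply: mat_tens_comp.
- by move=> *; apply: mat_tens_linearl.
- by move=> *; apply: mat_tens_linearr.
- by move=> *; rewrite graph_mat_comp; graph_ext => -[[]].
- by move=> *; rewrite graph_mat_comp; graph_ext => -[? []].
- by move=> *; rewrite graph_mat_comp; graph_ext => -[[]].
- by move=> *; rewrite graph_mat_comp; graph_ext.
- by move=> *; rewrite graph_mat_comp; graph_ext => -[? []].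
- by move=> *; rewrite graph_mat_comp; graph_ext.
- by move=> *; rewrite graph_mat_comp; graph_ext => -[].
- move=> X X' Y Y' Z Z' f g h.
  apply: (@matP (X ** Y ** Z) (X' ** (Y' ** Z'))) => -[x' [y' z']] [[x y] z].
  rewrite (@mat_comp_graphr (X ** Y ** Z) (X ** (Y ** Z)) (X' ** (Y' ** Z')) _ (hassoc X Y Z)).
  rewrite (@mat_comp_graphl (X ** Y ** Z) (X' ** Y' ** Z') (X' ** (Y' ** Z')) _
    (hassoc X' Y' Z') (hassocV X' Y' Z')) /= ?mulrA //; first by case=> [[]].
  by case=> [? []].
- move=> X X' f; apply: (@matP (fpt H ** X) X') => x' [[] x].
  rewrite (@mat_comp_graphr (fpt H ** X) X X' _ (hsnd (hpt H) X)).
  rewrite (@mat_comp_graphl (fpt H ** X) (fpt H ** X') X' _ (hsnd (hpt H) X')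
    (hpair (hto_pt X') (hmap_id X'))) /= ?asboolT ?mul1r //; by case=> [[]].
- move=> X X' f; apply: (@matP (X ** fpt H) X') => x' [x []].
  rewrite (@mat_comp_graphr (X ** fpt H) X X' _ (hfst X (hpt H))).
  rewrite (@mat_comp_graphl (X ** fpt H) (X' ** fpt H) X' _ (hfst X' (hpt H))
    (hpair (hmap_id X') (hto_pt X'))) /= ?asboolT ?mulr1 //; by case=> [? []].
- move=> X X' Y Y' f g; apply: (@matP (X ** Y) (Y' ** X')) => -[y' x'] [x y].
  rewrite (@mat_comp_graphr (X ** Y) (Y ** X) (Y' ** X') _ (hpair (hsnd X Y) (hfst X Y))).
  rewrite (@mat_comp_graphl (X ** Y) (X' ** Y') (Y' ** X') _ (hpair (hsnd X' Y') (hfst X' Y'))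
    (hpair (hsnd Y' X') (hfst Y' X'))) /= 1?mulrC //; by case.
- by move=> X Y; rewrite !graph_mat_tens graph_mat_comp; graph_ext.
- by move=> *; rewrite !graph_mat_tens !graph_mat_comp; graph_ext.
- by move=> *; rewrite !graph_mat_tens !graph_mat_comp; graph_ext.
Qed.

End PermCategory.

(** * Direct sums, transposes and duals of permutation modules *)

Section PermObjects.
Variables (H : permGroup) (olH : oligomorphic H) (s : orbit_sign H) (k : fieldType).
Implicit Types X Y Z : fhset H.

Let mu := measure_intr olH k (sign_measure olH s).
Notation "X ** Y" := (fprod olH X Y) (at level 40, left associativity).
Notation "B \oo A" := (mat_comp mu B A) (at level 50).
Notation "A \ox B" := (mat_tens olH A B) (at level 45).

Lemma mat_sumE X Y I (r : seq I) (P : pred I) (A : I -> mat k X Y) p :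
  (\sum_(i <- r | P i) A i) p = \sum_(i <- r | P i) (A i p : k) :> k.
Proof. by apply: (big_morph (fun B : mat k X Y => B p : k)). Qed.

Lemma perm_finite_dim X Y : finite_dim (mat k X Y).
Proof.
pose b (a : 'I_(nor (Y ** X))) : mat k X Y := @mkinv H k (Y ** X)
  (fun p => (@ocl H (Y ** X) p == a)%:R)
  (fun g p => congr1 (fun i => (i == a)%:R) (@ocl_hact H (Y ** X) g p)).
exists (nor (Y ** X)), b => A; exists (fun a => A (@orep H (Y ** X) a)).
apply: matP => y x; rewrite mat_sumE (bigD1 (@ocl H (Y ** X) (y, x))) //= big1 => [|i ni].
  rewrite addr0 -[RHS]/((A _ : k) * (_ == _)%:R) eqxx mulr1.
  by apply: (@hinv_ocl H _ (Y ** X) _ _ _ (invfun_hinv (X := Y ** X) A)); rewrite oclK.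
by rewrite -[LHS]/((A _ : k) * (_ == _)%:R) eq_sym (negbTE ni) mulr0.
Qed.

Section DisjointUnion.
Variables (n : nat) (S : 'I_n -> fhset H).

Definition hsum_act (g : H) (x : {a : 'I_n & S a}) : {a : 'I_n & S a} :=
  Tagged (fun a => hcar (S a)) (hact g (tagged x)).

Lemma hsum_act1 x : hsum_act 1%g x = x.
Proof. by case: x => a x; rewrite /hsum_act /= hact1. Qed.

Lemma hsum_actM g h x : hsum_act (g * h)%g x = hsum_act g (hsum_act h x).
Proof. by case: x => a x; rewrite /hsum_act /= hactM. Qed.

Lemma hsum_open x : exists A : seq (pdom H), forall g : H,
  {in A, forall w, pact g w = w} -> hsum_act g x = x.
Proof.
case: x => a x; have [A AP] := hopen x; exists A => g /AP.
by rewrite /hsum_act /= => ->.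
Qed.

Definition hsum : hset H := HSet hsum_act1 hsum_actM hsum_open.

Lemma finitary_hsum : finitary hsum.
Proof.
apply/finitaryP; exists {a : 'I_n & 'I_(nor (S a))}, (fun x : hsum =>
  Tagged (fun a => 'I_(nor (S a))) (ocl (tagged x))) => -[a x] [b y] /= E.
have ab : a = b := congr1 tag E; case: _ / ab y E => y /eqP.
rewrite eq_Tagged => /eqP /= /oclP[g ->].
by exists g.
Qed.

Definition fsum : fhset H := FHSet finitary_hsum.

Definition hsum_inj (a : 'I_n) : hmap (S a) fsum :=
  @HMap H (S a) fsum (fun x => Tagged (fun a => hcar (S a)) x) (fun g x => erefl).

Lemma hsum_injI a : injective (hsum_inj a).
Proof.
move=> x y E; have := projT2_eq E.
by rewrite (eq_irrelevance (projT1_eq E) erefl).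
Qed.

Lemma hsum_inj_neq a b (x : S a) (y : S b) : a != b -> hsum_inj a x <> hsum_inj b y.
Proof. by move=> ab /(congr1 tag) /eqP; rewrite /= (negbTE ab). Qed.

End DisjointUnion.

Lemma mat_comp_graph_inj X Y Z (A : mat k X Y) (f : hmap Y Z) y x : injective f ->
  (graph_mat k f \oo A) (f y, x) = A (y, x).
Proof.
move=> fI; rewrite mat_compE.
pose j : hmap (Y ** X) (Z ** Y ** X) :=
  hpair (hpair (hmap_comp f (hfst Y X)) (hfst Y X)) (hsnd Y X).
rewrite (@pushf_support H s k _ _ (Y ** X) _ j); last 3 first.
- exact: mat_hinv3.
- by move=> [y1 x1] [y2 x2] /= [_ -> ->].
- by move=> [[z' y'] x'] /=; case: asboolP => [->|_]; [exists (y', x') | rewrite mul0r eqxx].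
pose fx : hmap (Y ** X) (Z ** X) := hpair (hmap_comp f (hfst Y X)) (hsnd Y X).
rewrite (@eq_pushf_map H s k (Y ** X) (Z ** X) _ fx) // -[(f y, x)]/(fx (y, x)) pushf_inj.
- by rewrite /= asboolT // mul1r.
- by move=> g p; have := mat_hinv3 (olH := olH) (graph_mat k f) A g (j p); rewrite -(hfunP j).
- by move=> [y1 x1] [y2 x2] /= [/fI -> ->].
Qed.

Lemma mat_comp_graph_notin X Y Z (A : mat k X Y) (f : hmap Y Z) z x :
  (forall y, f y <> z) -> (graph_mat k f \oo A) (z, x) = 0 :> k.
Proof.
move=> nz; rewrite mat_compE /pushf big1 ?mulr0 // => i /eqP /oclP[g].
case: (orep i) => [[z' y'] x'] /= [zE _].
case: asboolP => [E|_]; last by rewrite !mul0r.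
by case: (nz (hact g y')); rewrite hfunP -E zE.
Qed.

Definition cograph_mat X Y (f : hmap X Y) : mat k Y X :=
  @mkinv H k (X ** Y) (fun p => graph_mat k f (p.2, p.1))
    (fun g p => invfunP (graph_mat k f) g (p.2, p.1)).

Lemma perm_direct_sum n (S : 'I_n -> perm olH mu) : exists X : perm olH mu, direct_sum S X.
Proof.
pose inj a : hmap (S a : fhset H) (fsum S) := @hsum_inj n S a.
have injI a : injective (inj a) := @hsum_injI n S a.
have inj_neq a b (x : (S a : fhset H)) (y : (S b : fhset H)) : a != b -> inj a x <> inj b y.
  exact: (@hsum_inj_neq n S a b x y).
exists (fsum S), (fun a => graph_mat k (inj a)), (fun a => cograph_mat (inj a)).
split.
- move=> a; apply: (@matP H k (S a) (S a)) => y x.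
  rewrite (@mat_comp_graphr H olH s k (S a) (fsum S) (S a) _ (inj a)) /=.
  by congr (nat_of_bool _)%:R; apply/asboolP/asboolP => [/injI|->].
- move=> a b ab; apply: (@matP H k (S b) (S a)) => y x.
  rewrite (@mat_comp_graphr H olH s k (S b) (fsum S) (S a) _ (inj b)) [LHS]/=.
  by rewrite asboolF // => E; case: (inj_neq a b y x ab).
apply: (@matP H k (fsum S) (fsum S)) => -[a y] z.
rewrite mat_sumE (bigD1 a) // big1 => [|b ba].
  rewrite [LHS]addr0 (@mat_comp_graph_inj (fsum S) (S a) (fsum S) _ (inj a) y z) //= .
  by congr (nat_of_bool _)%:R; apply/asboolP/asboolP => E; exact: esym E.
rewrite (@mat_comp_graph_notin (fsum S) (S b) (fsum S)) // => y'.
exact: inj_neq.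
Qed.

(** Every object is its own dual, and this is the duality on morphisms; it will supply the
    idempotent that cuts out the dual of a summand. *)
Definition mat_tr X Y (A : mat k X Y) : mat k Y X :=
  @mkinv H k (X ** Y) (fun p => A (p.2, p.1)) (fun g p => invfunP A g (p.2, p.1)).

Lemma mat_tr_comp X Y Z (B : mat k Y Z) (A : mat k X Y) :
  mat_tr (B \oo A) = mat_tr A \oo mat_tr B.
Proof.
apply: matP => x z; rewrite -[LHS]/((B \oo A) (z, x)) !mat_compE.
pose q : hmap (X ** Z) (Z ** X) := hpair (hsnd X Z) (hfst X Z).
pose q' : hmap (X ** Y ** Z) (Z ** Y ** X) :=
  hpair (hpair (hsnd (X ** Y) Z) (hmap_comp (hsnd X Y) (hfst (X ** Y) Z)))
    (hmap_comp (hfst X Y) (hfst (X ** Y) Z)).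
rewrite [RHS](@eq_pushf H s k (X ** Y ** Z) (X ** Z) (proj13 Z Y X) _
  (fun t => (B ((q' t).1.1, (q' t).1.2) : k) * A ((q' t).1.2, (q' t).2))).
  apply: (@pushf_bc H s k (Z ** Y ** X) (Z ** X) (X ** Y ** Z) (X ** Z) _ q q' _ _ (x, z)).
    split=> //.
    - by move=> [[z1 y1] x1] [x2 z2] /= [-> ->]; exists (x2, y1, z2).
    - by move=> [[x1 y1] z1] [[x2 y2] z2] /= [-> -> ->].
  exact: mat_hinv3.
by move=> t; rewrite /= mulrC.
Qed.

Definition mat_ev X : mat k (X ** X) (fpt H) :=
  @mkinv H k (fpt H ** (X ** X)) (fun p => graph_mat k (hmap_id X) (p.2.1, p.2.2))
    (fun g p => invfunP (graph_mat k (hmap_id X)) g (p.2.1, p.2.2)).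

Definition mat_coev X : mat k (fpt H) (X ** X) := mat_tr (mat_ev X).

Lemma mat_ev_tens_l X (A : mat k X X) t x y :
  (mat_ev X \oo (A \ox graph_mat k (hmap_id X))) (t, (x, y)) = A (y, x).
Proof.
rewrite mat_compE.
pose j : hmap (fpt H ** (X ** X)) (fpt H ** (X ** X) ** (X ** X)) :=
  hpair (hpair (hfst _ _) (hpair (hmap_comp (hsnd X X) (hsnd _ _)) (hmap_comp (hsnd X
    X) (hsnd _ _))))
    (hsnd _ _).
rewrite (@pushf_section H s k _ _ _ j).
- by rewrite /= !asboolT // mul1r mulr1.
- exact: mat_hinv3.
- by case=> [? []].
- move=> [[t' [u v]] [x' y']] /=; case: asboolP => [->|_]; last by rewrite mul0r eqxx.
  by case: asboolP => [->//|_]; rewrite !mulr0 eqxx.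
Qed.

Lemma mat_ev_tens_r X (A : mat k X X) t x y :
  (mat_ev X \oo (graph_mat k (hmap_id X) \ox A)) (t, (x, y)) = A (x, y).
Proof.
rewrite mat_compE.
pose j : hmap (fpt H ** (X ** X)) (fpt H ** (X ** X) ** (X ** X)) :=
  hpair (hpair (hfst _ _) (hpair (hmap_comp (hfst X X) (hsnd _ _)) (hmap_comp (hfst X
    X) (hsnd _ _))))
    (hsnd _ _).
rewrite (@pushf_section H s k _ _ _ j).
- by rewrite /= !asboolT // !mul1r.
- exact: mat_hinv3.
- by case=> [? []].
- move=> [[t' [u v]] [x' y']] /=; case: asboolP => [->|_]; last by rewrite mul0r eqxx.
  by case: asboolP => [->//|_]; rewrite mul0r mulr0 eqxx.
Qed.

Lemma mat_tr_tens X X' Y Y' (A : mat k X X') (B : mat k Y Y') :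
  mat_tr (A \ox B) = mat_tr A \ox mat_tr B.
Proof. by apply: matP => -[]. Qed.

Lemma mat_tr_id X : mat_tr (graph_mat k (hmap_id X)) = graph_mat k (hmap_id X).
Proof.
by apply: matP => y x /=; congr (nat_of_bool _)%:R; apply/asboolP/asboolP => ->.
Qed.

Lemma mat_trK X Y (A : mat k X Y) : mat_tr (mat_tr A) = A.
Proof. exact: matP. Qed.

Lemma mat_ev_tr X (A : mat k X X) :
  mat_ev X \oo (mat_tr A \ox graph_mat k (hmap_id X)) =
  mat_ev X \oo (graph_mat k (hmap_id X) \ox A).
Proof. by apply: matP => t [x y]; rewrite mat_ev_tens_l mat_ev_tens_r. Qed.

Lemma mat_coev_tr X (A : mat k X X) :
  (graph_mat k (hmap_id X) \ox mat_tr A) \oo mat_coev X =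
  (A \ox graph_mat k (hmap_id X)) \oo mat_coev X.
Proof.
apply: (can_inj (@mat_trK (fpt H) (X ** X))).
rewrite !mat_tr_comp (mat_tr_tens (graph_mat k (hmap_id X)) (mat_tr A)).
rewrite (mat_tr_tens A (graph_mat k (hmap_id X))) mat_tr_id !mat_trK.
by rewrite -mat_ev_tr.
Qed.

(* Both zigzags integrate, over the graph of [f'], a product of four equality
   tests that forces all coordinates to agree. *)
Lemma pushf_diag X Y (f : hmap Y (X ** X)) (j : hmap X Y) (phi : Y -> k) z x :
  hinv phi -> (forall x, f (j x) = (x, x)) -> (forall x, phi (j x) = 1) ->
  (forall y, phi y != 0 -> exists x, j x = y) ->
  pushf s f phi (z, x) = graph_mat k (hmap_id X) (z, x).
Proof.
move=> phiP fj phij phi0; have jI : injective j.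
  by move=> x1 x2 /(congr1 f); rewrite !fj => -[].
pose d : hmap X (X ** X) := hpair (hmap_id X) (hmap_id X).
rewrite (@pushf_support H s k _ _ X _ j) //.
rewrite (@eq_pushf_map H s k X (X ** X) _ d) => [|w]; last exact: fj.
rewrite (@eq_pushf H s k X (X ** X) d _ (fun=> 1)) => [|w]; last exact: phij.
rewrite /=; case: asboolP => [->|zx].
  by rewrite -[(x, x)]/(d x) pushf_inj // => x1 x2 [].
by rewrite pushf_notin // => w [zw xw]; apply: zx; rewrite -zw -xw.
Qed.

Notation gid X := (graph_mat k (hmap_id X)).

Lemma gid_neq0 X p : gid X p != 0 :> k -> p.1 = p.2.
Proof. by rewrite /=; case: asboolP => // _; rewrite eqxx. Qed.

Lemma mat_zigzag_l X :
  let P := perm olH mu in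
  comp (comp (comp (comp (runit (X : P)) (tensm (idm (X : P)) (mat_ev X : hom (tens (X
    : P) X) unit_ob)))
    (assoc (X : P) X X)) (tensm (mat_coev X : hom unit_ob (tens (X : P) X)) (idm (X :
      P)))) (lunitV (X : P))
  = idm (X : P).
Proof.
move=> P; rewrite -(compA (perm_smc olH s k)).
apply: (@matP H k X X) => z x; set B := comp (comp _ _) _; set A := comp _ (lunitV _).
have BE w t : (B : mat k (X ** X ** X) X) (w, t) =
    (gid X (w, t.1.1) : k) * gid X (t.1.2, t.2).
  case: t => [[x1 x2] x3].
  rewrite /B (@mat_comp_graphr H olH s k (X ** X ** X) (X ** (X ** X)) X _ (hassoc X X X)).
  by rewrite (@mat_comp_graphl H olH s k (X ** (X ** X)) (X ** fpt H) X _ (hfst X (hpt H))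
    (hpair (hmap_id X) (hto_pt X))) //; case=> [? []].
have AE t w : (A : mat k X (X ** X ** X)) (t, w) =
    (gid X (t.1.1, t.1.2) : k) * gid X (t.2, w).
  case: t => [[x1 x2] x3].
  by rewrite /A (@mat_comp_graphr H olH s k X (fpt H ** X) (X ** X ** X) _ (hpair
    (hto_pt X) (hmap_id X))).
apply: etrans (@mat_compE H olH s k X (X ** X ** X) X B A (z, x)) _.
pose j : hmap X (X ** (X ** X ** X) ** X) :=
  hpair (hpair (hmap_id X) (hpair (hpair (hmap_id X) (hmap_id X)) (hmap_id X))) (hmap_id X).
apply: (@pushf_diag X (X ** (X ** X ** X) ** X) _ j) => //.
- exact: mat_hinv3.
- by move=> w; rewrite BE AE /= !asboolT // !mulr1.
move=> [[z1 [[x1 x2] x3]] w]; rewrite BE AE !mulf_eq0 !negb_or -!andbA.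
case/and4P => /gid_neq0 e1 /gid_neq0 e2 /gid_neq0 e3 /gid_neq0 e4.
by exists w; move: e1 e2 e3 e4 => /= -> -> -> ->.
Qed.

Lemma mat_zigzag_r X :
  let P := perm olH mu in
  comp (comp (comp (comp (lunit (X : P)) (tensm (mat_ev X : hom (tens (X : P) X)
    unit_ob) (idm (X : P))))
    (assocV (X : P) X X)) (tensm (idm (X : P)) (mat_coev X : hom unit_ob (tens (X : P)
      X)))) (runitV (X : P))
  = idm (X : P).
Proof.
move=> P; rewrite -(compA (perm_smc olH s k)).
apply: (@matP H k X X) => z x; set B := comp (comp _ _) _; set A := comp _ (runitV _).
have BE w t : (B : mat k (X ** (X ** X)) X) (w, t) =
    (gid X (t.1, t.2.1) : k) * gid X (w, t.2.2).
  case: t => [x1 [x2 x3]].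
  rewrite /B (@mat_comp_graphr H olH s k (X ** (X ** X)) (X ** X ** X) X _ (hassocV X X X)).
  by rewrite (@mat_comp_graphl H olH s k (X ** X ** X) (fpt H ** X) X _ (hsnd (hpt H) X)
    (hpair (hto_pt X) (hmap_id X))) //; case=> [[]].
have AE t w : (A : mat k X (X ** (X ** X))) (t, w) =
    (gid X (t.1, w) : k) * gid X (t.2.1, t.2.2).
  case: t => [x1 [x2 x3]].
  by rewrite /A (@mat_comp_graphr H olH s k X (X ** fpt H) (X ** (X ** X)) _ (hpair
    (hmap_id X) (hto_pt X))).
apply: etrans (@mat_compE H olH s k X (X ** (X ** X)) X B A (z, x)) _.
pose j : hmap X (X ** (X ** (X ** X)) ** X) :=
  hpair (hpair (hmap_id X) (hpair (hmap_id X) (hpair (hmap_id X) (hmap_id X)))) (hmap_id X).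
apply: (@pushf_diag X (X ** (X ** (X ** X)) ** X) _ j) => //.
- exact: mat_hinv3.
- by move=> w; rewrite BE AE /= !asboolT // !mulr1.
move=> [[z1 [x1 [x2 x3]]] w]; rewrite BE AE !mulf_eq0 !negb_or -!andbA.
case/and4P => /gid_neq0 e1 /gid_neq0 e2 /gid_neq0 e3 /gid_neq0 e4.
by exists w; move: e1 e2 e3 e4 => /= -> -> -> ->.
Qed.

End PermObjects.

(** * Algebras without nil right ideals *)

Section Nilpotent.
Variable F : fieldType.

(** Written with [iter] so that size [0] is covered, which the induction on rank in [mxtrace_mxnil]
    can reach. *)
Definition mxnil n (M : 'M[F]_n) : Prop := exists m, iter m (mulmx M) 1%:M = 0.

Lemma mxnilE n (M : 'M[F]_n.+1) : mxnil M <-> exists m, M ^+ m = 0.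
Proof.
by split=> -[m mE]; exists m; rewrite -mE; elim: m {mE} => [|m IH] //=; rewrite ?exprS ?IH.
Qed.

(** For a rank factorization [M = C R] the traces of [C R] and [R C] agree, and [R C] is again
    nilpotent. It is smaller unless [M] is invertible, which nilpotence excludes in positive
    size. *)
Lemma mxtrace_mxnil n (M : 'M[F]_n) : mxnil M -> \tr M = 0.
Proof.
have [N] := ubnP n; elim: N n M => // N IH [|n] M nN [m Mm];
  first by rewrite /mxtrace big_ord0.
have [r_n|r_n] := eqVneq (\rank M) n.+1.
  have Mu : M \in unitmx by rewrite -row_full_unit /row_full r_n.
  have Mmu j : iter j (mulmx M) 1%:M \in unitmx.
    by elim: j => [|j IHj] /=; rewrite ?unitmx1 // unitmx_mul Mu.
  by have := Mmu m; rewrite Mm unitmxE det0 unitr0.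
have MCR := mulmx_base M; move: (col_base M) (row_base M) MCR => C R MCR.
rewrite -{1}MCR mxtrace_mulC; apply: IH.
  by rewrite ltnS in nN; apply: leq_trans nN; rewrite ltn_neqAle r_n rank_leq_row.
exists m.+1.
have E j : iter j.+1 (mulmx (R *m C)) 1%:M = R *m iter j (mulmx M) 1%:M *m C.
  elim: j => [|j IHj]; first by rewrite /= !mulmx1.
  by rewrite iterS IHj /= !mulmxA -(mulmxA R C R) -(mulmxA R (C *m R)) MCR !mulmxA.
by rewrite E Mm mulmx0 mul0mx.
Qed.

(** In a rank factorization [M = C R], idempotence forces [R C = 1]. *)
Lemma mxtrace_idem n (M : 'M[F]_n) : M *m M = M -> \tr M = (\rank M)%:R.
Proof.
move=> MM; have [Cf [Rf MCR]] := (col_base_full M, (row_base_free M, mulmx_base M)).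
move: (col_base M) (row_base M) Cf Rf MCR => C R Cf Rf MCR.
have E : R *m C = 1%:M.
  apply: (row_full_inj Cf); apply: (row_free_inj Rf).
  by rewrite mulmx1 !mulmxA MCR -mulmxA MCR MM.
by rewrite -{1}MCR mxtrace_mulC E mxtrace1.
Qed.

(** This is the Fitting projector onto the part where [M] is invertible. A polynomial without
    constant term keeps it in the right ideal generated by [M], and makes its trace a combination of
    traces of positive powers. *)
Lemma idem_poly n (M : 'M[F]_n.+1) : ~ mxnil M ->
  exists p : {poly F}, let f := horner_mx M ('X * p) in f * f = f /\ f != 0.
Proof.
move=> /mxnilE Mn; have c0 : char_poly M != 0 by apply: monic_neq0; apply: char_poly_monic.
have [m [q /implyP/(_ c0) q0 cE]] := multiplicity_XsubC (char_poly M) 0.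
rewrite subr0 in cE.
(* One more than the multiplicity of the root [0], so that the projector is divisible by ['X] even
   when [M] is invertible. *)
have : coprimep ('X ^+ m.+1) q.
  by rewrite coprimep_expl // coprimep_sym coprimepX.
move=> /Bezout_eq1_coprimepP[[u v] /= uv].
have cM : horner_mx M (q * 'X^m) = 0 by rewrite -cE Cayley_Hamilton.
exists (u * 'X^m); set f := horner_mx M _.
have fE : f = horner_mx M (u * 'X ^+ m.+1) by rewrite /f exprS mulrCA.
have fv : f + horner_mx M (v * q) = 1 by rewrite fE -rmorphD uv rmorph1.
have f0 : f * horner_mx M (v * q) = 0.
  have pE : u * 'X ^+ m.+1 * (v * q) = u * 'X * v * (q * 'X^m) by rewrite exprS; ring.
  by rewrite fE -rmorphM pE rmorphM /= cM mulr0.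
split; first by rewrite -{3}[f]mulr1 -fv mulrDr f0 addr0.
apply/eqP => ff; apply: Mn; exists m.
rewrite -[M ^+ m]mul1r -fv ff add0r -{2}(horner_mx_X M) -rmorphXn -rmorphM -mulrA.
by rewrite rmorphM /= cM mulr0.
Qed.

(** Otherwise [idem_poly] yields a nonzero idempotent of trace [0], whereas its trace is its rank,
    nonzero in characteristic [0]. *)
Lemma mxnil_trace0 n (M : 'M[F]_n.+1) : [pchar F] =i pred0 ->
  (forall m, \tr (M ^+ m.+1) = 0) -> mxnil M.
Proof.
move=> ch0 tr0; apply: contrapT => /idem_poly[p [ff /eqP f0]]; apply: f0.
set f := horner_mx _ _ in ff *.
have : \tr f = 0.
  rewrite /f; have -> : 'X * p = \sum_(i < size p) p`_i *: 'X ^+ i.+1.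
    rewrite -{1}[p]coefK poly_def mulr_sumr; apply: eq_bigr => i _.
    by rewrite exprS -scalerAr.
  rewrite rmorph_sum raddf_sum /= big1 // => i _.
  by rewrite linearZ /= rmorphXn /= horner_mx_X mxtraceZ tr0 mulr0.
have /pcharf0P nat0 := ch0; rewrite mxtrace_idem // => /eqP; rewrite nat0.
by rewrite mxrank_eq0 => /eqP.
Qed.

End Nilpotent.

(* A finite dimensional algebra on [F^(n+1)], given by its right regular
   representation [R]: the product is [u * v = u *m R v]. *)
Section RegularAlgebra.
Variables (F : fieldType) (n : nat).
Variables (R : 'rV[F]_n.+1 -> 'M[F]_n.+1) (e : 'rV[F]_n.+1).
Hypothesis R_lin : linear R.
Hypothesis R_mul : forall u v, R (u *m R v) = R u *m R v.
Hypothesis R_one : R e = 1%:M.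
Hypothesis mul_onel : forall v, e *m R v = v.
Hypothesis nonnil : forall u, u != 0 -> exists v, ~ mxnil (R (u *m R v)).

Notation "u ** v" := (u *m R v) (at level 40, left associativity).
Implicit Types u v w : 'rV[F]_n.+1.

Let RD u v : R (u + v) = R u + R v.
Proof. by rewrite -[u in LHS]scale1r R_lin scale1r. Qed.
Let R0 : R 0 = 0.
Proof. by apply: (addrI (R 0)); rewrite -RD !addr0. Qed.
Let RZ a u : R (a *: u) = a *: R u.
Proof. by rewrite -[a *: u]addr0 R_lin R0 addr0. Qed.
Let RB u v : R (u - v) = R u - R v.
Proof. by rewrite RD -scaleN1r RZ scaleN1r. Qed.
Let mulA u v w : u ** (v ** w) = u ** v ** w.
Proof. by rewrite R_mul mulmxA. Qed.
Let mulBl u v w : (u - v) ** w = u ** w - v ** w.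
Proof. exact: mulmxBl. Qed.
Let mulDl u v w : (u + v) ** w = u ** w + v ** w.
Proof. exact: mulmxDl. Qed.
Let mulBr u v w : w ** (u - v) = w ** u - w ** v.
Proof. by rewrite RB mulmxBr. Qed.
Let mulDr u v w : w ** (u + v) = w ** u + w ** v.
Proof. by rewrite RD mulmxDr. Qed.

Lemma regular_horner c p : R (e *m horner_mx (R c) p) = horner_mx (R c) p.
Proof.
elim/poly_ind: p => [|p a IH]; first by rewrite rmorph0 mulmx0 R0.
rewrite rmorphD rmorphM /= horner_mx_X horner_mx_C mulmxDr RD; congr (_ + _).
  by rewrite -[_ * R c]/(_ *m R c) mulmxA R_mul IH.
by rewrite -scalemx1 -scalemxAr mulmx1 RZ R_one.
Qed.

(** The row space of [L u] is the right ideal generated by [u], so its rank measures the growth of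
    right ideals. *)
Let L u : 'M[F]_n.+1 := lin1_mx (fun v => u ** v).

Let mul_L u v : v *m L u = u ** v.
Proof.
have lin : linear (fun v => u ** v).
  by move=> a w w'; rewrite R_lin mulmxDr scalemxAr.
rewrite {1}[v]row_sum_delta mulmx_suml.
rewrite [v in RHS]row_sum_delta.
have Rsum (G : 'I_n.+1 -> 'rV[F]_n.+1) : R (\sum_j G j) = \sum_j R (G j).
  by apply: (big_morph R RD R0).
rewrite Rsum mulmx_sumr; apply: eq_bigr => j _.
rewrite RZ -scalemxAr -scalemxAl; congr (_ *: _).
by rewrite -rowE; apply/rowP => i; rewrite !mxE.
Qed.

(* Enlarge an idempotent of [a * E] until it fixes [a]. *)
Lemma regular_vonNeumann a : exists b, a ** b ** a = a.
Proof.
(* Induction on the codimension of the right ideal of the idempotent [g], starting from [g = 0]. *)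
suff main d g b : g = a ** b -> g ** g = g -> (n.+1 - \rank (L g) < d)%N ->
    exists b, a ** b ** a = a.
  by apply: (main _ 0 0 _ _ (ltnSn _)); rewrite ?R0 ?mulmx0.
elim: d g b => // d IH g b gE gg rk.
have [/eqP|a'0] := eqVneq (a - g ** a) 0.
  by rewrite subr_eq0 => /eqP ag; exists b; rewrite -gE -ag.
have [y /idem_poly[p]] := nonnil a'0.
set a' := a - g ** a in a'0 *; set c := a' ** y.
set f := horner_mx _ _ => -[ff f0]; pose h := e *m f.
have Rh : R h = f by apply: regular_horner.
have hh : h ** h = h by rewrite Rh /h -mulmxA; congr (_ *m _).
have h0 : h != 0 by apply: contraNneq f0 => h0; rewrite -Rh h0 R0.
have ga' : g ** a' = 0 by rewrite /a' mulBr mulA gg subrr.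
pose z := e *m horner_mx (R c) p.
have hE : h = a' ** (y ** z).
  rewrite mulA /h /f rmorphM /= horner_mx_X -[_ * _]/(R c *m _) mulmxA.
  by rewrite mul_onel /z regular_horner.
have gh : g ** h = 0 by rewrite hE mulA ga' mul0mx.
(* As [g h = 0], this is again idempotent, and a left identity for both [g] and [h]. The right ideal
   grows strictly, since an [h] in the ideal of [g] would equal [g h = 0]. *)
pose g' := g + h - h ** g.
have g'g : g' ** g = g by rewrite /g' mulBl mulDl gg -mulA gg addrK.
have g'h : g' ** h = h.
  by rewrite /g' mulBl mulDl gh hh add0r -mulA gh R0 mulmx0 subr0.
have g'g' : g' ** g' = g' by rewrite {2}/g' mulBr mulDr g'g g'h mulA g'h.
pose w := y ** z - b ** (a ** (y ** z)).
have hw : h = a ** w by rewrite hE /a' mulBl mulBr gE -!mulA.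
have g'E : g' = a ** (b + w - w ** g) by rewrite mulBr mulDr -gE mulA -hw.
have lt : (\rank (L g) < \rank (L g'))%N.
  have : (L g < L g')%MS.
    apply/andP; split.
      by apply/row_subP => i; rewrite rowE mul_L -g'g -mulA -mul_L; exact: submxMl.
    apply/negP => /(submx_trans (submxMl h (L g'))); rewrite mul_L g'h => /submxP[v hv].
    by move/eqP: h0; apply; rewrite hv mul_L -{1}gg -mulA -(mul_L g v) -hv gh.
  by rewrite ltmxErank => /andP[].
apply: (IH _ _ g'E g'g'); apply: leq_trans (_ : n.+1 - \rank (L g) <= d)%N => //.
by apply: ltn_sub2l => //; apply: leq_trans lt _; apply: rank_leq_row.
Qed.

End RegularAlgebra.

(** Descent: a kernel vector that vanishes modulo [2] can be halved, which lowers the sum of the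
    absolute values of its entries. *)
Lemma primitive_kernel n (g : 'M[int]_n) : \det g = 0 ->
  exists u : 'rV[int]_n, u *m g = 0 /\ map_mx intr u != 0 :> 'rV['F_2]_n.
Proof.
move=> /eqP/det0P[v]; have [N] := ubnP (\sum_j `|v 0%R j|%N); elim: N v => // N IH v vN v0 vg.
have [/rowP vz|] := eqVneq (map_mx intr v : 'rV['F_2]_n) 0; last by move=> ?; exists v.
have veven j : v 0 j = (v 0%R j %/ 2)%Z * 2.
  have := vz j; rewrite !mxE => /eqP v2.
  rewrite divzK // dvdzE /=; apply/eqP.
  have : (`|v 0%R j|%N)%:R == 0 :> 'F_2.
    rewrite -[_%:R]/((`|v 0%R j|%N)%:Z%:~R) abszE.
    by case: (ger0P (v 0 j)) => _; rewrite ?rmorphN ?oppr_eq0.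
  by rewrite -(dvdn_pcharf (pchar_Fp (isT : prime 2))) => /eqP.
pose w : 'rV[int]_n := \row_j (v 0%R j %/ 2)%Z.
have vw : v = 2 *: w by apply/rowP => j; rewrite !mxE {1}veven mulrC.
have w0 : w != 0 by apply: contraNneq v0 => w0; rewrite vw w0 scaler0.
apply: (IH w) => //; last first.
  by move/eqP: vg; rewrite vw -scalemxAl scalemx_eq0 /= => /eqP.
rewrite ltnS in vN; apply: leq_trans vN.
have /rowP/eqfunP : ~ w = 0 by apply/eqP.
rewrite negb_forall => /existsP[j wj].
rewrite (bigD1 j) //= [X in (_ < X)%N](bigD1 j) //=.
have E i : `|v 0%R i|%N = (2 * `|w 0%R i|)%N by rewrite vw mxE abszM.
rewrite -addSn leq_add //; last by apply: leq_sum => i _; rewrite E leq_pmull.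
rewrite E mul2n -addnn -[X in (X < _)%N]addn0 ltn_add2l absz_gt0.
by move: wj; rewrite [X in _ != X]mxE.
Qed.

(** * Algebras with integer structure constants *)

Section IntegralAlgebra.
Variables (n : nat) (c : 'I_n.+1 -> 'M[int]_n.+1).

(** The integer matrix [c j] is right multiplication by the basis vector [j], so one family [c]
    describes the algebra over all fields. *)
Definition rreg (F : fieldType) (v : 'rV[F]_n.+1) : 'M[F]_n.+1 :=
  \sum_j v 0 j *: map_mx intr (c j).

Lemma rreg_linear (F : fieldType) : linear (@rreg F).
Proof.
move=> a u v; rewrite /rreg scaler_sumr -big_split /=; apply: eq_bigr => j _.
by rewrite !mxE scalerDl scalerA.
Qed.

Definition nonnil_mul (F : fieldType) : Prop :=
  forall u : 'rV[F]_n.+1, u != 0 -> exists v, ~ mxnil (rreg (u *m rreg v)).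

Let regZ (v : 'rV[int]_n.+1) : 'M[int]_n.+1 := \sum_j v 0 j *: c j.

Let map_regZ (F : fieldType) v : map_mx intr (regZ v) = rreg (map_mx intr v : 'rV[F]_n.+1).
Proof.
rewrite /regZ raddf_sum; apply: eq_bigr => j _.
by rewrite /= map_mxZ mxE.
Qed.

Let gram : 'M[int]_n.+1 := \matrix_(i, j) \tr (c i *m c j).

Let gramE (F : fieldType) (u v : 'rV[F]_n.+1) :
  \tr (rreg u *m rreg v) = (u *m map_mx intr gram *m v^T) 0 0.
Proof.
rewrite mxE /rreg mulmx_sumr raddf_sum /=; apply: eq_bigr => j _.
rewrite mulmx_suml raddf_sum /= !mxE mulr_suml; apply: eq_bigr => i _.
rewrite -scalemxAl -scalemxAr !mxtraceZ -map_mxM trace_map_mx !mxE.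
by rewrite mulrA mulrAC.
Qed.

(* The trace form of the regular representation has an integral Gram matrix.
   Were it singular, a primitive integral kernel vector would, by the traces of
   all its powers, generate a nil right ideal, which survives modulo [2]. *)
Lemma gram_det : (forall u v : 'rV[rat]_n.+1, rreg (u *m rreg v) = rreg u *m rreg v) ->
  nonnil_mul 'F_2 -> \det gram != 0.
Proof.
move=> mulQ nn2; apply/eqP => /primitive_kernel[u [ug /nn2[v]]]; apply.
pose w : 'rV[int]_n.+1 := \row_j (val (v 0 j))%:Z.
have wv : map_mx intr w = v.
  by apply/rowP => j; rewrite !mxE /= -[RHS]natr_Zp.
have : mxnil (map_mx intr (regZ (u *m regZ w)) : 'M[rat]_n.+1).
  rewrite map_regZ map_mxM map_regZ mulQ; apply: mxnil_trace0.
    exact: Num.Theory.pchar_num.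
  move=> m; set U := map_mx _ u; set W := map_mx _ w.
  (* A positive power of [U W] is [U] times some [z], so its trace is a value of the form at the
     kernel vector. *)
  have [z zE] : exists z, rreg W *m (rreg U *m rreg W) ^+ m = rreg z.
    elim: m => [|m [z zE]]; first by exists W; rewrite expr0 mulmx1.
    exists (z *m rreg (U *m rreg W)).
    by rewrite mulQ -zE mulQ exprSr -[_ * _]/(_ *m _) !mulmxA.
  rewrite exprS -[_ * _]/(_ *m _) -mulmxA zE gramE.
  by rewrite -map_mxM ug map_mx0 mul0mx mxE.
move=> [m mE]; exists m.
(* A power of an integer matrix that vanishes over the rationals vanishes over the integers, hence
   modulo [2]. *)
have intE (F : fieldType) (M : 'M[int]_n.+1) :
    iter m (mulmx (map_mx intr M : 'M[F]_n.+1)) 1%:M = map_mx intr (iter m (mulmx M) 1%:M).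
  by elim: m {mE} => [|m IH] /=; rewrite ?map_mx1 // IH map_mxM.
rewrite -wv -(map_regZ _ w) -map_mxM -map_regZ intE.
move: mE; rewrite intE => /matrixP mE.
apply/matrixP => i j; have := mE i j; rewrite !mxE => /eqP.
by rewrite intr_eq0 => /eqP ->.
Qed.

(** A nonzero integer determinant stays invertible in characteristic [0], so [u] pairs nontrivially
    with some basis vector; that product has nonzero trace and is not nilpotent. *)
Lemma nonnil_mul_char0 (F : fieldType) : [pchar F] =i pred0 ->
  (forall u v : 'rV[F]_n.+1, rreg (u *m rreg v) = rreg u *m rreg v) ->
  \det gram != 0 -> nonnil_mul F.
Proof.
move=> /pcharf0P ch0 mulF gdet u u0.
have gF : (map_mx intr gram : 'M[F]_n.+1) \in unitmx.
  rewrite unitmxE det_map_mx unitfE; case: (\det gram) gdet => [m|m] m0.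
    by rewrite [X in X == _]/= -[X in X == _]/(m%:R : F) ch0.
  by rewrite NegzE rmorphN oppr_eq0 /= -[X in X == _]/(m.+1%:R : F) ch0.
have /eqP : u *m map_mx intr gram != 0.
  by apply: contraNneq u0 => ug; rewrite -[u](mulmxK gF) ug mul0mx.
move=> /rowP/eqfunP; rewrite negb_forall => /existsP[j gj].
exists (delta_mx 0 j); rewrite mulF => /mxtrace_mxnil; rewrite gramE => E.
by move: gj; rewrite trmx_delta -colE mxE in E; rewrite E mxE eqxx.
Qed.

End IntegralAlgebra.

(** Every cycle of [f] has length [1] or [p], and a cycle of length [p] contributes [p] equal
    terms. *)
Lemma sum_period (F : fieldType) (p : nat) (I : finType) (f : I -> I) (w : I -> F) :
  p \in [pchar F] -> (forall i, iter p f i = i) -> (forall i, w (f i) = w i) ->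
  \sum_i w i = \sum_(i | f i == i) w i.
Proof.
move=> chp fp wf; have pp := pcharf_prime chp.
have finj : injective f.
  apply: (@can_inj _ _ _ (iter p.-1 f)) => i.
  by rewrite -iterSr prednK ?prime_gt0 // fp.
have fsym := fconnect_sym finj.
have wconn i j : fconnect f i j -> w j = w i.
  by move=> /iter_findex <-; elim: (findex _ _ _) => //= m IH; rewrite wf.
have fixed i j : f i = i -> fconnect f i j -> j = i.
  by move=> fi /iter_findex <-; elim: (findex _ _ _) => //= m ->.
have ordp i : f i != i -> order f i = p.
  move=> fi; have o1 : order f i != 1%N.
    by apply: contra fi => /eqP o1; have /eqP := iter_order finj i; rewrite o1.
  have : (order f i %| p)%N.
    rewrite /dvdn; have lt : (p %% order f i < order f i)%N by rewrite ltn_mod order_gt0.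
    have := findex_iter lt; rewrite [X in findex _ _ X](_ : _ = i) ?findex0 => [<- //|].
    rewrite -[RHS]fp [in RHS](divn_eq p (order f i)) addnC iterD; congr iter.
    by elim: (p %/ _)%N => //= m IH; rewrite mulSn iterD -IH iter_order.
  by move=> /(prime_nt_dvdP pp o1).
rewrite (bigID (fun i => f i == i)) /= -[RHS]addr0; congr (_ + _).
rewrite (partition_big (froot f) predT) //=; apply: big1 => r _.
have [i0 /andP[fi0 /eqP ri0]|none] := pickP (fun i => (f i != i) && (froot f i == r));
  last first.
  by rewrite big_pred0.
have E i : (f i != i) && (froot f i == r) = fconnect f i0 i.
  rewrite -ri0 (eq_sym (froot f i)) (root_connect fsym); apply: andb_idl => i0i.
  apply: contra fi0 => /eqP fi; rewrite (fixed i i0) ?fi //.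
  by rewrite fsym.
rewrite (eq_bigl _ _ E) (eq_bigr (fun=> w i0)) => [|i]; last exact: wconn.
by rewrite sumr_const -/(order f i0) ordp // -mulr_natr pcharf0 ?mulr0.
Qed.

(** * Traces of nilpotent endomorphisms *)

Section EndomorphismAlgebra.
Variables (H : permGroup) (olH : oligomorphic H) (s : orbit_sign H).

Notation "X ** Y" := (fprod olH X Y) (at level 40, left associativity).
Notation mcomp B A := (mat_comp (measure_intr olH _ (sign_measure olH s)) B A).

Lemma pushf_sum (R : comNzRingType) (I : Type) (r : seq I) (X Y : fhset H) (f : hmap X Y)
    (phi : I -> X -> R) y :
  pushf s f (fun x => \sum_(i <- r) phi i x) y = \sum_(i <- r) pushf s f (phi i) y.
Proof.
rewrite /pushf -mulr_sumr; congr (_ * _); rewrite exchange_big /=.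
by apply: eq_bigr => i _; rewrite mulr_suml.
Qed.

Lemma pushf_scale (R : comNzRingType) (X Y : fhset H) (f : hmap X Y) (a : R)
    (phi : X -> R) y :
  pushf s f (fun x => a * phi x) y = a * pushf s f phi y.
Proof.
rewrite /pushf mulrCA; congr (_ * _); rewrite mulr_sumr.
by apply: eq_bigr => i _; rewrite mulrA.
Qed.

Lemma pushf_intr (R : comNzRingType) (X Y : fhset H) (f : hmap X Y) (phi : X -> int) y :
  pushf s f (fun x => (phi x)%:~R : R) y = (pushf s f phi y)%:~R.
Proof.
rewrite /pushf intrM /rsgn intz; congr (_ * _).
by rewrite raddf_sum; apply: eq_bigr => i _; rewrite /= intrM intz.
Qed.

Section Coordinates.
Variables (X : fhset H) (n : nat).
Hypothesis nE : nor (X ** X) = n.+1.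

Let rep (i : 'I_n.+1) : X ** X := orep (cast_ord (esym nE) i).
Let cls (p : X ** X) : 'I_n.+1 := cast_ord nE (ocl p).

Let clsK i : cls (rep i) = i.
Proof. by rewrite /cls /rep oclK cast_ordKV. Qed.

Let rep_cls (T : Type) (phi : X ** X -> T) p : hinv phi -> phi (rep (cls p)) = phi p.
Proof. by move=> phiP; apply: hinv_ocl phiP _; rewrite /rep /cls cast_ordK oclK. Qed.

Definition mcoord (F : fieldType) (A : mat F X X) : 'rV[F]_n.+1 := \row_j A (rep j).

Lemma mat_of_coord_subproof (F : fieldType) (v : 'rV[F]_n.+1) g p :
  v 0 (cls (hact g p)) = v 0 (cls p).
Proof. by rewrite /cls ocl_hact. Qed.

Definition mat_of_coord (F : fieldType) (v : 'rV[F]_n.+1) : mat F X X :=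
  @mkinv H F (X ** X) (fun p => v 0 (cls p)) (mat_of_coord_subproof v).

Lemma mat_of_coordK F : cancel (@mat_of_coord F) (@mcoord F).
Proof. by move=> v; apply/rowP => j; rewrite mxE /= clsK. Qed.

Lemma mcoordK F : cancel (@mcoord F) (@mat_of_coord F).
Proof.
move=> A; apply: (@matP H F X X) => y x; rewrite /= mxE.
exact: (@rep_cls _ _ (y, x) (invfun_hinv (X := X ** X) A)).
Qed.

(** Signs and indicators of orbits are integers, so the products of basis matrices can be computed
    over [int], before any field is chosen. *)
Definition struct_const (j : 'I_n.+1) : 'M[int]_n.+1 :=
  \matrix_(i, l) @pushf H s int (X ** X ** X) (X ** X) (proj13 X X X)
    (fun t => (cls t.1 == i)%:R * (cls (t.1.2, t.2) == j)%:R) (rep l).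

Lemma mcoord_comp (F : fieldType) (A B : mat F X X) :
  mcoord (mcomp A B) = mcoord A *m rreg struct_const (mcoord B).
Proof.
apply/rowP => l; rewrite mxE mat_compE mxE.
rewrite (@eq_pushf H s F (X ** X ** X) (X ** X) (proj13 X X X) _ (fun t => \sum_i
  \sum_j (mcoord A 0 i * mcoord B 0 j) *
   (((cls t.1 == i)%:R * (cls (t.1.2, t.2) == j)%:R : int)%:~R : F))).
  rewrite pushf_sum; apply: eq_bigr => i _; rewrite pushf_sum.
  rewrite /rreg summxE mulr_sumr; apply: eq_bigr => j _.
  by rewrite pushf_scale pushf_intr -mulrA !mxE.
move=> [[z y] x] /=.
rewrite (bigD1 (cls (z, y))) //= [X in _ + X]big1 => [|i /negbTE ni]; last first.
  by apply: big1 => j _; rewrite eq_sym ni mul0r mulr0.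
rewrite (bigD1 (cls (y, x))) //= [X in _ + X + _]big1 => [|j /negbTE nj]; last first.
  by rewrite (eq_sym _ j) nj !mulr0.
rewrite !eqxx !addr0 !mulr1n mulr1 mulr1z mulr1 !mxE.
by rewrite (@rep_cls _ _ (z, y) (invfun_hinv (X := X ** X) A))
           (@rep_cls _ _ (y, x) (invfun_hinv (X := X ** X) B)).
Qed.

Let id_mat F : mat F X X := @graph_mat H F X X (hmap_id X).

Lemma rreg_mul (F : fieldType) (u v : 'rV[F]_n.+1) :
  rreg struct_const (u *m rreg struct_const v) = rreg struct_const u *m rreg struct_const v.
Proof.
apply/row_matrixP => i; rewrite !rowE mulmxA -[delta_mx 0 i]mat_of_coordK.
rewrite -[u]mat_of_coordK -[v]mat_of_coordK -!mcoord_comp.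
by rewrite (mat_compA olH s).
Qed.

Lemma rreg_one (F : fieldType) : rreg struct_const (mcoord (id_mat F)) = 1%:M.
Proof.
apply/row_matrixP => i; rewrite !rowE mulmx1 -[delta_mx 0 i]mat_of_coordK -mcoord_comp.
by congr mcoord; apply: (@matP H F X X) => y x; rewrite (@mat_comp_graphr _ olH s F X X X).
Qed.

Lemma rreg_onel (F : fieldType) (v : 'rV[F]_n.+1) :
  mcoord (id_mat F) *m rreg struct_const v = v.
Proof.
rewrite -{1}[v]mat_of_coordK -mcoord_comp -[RHS]mat_of_coordK; congr mcoord.
apply: (@matP H F X X) => y x.
by rewrite (@mat_comp_graphl _ olH s F X X X _ (hmap_id X) (hmap_id X)).
Qed.

Lemma mat_vonNeumann_coord (F : fieldType) : nonnil_mul struct_const F ->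
  forall A : mat F X X, exists B : mat F X X, mcomp (mcomp A B) A = A.
Proof.
move=> nn A; have [b bE] := @regular_vonNeumann F n (@rreg n struct_const F)
  (mcoord (id_mat F)) (@rreg_linear _ _ F) (@rreg_mul F) (rreg_one F) (@rreg_onel F) nn
    (mcoord A).
exists (mat_of_coord b); apply: (can_inj (@mcoordK F)).
by rewrite !mcoord_comp mat_of_coordK.
Qed.

Lemma mcoord0 F : mcoord (0 : mat F X X) = 0.
Proof. by apply/rowP => j; rewrite !mxE. Qed.

End Coordinates.

End EndomorphismAlgebra.

(** * The Frobenius identity for traces *)

Section Trace.
Variables (H : permGroup) (olH : oligomorphic H) (s : orbit_sign H).
Hypothesis torsion_free : forall (X : hset H) (x : X) (g : H) n, (0 < n)%N ->
  hact (g ^+ n)%g x = x -> hact g x = x.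
Variable F : fieldType.

Notation "X ** Y" := (fprod olH X Y) (at level 40, left associativity).
Notation mcomp B A := (mat_comp (measure_intr olH F (sign_measure olH s)) B A).

Definition mtrace (X : fhset H) (A : mat F X X) : F := isum s (fun x => A (x, x) : F).

Lemma mat_hinv (X Y : fhset H) (A : mat F X Y) : @hinv H F (Y ** X) (fun p => A p).
Proof. exact: (invfun_hinv (X := Y ** X) A). Qed.

Lemma mtrace_comp (X : fhset H) (A B : mat F X X) :
  mtrace (mcomp A B) = @isum H s F (X ** X) (fun p => (A (p.1, p.2) : F) * B (p.2, p.1)).
Proof.
rewrite /mtrace -(isum_pushf s (hfst X X : hmap (X ** X) X)); apply: eq_isum => x.
rewrite mat_compE; pose q : hmap X (X ** X) := hpair (hmap_id X) (hmap_id X).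
apply: (@pushf_bc H s F (X ** X ** X) (X ** X) (X ** X) X (proj13 X X X) q
  (hpair (hmap_id (X ** X)) (hfst X X)) (hfst X X) _ x); last exact: mat_hinv3.
split=> //.
- by move=> [[z y] x'] x1 /= [-> ->]; exists (x1, y).
- by move=> [z y] [z' y'] /= [-> ->].
Qed.

(** Pairing with the indicator of one transposed orbit isolates the value of [A] there, up to a
    sign, which is invertible. *)
Lemma mtrace_nondeg (X : fhset H) (A : mat F X X) : A != 0 ->
  exists B : mat F X X, mtrace (mcomp A B) != 0.
Proof.
move=> A0; have [p Ap] : exists p : X ** X, A p != 0 :> F.
  apply: contrapT => /forallNP A0'; move/eqP: A0; apply.
  by apply: (@matP H F X X) => y x; have [//|/A0'] := eqVneq (A (y, x) : F) 0.
pose B : mat F X X := @mkinv H F (X ** X)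
  (fun q => (@ocl H (X ** X) (q.2, q.1) == ocl p)%:R)
  (fun g q => congr1 (fun i => (i == ocl p)%:R) (@ocl_hact H (X ** X) g (q.2, q.1))).
exists B; rewrite mtrace_comp /isum (bigD1 (ocl p)) //= big1 => [|i /negbTE ni].
  rewrite -surjective_pairing oclK eqxx mulr1 addr0.
  rewrite (@hinv_ocl H _ (X ** X) (fun q => A q) _ p (mat_hinv A)) ?oclK //.
  by rewrite mulf_neq0 //; apply/eqP => s0; have := rsgn_sq s F (orep (ocl p));
    rewrite s0 mul0r => /eqP; rewrite eq_sym oner_eq0.
by rewrite -surjective_pairing oclK ni mulr0 mul0r.
Qed.

(** Words are iterated products, to which push-forward applies; [pseq] turns them into sequences,
    where rotation is easy to handle. *)
Fixpoint hpows (X : fhset H) (m : nat) : fhset H :=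
  if m is m.+1 then X ** hpows X m else fpt H.

Fixpoint pseq (X : fhset H) (m : nat) : hpows X m -> seq X :=
  if m is m.+1 return hpows X m -> seq X then fun t => t.1 :: pseq t.2 else fun=> [::].

Fixpoint psnoc (X : fhset H) (m : nat) : hpows X m -> X -> hpows X m.+1 :=
  if m is m.+1 return hpows X m -> X -> hpows X m.+1
  then fun t x => (t.1, psnoc t.2 x) else fun _ x => (x, tt).

Fixpoint pconst (X : fhset H) (m : nat) (x : X) : hpows X m :=
  if m is m.+1 return hpows X m then (x, pconst m x) else tt.

(** The product of the entries of [A] along the path from [z] through the letters of [t] to [x];
    integrated over [t], it is an entry of a power of [A]. *)
Fixpoint walk (X : fhset H) (A : mat F X X) (m : nat) : X -> hpows X m -> X -> F :=
  if m is m.+1 return X -> hpows X m -> X -> F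
  then fun z t x => (A (z, t.1) : F) * walk A t.1 t.2 x else fun z _ x => A (z, x).

Variable X : fhset H.
Implicit Types A B : mat F X X.

Lemma pseq_inj m : injective (@pseq X m).
Proof.
elim: m => [[] []|m IH] //= [x t] [x' t'] /= [-> /IH ->] //.
Qed.

Lemma size_pseq m (t : hpows X m) : size (pseq t) = m.
Proof. by elim: m t => //= m IH t; rewrite IH. Qed.

Lemma pseq_psnoc m (t : hpows X m) x : pseq (psnoc t x) = rcons (pseq t) x.
Proof. by elim: m t => //= m IH t; rewrite -IH. Qed.

Lemma pseq_pconst m (x : X) : pseq (pconst m x) = nseq m x.
Proof. by elim: m => //= m ->. Qed.

Lemma pseq_hact m (g : H) (t : hpows X m) : pseq (hact g t) = [seq hact g x | x <- pseq t].
Proof. by elim: m t => //= m IH t; rewrite IH. Qed.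

Lemma prot_subproof m (g : H) (t : hpows X m.+1) :
  psnoc (hact g t).2 (hact g t).1 = hact g (psnoc t.2 t.1).
Proof. by apply: pseq_inj; rewrite pseq_psnoc !pseq_hact pseq_psnoc map_rcons. Qed.

Definition prot m : hmap (hpows X m.+1) (hpows X m.+1) :=
  @HMap H (hpows X m.+1) (hpows X m.+1) (fun t => psnoc t.2 t.1) (@prot_subproof m).

Lemma pseq_prot m (t : hpows X m.+1) : pseq (prot m t) = rot 1 (pseq t).
Proof. by rewrite [LHS](pseq_psnoc t.2 t.1) -rot1_cons. Qed.

Lemma iter_prot m (t : hpows X m.+1) : iter m.+1 (prot m) t = t.
Proof.
have E j : (j <= m.+1)%N -> pseq (iter j (prot m) t) = rot j (pseq t).
  elim: j => [|j IH] le; first by rewrite rot0.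
  by rewrite iterS pseq_prot IH ?(ltnW le) // -rotS // size_pseq.
by apply: pseq_inj; rewrite E // -{1}(size_pseq t) rot_size.
Qed.

Lemma prot_inj m : injective (prot m).
Proof.
move=> t t' E; apply: pseq_inj; apply: (@rot_inj 1).
by rewrite -!pseq_prot E.
Qed.

Lemma prot_fixed m (t : hpows X m.+1) : prot m t = t -> t = pconst m.+1 t.1.
Proof.
move=> /(congr1 (@pseq _ _)); rewrite pseq_prot => E; apply: pseq_inj; rewrite pseq_pconst.
case: t E => x l /=; rewrite rot1_cons => E; congr cons.
have := size_pseq l; move: (pseq l) E => {l}; elim: m x => [|m IH] x [|y l] //= [-> E] [sl].
by congr cons; apply: IH.
Qed.

Lemma pconst_subproof m (g : H) (x : X) : pconst m (hact g x) = hact g (pconst m x).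
Proof. by elim: m => //= m ->. Qed.

Definition hconst m : hmap X (hpows X m) := @HMap H X (hpows X m) (pconst m)
  (@pconst_subproof m).

(** If rotation sends [t] to [g t], then [g^(m+1)] fixes [t], and by torsion-freeness so does [g];
    the word equals its rotation. *)
Lemma prot_orbit m (t : hpows X m.+1) : ocl (prot m t) = ocl t -> t = pconst m.+1 t.1.
Proof.
move=> /esym/oclP[g gE]; apply: prot_fixed; rewrite gE.
apply: (@torsion_free _ _ _ m.+1) => //; rewrite -[RHS]iter_prot.
suff E j : hact (g ^+ j)%g t = iter j (prot m) t by apply: E.
elim: j => [|j IH]; first by rewrite expg0 hact1.
by rewrite expgSr hactM -gE -hfunP IH.
Qed.

Lemma walk_hinv A m : @hinv H F (X ** hpows X m ** X) (fun t => walk A t.1.1 t.1.2 t.2).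
Proof.
move=> g [[z t] x] /=; elim: m z t => [z _|m IH z [y t]] /=.
  by rewrite -[RHS](invfunP A g (z, x)).
by rewrite IH -(invfunP A g (z, y)).
Qed.

Lemma walk_psnoc A m z (t : hpows X m) y x :
  walk A z (psnoc t y) x = walk A z t y * A (y, x).
Proof. by elim: m z t => //= m IH z [z' t] /=; rewrite IH mulrA. Qed.

Definition cyc A m (t : hpows X m.+1) : F := walk A t.1 t.2 t.1.

Lemma cyc_prot A m (t : hpows X m.+1) : cyc A (prot m t) = cyc A t.
Proof.
case: m t => [[x []]|m [x [y t]]] //.
by rewrite -[LHS]/(walk A y (psnoc t x) y) walk_psnoc mulrC.
Qed.

Lemma cyc_hinv A m : hinv (@cyc A m).
Proof. by move=> g t; apply: (walk_hinv A g (t.1, t.2, t.1)). Qed.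

Lemma cyc_pconst A m x : cyc A (pconst m.+1 x) = (A (x, x) : F) ^+ m.+1.
Proof.
rewrite /cyc /=; elim: m => [|m IH] /=; first by rewrite expr1.
by rewrite IH -exprS.
Qed.

(* [mpow A m] is the power of exponent [m.+1]. *)
Definition mpow A m : mat F X X := iter m (fun B => mcomp A B) A.

(** Induction on the first step: [f1] keeps the first letter and integrates over the others, which
    by base change gives an entry of the preceding power. *)
Lemma mpow_walk A m z x : mpow A m (z, x) =
  @pushf H s F (X ** hpows X m ** X) (X ** X)
    (hpair (hmap_comp (hfst _ _) (hfst _ _)) (hsnd _ _))
    (fun t => walk A t.1.1 t.1.2 t.2) (z, x) :> F.
Proof.
elim: m z x => [|m IH] z x.
  pose j : hmap (X ** X) (X ** hpows X 0 ** X) :=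
    hpair (hpair (hfst X X) (hto_pt _)) (hsnd X X).
  rewrite (@pushf_section H s F _ _ _ j) //; first exact: walk_hinv.
    by case.
  by move=> [[z' []] x'].
pose T := X ** hpows X m.+1 ** X.
pose f1 : hmap T (X ** X ** X) :=
  hpair (hpair (hmap_comp (hfst _ _) (hfst _ _))
    (hmap_comp (hfst X (hpows X m)) (hmap_comp (hsnd _ _) (hfst _ _)))) (hsnd _ _).
pose q' : hmap T (X ** hpows X m ** X) :=
  hpair (hmap_comp (hsnd _ _) (hfst _ _)) (hsnd _ _).
pose q : hmap (X ** X ** X) (X ** X) := hpair (hmap_comp (hsnd _ _) (hfst _ _)) (hsnd _ _).
rewrite -[LHS]/(mcomp A (mpow A m) (z, x)) mat_compE.
rewrite (@eq_pushf_map H s F T (X ** X) _ (hmap_comp (proj13 X X X) f1)) //.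
rewrite -(@pushf_comp H s F T (X ** X ** X) (X ** X)); apply: eq_pushf => -[[z1 y1] x1].
rewrite (@eq_pushf H s F T (X ** X ** X) f1 _
  (fun t => (A ((f1 t).1.1, (f1 t).1.2) : F) * walk A (q' t).1.1 (q' t).1.2 (q' t).2)) //.
rewrite (@pushf_proj H s F T (X ** X ** X) f1 (fun t => walk A (q' t).1.1 (q' t).1.2 (q' t).2)
  (fun t => A (t.1.1, t.1.2))); last first.
  by move=> g [[z2 y2] x2]; apply: (invfunP A g (z2, y2)).
congr (_ * _); rewrite IH.
apply: (@pushf_bc H s F (X ** hpows X m ** X) (X ** X) T (X ** X ** X) _ q q' f1 _ (z1,
  y1, x1)).
  split=> //.
  - move=> [[y2 t] x2] [[z3 y3] x3] /= [-> ->].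
    by exists (z3, (y3, t), x3).
  - by move=> [[z2 [y2 t]] x2] [[z3 [y3 t']] x3] /= [-> -> ->] [->].
exact: walk_hinv.
Qed.

Lemma mtrace_mpow A m : mtrace (mpow A m) = @isum H s F (hpows X m.+1) (@cyc A m).
Proof.
rewrite /mtrace -(isum_pushf s (hfst X (hpows X m) : hmap (hpows X m.+1) X)).
apply: eq_isum => x; rewrite mpow_walk.
pose q : hmap X (X ** X) := hpair (hmap_id X) (hmap_id X).
apply: (@pushf_bc H s F (X ** hpows X m ** X) (X ** X) (hpows X m.+1) X _ q
  (hpair (hmap_id (hpows X m.+1)) (hfst X (hpows X m))) (hfst X (hpows X m)) _ x);
    last exact: walk_hinv.
split=> //.
- by move=> [[z t] x'] x1 /= [-> ->]; exists (x1, t).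
- by move=> [z y] [z' y'] /= [-> ->].
Qed.

(* Cyclic rotation acts on the orbits of [X^p]; the orbits it moves come in
   packets of [p], and it fixes only those of constant words. *)
Lemma mtrace_frobenius A p : p.+1 \in [pchar F] -> mtrace (mpow A p) = mtrace A ^+ p.+1.
Proof.
move=> chp; rewrite mtrace_mpow /isum; set Xp := hpows X p.+1.
pose f (i : 'I_(nor Xp)) := ocl (prot p (orep i)).
have ocl_rot (t : Xp) : ocl (prot p t) = f (ocl t) by apply: ocl_map; rewrite oclK.
have iterf i j : iter j f i = ocl (iter j (prot p) (orep i)).
  by elim: j => [|j IH]; rewrite ?oclK //= IH ocl_rot.
rewrite (@sum_period F p.+1 _ f) //; last first.
- move=> i; have E : ocl (orep (f i)) = ocl (prot p (orep i)) by rewrite oclK.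
  rewrite (hinv_ocl (@cyc_hinv A p) E) cyc_prot; congr (_ * _).
  by rewrite (rsgn_ocl s F E) rsgn_inj //; apply: prot_inj.
- by move=> i; rewrite iterf iter_prot oclK.
(* [h] and [h'] match the orbits of [X] with the orbits of words fixed by rotation. *)
pose h (j : 'I_(nor X)) : 'I_(nor Xp) := ocl (hconst p.+1 (orep j)).
pose h' (i : 'I_(nor Xp)) : 'I_(nor X) := ocl (orep i).1.
have constI : injective (hconst p.+1) by move=> x x' [].
have hK : cancel h h'.
  move=> j; rewrite /h' /h -[RHS]oclK.
  exact: (@ocl_map H Xp X (hfst _ _) _ (pconst p.+1 (orep j))) (oclK _).
have h'K i : f i = i -> h (h' i) = i.
  move=> fi; have /prot_orbit E : ocl (prot p (orep i)) = ocl (orep i) by rewrite oclK.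
  rewrite /h /h' -[RHS]oclK [in RHS]E; apply: (@ocl_map H X Xp (hconst p.+1)).
  by rewrite oclK.
rewrite (reindex_onto h h') /=; last by move=> i /eqP; apply: h'K.
have -> : (mtrace A) ^+ p.+1 = pFrobenius_aut chp (mtrace A) by rewrite pFrobenius_autE.
rewrite /mtrace /isum rmorph_sum; apply: eq_big => [j|j _].
  rewrite hK eqxx andbT; apply/eqP; rewrite /f -[RHS]oclK.
  rewrite /h; apply: etrans (_ : ocl (prot p (hconst p.+1 (orep j))) = _).
    by apply: ocl_map; rewrite oclK.
  rewrite oclK; congr ocl; apply: pseq_inj.
  rewrite pseq_prot (pseq_pconst p.+1 (orep j)) rot1_cons.
  by elim: (p) (orep j) => //= m IH x; rewrite IH.
(* The sign of a constant word is that of its letter, not a power of it; this is consistent because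
   Frobenius fixes images of integers. *)
have E : ocl (orep (h j)) = ocl (hconst p.+1 (orep j)) by rewrite oclK.
rewrite (hinv_ocl (@cyc_hinv A p) E) cyc_pconst (rsgn_ocl s F E) (rsgn_inj s F _ constI).
by rewrite rmorphM /= pFrobenius_autE /rsgn rmorph_int.
Qed.

End Trace.

(** * Von Neumann regularity over every field *)

Section VonNeumann.
Variables (H : permGroup) (olH : oligomorphic H) (s : orbit_sign H).
Hypothesis torsion_free : forall (X : hset H) (x : X) (g : H) n, (0 < n)%N ->
  hact (g ^+ n)%g x = x -> hact g x = x.

Notation "X ** Y" := (fprod olH X Y) (at level 40, left associativity).
Notation mcomp B A := (mat_comp (measure_intr olH _ (sign_measure olH s)) B A).

Section Coordinates.
Variables (X : fhset H) (n : nat) (nE : nor (X ** X) = n.+1).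

(** Repeated powers of exponent [p] bring [A] to [0], while by [mtrace_frobenius] the trace is only
    raised to the same power, and a field has no nilpotents. *)
Lemma mtrace_nil (F : fieldType) (p : nat) (A : mat F X X) : p \in [pchar F] ->
  mxnil (rreg (struct_const s nE) (mcoord nE A)) -> mtrace s A = 0.
Proof.
move=> chp /mxnilE[m]; have p0 := prime_gt0 (pcharf_prime chp).
rewrite -(prednK p0) in chp *; move: p.-1 chp => {p p0} q chp.
have pow (B : mat F X X) : rreg (struct_const s nE) (mcoord nE (mpow olH s B q)) =
    rreg (struct_const s nE) (mcoord nE B) ^+ q.+1.
  elim: (q) => [|j IH]; first by rewrite expr1.
  by rewrite [mpow _ _ _ _]iterS mcoord_comp rreg_mul exprS IH.
have [e] : exists e, (m <= q.+1 ^ e)%N.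
  by exists m; apply/ltnW/ltn_expl; apply: prime_gt1; apply: pcharf_prime chp.
elim: e A m => [|e IH] A m le mE.
  have {}mE : rreg (struct_const s nE) (mcoord nE A) = 0.
    by move: le mE; case: m => [|[|m]] // _; rewrite ?expr0 ?expr1 // => /eqP;
      rewrite oner_eq0.
  have : mcoord nE A = 0.
    by rewrite -(rreg_onel s nE (mcoord nE A)) mE mulmx0.
  move=> /(congr1 (@mat_of_coord H olH X n nE F)); rewrite mcoordK => ->.
  by rewrite /mtrace /isum big1 // => i _; rewrite /= mxE mul0r.
suff : mtrace s A ^+ q.+1 == 0 by rewrite expf_eq0 /= => /eqP.
rewrite -(mtrace_frobenius olH s torsion_free A chp); apply/eqP.
apply: (IH _ (q.+1 ^ e)%N) => //; rewrite pow -exprM -expnS.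
by rewrite -(subnK le) exprD mE mulr0.
Qed.

Lemma nonnil_mul_pchar (F : fieldType) (p : nat) : p \in [pchar F] ->
  nonnil_mul (struct_const s nE) F.
Proof.
move=> chp u u0; have A0 : mat_of_coord nE u != 0.
  by apply: contraNneq u0 => A0; rewrite -(mat_of_coordK nE u) A0 mcoord0.
have [B] := mtrace_nondeg olH s A0; move=> tB; exists (mcoord nE B) => nil.
move/eqP: tB; apply; apply: mtrace_nil chp _.
by rewrite mcoord_comp mat_of_coordK.
Qed.

Lemma nonnil_mul_field (F : fieldType) : nonnil_mul (struct_const s nE) F.
Proof.
have [ch0|] := pselect ([pchar F] =i pred0); last first.
  move=> /existsNP[p chp]; apply: (@nonnil_mul_pchar F p).
  by case E : (p \in [pchar F]) => //; case: chp; rewrite E.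
apply: nonnil_mul_char0 ch0 _ _; first exact: rreg_mul.
apply: gram_det; first exact: rreg_mul.
by apply: (@nonnil_mul_pchar _ 2); apply: pchar_Fp.
Qed.

End Coordinates.

Theorem mat_vonNeumann (F : fieldType) (X : fhset H) (A : mat F X X) :
  exists B : mat F X X, mcomp (mcomp A B) A = A.
Proof.
(* With no orbit on [X ** X] all matrices agree; otherwise the algebra has positive dimension. *)
case E : (nor (X ** X)) => [|n]; last first.
  by apply: (mat_vonNeumann_coord (nE := E)); apply: nonnil_mul_field.
exists A; apply: (@matP H F X X) => y x.
by have := @ocl H (X ** X) (y, x); rewrite E => -[].
Qed.

End VonNeumann.

(** * Karoubi envelopes of von Neumann regular categories *)

Local Open Scope smc_scope.

Section LinearCategory.
Variables (k : fieldType) (C : smcData k) (L : linear_smc C).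
Implicit Types X Y Z : C.

Lemma comp_sum_l X Y Z (f : hom X Y) I (r : seq I) (P : pred I) (g : I -> hom Y Z) :
  (\sum_(i <- r | P i) g i) ∘ f = \sum_(i <- r | P i) (g i ∘ f).
Proof.
have D u v : (u + v) ∘ f = u ∘ f + v ∘ f :> hom X Z.
  by rewrite -[u in LHS]scale1r (comp_linearl L) scale1r.
apply: (big_morph (fun u : hom Y Z => u ∘ f)) => //.
by apply: (addrI (0 ∘ f)); rewrite -D !addr0.
Qed.

Lemma comp_sum_r X Y Z (g : hom Y Z) I (r : seq I) (P : pred I) (f : I -> hom X Y) :
  g ∘ (\sum_(i <- r | P i) f i) = \sum_(i <- r | P i) (g ∘ f i).
Proof.
have D u v : g ∘ (u + v) = g ∘ u + g ∘ v :> hom X Z.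
  by rewrite -[u in LHS]scale1r (comp_linearr L) scale1r.
apply: (big_morph (fun u : hom X Y => g ∘ u)) => //.
by apply: (addrI (g ∘ 0)); rewrite -D !addr0.
Qed.

Lemma comp0l X Y Z (f : hom X Y) : (0 : hom Y Z) ∘ f = 0.
Proof. by have := comp_sum_l f [::] xpredT (fun _ : nat => 0 : hom Y Z); rewrite !big_nil. Qed.

Lemma comp0r X Y Z (g : hom Y Z) : g ∘ (0 : hom X Y) = 0.
Proof. by have := comp_sum_r g [::] xpredT (fun _ : nat => 0 : hom X Y); rewrite !big_nil. Qed.

Lemma compZl X Y Z (a : k) (g : hom Y Z) (f : hom X Y) : (a *: g) ∘ f = a *: (g ∘ f).
Proof. by rewrite -[a *: g]addr0 (comp_linearl L) comp0l addr0. Qed.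

Lemma compZr X Y Z (a : k) (g : hom Y Z) (f : hom X Y) : g ∘ (a *: f) = a *: (g ∘ f).
Proof. by rewrite -[a *: f]addr0 (comp_linearr L) comp0r addr0. Qed.

Lemma compDl X Y Z (g g' : hom Y Z) (f : hom X Y) : (g + g') ∘ f = g ∘ f + g' ∘ f.
Proof. by rewrite -[g in LHS]scale1r (comp_linearl L) scale1r. Qed.

Lemma compDr X Y Z (g : hom Y Z) (f f' : hom X Y) : g ∘ (f + f') = g ∘ f + g ∘ f'.
Proof. by rewrite -[f in LHS]scale1r (comp_linearr L) scale1r. Qed.

Lemma compBl X Y Z (g g' : hom Y Z) (f : hom X Y) : (g - g') ∘ f = g ∘ f - g' ∘ f.
Proof. by rewrite compDl -scaleN1r compZl scaleN1r. Qed.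

Lemma compBr X Y Z (g : hom Y Z) (f f' : hom X Y) : g ∘ (f - f') = g ∘ f - g ∘ f'.
Proof. by rewrite compDr -scaleN1r compZr scaleN1r. Qed.

Lemma is_zero_idm X : is_zero X <-> idm X = 0.
Proof.
split=> [[h _]|X0]; first exact: h.
split=> Y f g; first by rewrite -(comp1m L f) -(comp1m L g) X0 !comp0l.
by rewrite -(compm1 L f) -(compm1 L g) X0 !comp0r.
Qed.

Lemma lunitV_nat X X' (f : hom X X') : lunitV X' ∘ f = (idm 𝟙 ⊠ f) ∘ lunitV X.
Proof.
rewrite -[RHS](comp1m L) -(lunitK L X') -(compA L); congr (_ ∘ _).
by rewrite (compA L) (lunit_nat L) -(compA L) (lunitVK L) (compm1 L).
Qed.

Lemma runitV_nat X X' (f : hom X X') : runitV X' ∘ f = (f ⊠ idm 𝟙) ∘ runitV X.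
Proof.
rewrite -[RHS](comp1m L) -(runitK L X') -(compA L); congr (_ ∘ _).
by rewrite (compA L) (runit_nat L) -(compA L) (runitVK L) (compm1 L).
Qed.

Lemma assocV_nat X X' Y Y' Z Z' (f : hom X X') (g : hom Y Y') (h : hom Z Z') :
  assocV X' Y' Z' ∘ (f ⊠ (g ⊠ h)) = ((f ⊠ g) ⊠ h) ∘ assocV X Y Z.
Proof.
rewrite -[RHS](comp1m L) -(assocK L) -(compA L); congr (_ ∘ _).
by rewrite (compA L) (assoc_nat L) -(compA L) (assocVK L) (compm1 L).
Qed.

(** On morphisms commuting with the idempotents [kcut] respects composition. All structure maps are
    such, by naturality, so the coherence laws of [C] carry over to the envelope. *)
Definition knat (X Y : kob C) (f : hom (kobj X) (kobj Y)) : Prop :=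
  f ∘ kidem X = kidem Y ∘ f.

Lemma khom_inj (X Y : kob C) (f g : khom X Y) : khom_val f = khom_val g -> f = g.
Proof. exact: val_inj. Qed.

Lemma knat_khom (X Y : kob C) (f : khom X Y) : knat (khom_val f).
Proof. by rewrite /knat (khoml L) (khomr L). Qed.

Lemma kcut_khom (X Y : kob C) (f : khom X Y) : kcut L (khom_val f) = f.
Proof. by apply: khom_inj; rewrite /= (khoml L) (khomr L). Qed.

Lemma knat_id (X : kob C) : @knat X X (idm _).
Proof. by rewrite /knat (comp1m L) (compm1 L). Qed.

Lemma kcut_id (X : kob C) : @kcut k C L X X (idm _) = kid X.
Proof. by apply: khom_inj; rewrite /= (compm1 L) kidemP. Qed.

Lemma knat_comp (X Y Z : kob C) (g : hom (kobj Y) (kobj Z)) (f : hom (kobj X) (kobj Y)) :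
  knat g -> knat f -> @knat X Z (g ∘ f).
Proof. by rewrite /knat => gn fn; rewrite -(compA L) fn !(compA L) gn. Qed.

Lemma kcut_comp (X Y Z : kob C) (g : hom (kobj Y) (kobj Z)) (f : hom (kobj X) (kobj Y)) :
  knat g -> kcomp L (kcut L g) (kcut L f) = @kcut k C L X Z (g ∘ f).
Proof.
move=> gn; have h : kidem Z ∘ g ∘ kidem Y = kidem Z ∘ g by rewrite -gn -(compA L) kidemP.
by apply: khom_inj; rewrite /= h !(compA L) h.
Qed.

Lemma knat_tens (X X' Y Y' : kob C) (f : hom (kobj X) (kobj X')) (g : hom (kobj Y) (kobj Y')) :
  knat f -> knat g -> @knat (ktens L X Y) (ktens L X' Y') (f ⊠ g).
Proof. by rewrite /knat /= -!(tensm_comp L) => -> ->. Qed.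

Lemma kcut_tens (X X' Y Y' : kob C) (f : hom (kobj X) (kobj X')) (g : hom (kobj Y) (kobj Y')) :
  ktensm L (kcut L f) (kcut L g) = @kcut k C L (ktens L X Y) (ktens L X' Y') (f ⊠ g).
Proof. by apply: khom_inj; rewrite /= !(tensm_comp L). Qed.

Lemma knat_assoc (X Y Z : kob C) :
  @knat (ktens L (ktens L X Y) Z) (ktens L X (ktens L Y Z)) (assoc _ _ _).
Proof. exact: (assoc_nat L). Qed.

Lemma knat_assocV (X Y Z : kob C) :
  @knat (ktens L X (ktens L Y Z)) (ktens L (ktens L X Y) Z) (assocV _ _ _).
Proof. exact: assocV_nat. Qed.

Lemma knat_lunit (X : kob C) : @knat (ktens L (kunit L) X) X (lunit _).
Proof. exact: (lunit_nat L). Qed.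

Lemma knat_lunitV (X : kob C) : @knat X (ktens L (kunit L) X) (lunitV _).
Proof. exact: lunitV_nat. Qed.

Lemma knat_runit (X : kob C) : @knat (ktens L X (kunit L)) X (runit _).
Proof. exact: (runit_nat L). Qed.

Lemma knat_runitV (X : kob C) : @knat X (ktens L X (kunit L)) (runitV _).
Proof. exact: runitV_nat. Qed.

Lemma knat_swap (X Y : kob C) : @knat (ktens L X Y) (ktens L Y X) (swap _ _).
Proof. exact: (swap_nat L). Qed.

Local Hint Resolve knat_khom knat_id knat_comp knat_tens knat_assoc knat_assocV
  knat_lunit knat_lunitV knat_runit knat_runitV knat_swap : core.

Lemma karoubi_smc : linear_smc (karoubi L).
Proof.
split=> /=.
- by move=> W X Y Z h g f; apply: khom_inj; apply: (compA L).
- by move=> X Y f; apply: khom_inj; apply: (khoml L).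
- by move=> X Y f; apply: khom_inj; apply: (khomr L).
- by move=> X Y Z f a g g'; apply: khom_inj; apply: (comp_linearl L).
- by move=> X Y Z g a f f'; apply: khom_inj; apply: (comp_linearr L).
- by move=> X Y; apply: khom_inj.
- by move=> X X' X'' Y Y' Y'' g f g' f'; apply: khom_inj; apply: (tensm_comp L).
- by move=> X X' Y Y' g a f f'; apply: khom_inj; apply: (tensm_linearl L).
- by move=> X X' Y Y' f a g g'; apply: khom_inj; apply: (tensm_linearr L).
- by move=> X Y Z; rewrite kcut_comp // (assocK L) kcut_id.
- by move=> X Y Z; rewrite kcut_comp // (assocVK L) kcut_id.
- by move=> X; rewrite kcut_comp // (lunitK L) kcut_id.
- by move=> X; rewrite kcut_comp // (lunitVK L) kcut_id.
- by move=> X; rewrite kcut_comp // (runitK L) kcut_id.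
- by move=> X; rewrite kcut_comp // (runitVK L) kcut_id.
- by move=> X Y; rewrite kcut_comp // (swapK L) kcut_id.
- move=> X X' Y Y' Z Z' f g h.
  by rewrite -(kcut_khom f) -(kcut_khom g) -(kcut_khom h) !kcut_tens !kcut_comp
    ?(assoc_nat L) //; auto 6.
- move=> X X' f; rewrite -(kcut_khom f) -kcut_id kcut_tens !kcut_comp //.
  by rewrite (lunit_nat L).
- move=> X X' f; rewrite -(kcut_khom f) -kcut_id kcut_tens !kcut_comp //.
  by rewrite (runit_nat L).
- move=> X X' Y Y' f g; rewrite -(kcut_khom f) -(kcut_khom g) !kcut_tens !kcut_comp //; auto.
  by rewrite (swap_nat L).
- by move=> X Y; rewrite -!kcut_id !kcut_tens kcut_comp ?(triangle L) //; auto.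
- move=> W X Y Z; rewrite -!kcut_id !kcut_tens !kcut_comp ?(pentagon L) //; auto.
- move=> X Y Z; rewrite -!kcut_id !kcut_tens !kcut_comp ?(hexagon L) //; auto.
Qed.

End LinearCategory.

(** * Regular categories with split idempotents *)

Section SemisimpleCategory.
Variables (k : fieldType) (C : smcData k) (L : linear_smc C).
Implicit Types X Y Z S : C.

Hypothesis reg : forall X Y (a : hom X Y), exists b, a ∘ b ∘ a = a.
Hypothesis split_idem : forall X (e : hom X X), e ∘ e = e ->
  exists Y (i : hom Y X) (p : hom X Y), p ∘ i = idm Y /\ i ∘ p = e.
Hypothesis fdim : forall X Y, finite_dim (hom X Y).

Let cA := compA L.
Let c1 := comp1m L.
Let cm1 := compm1 L.

Lemma mono_retract X Y (f : hom X Y) : mono f -> exists g, g ∘ f = idm X.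
Proof.
move=> fm; have [g gE] := reg f; exists g; apply: fm.
by rewrite cA gE cm1.
Qed.

Lemma epi_section X Y (f : hom X Y) : epi f -> exists g, f ∘ g = idm Y.
Proof.
move=> fe; have [g gE] := reg f; exists g; apply: fe.
by rewrite gE c1.
Qed.

Lemma idem_compl X (e : hom X X) : e ∘ e = e -> (idm X - e) ∘ (idm X - e) = idm X - e.
Proof. by move=> ee; rewrite (compBl L) !(compBr L) !c1 cm1 ee subrr subr0. Qed.

(** If [f g f = f], then [g f] is idempotent, and [1 - g f] cuts out the kernel; dually, [1 - f g]
    cuts out the cokernel. *)
Lemma regular_kernel X Y (f : hom X Y) : exists K (i : hom K X), is_kernel f i.
Proof.
have [g fgf] := reg f; have ee : (g ∘ f) ∘ (g ∘ f) = g ∘ f by rewrite -cA (cA f) fgf.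
have [K [i [p [pi ip]]]] := split_idem (idem_compl ee).
exists K, i; split.
  rewrite -[i]cm1 -pi (cA i) ip (compBl L) c1 (compBr L) -!cA.
  by rewrite (cA g) (cA f) (cA f g) fgf subrr.
move=> W u fu; exists (p ∘ u); split.
  by rewrite cA ip (compBl L) c1 -cA fu (comp0r L) subr0.
by move=> v <-; rewrite cA pi c1.
Qed.

Lemma regular_cokernel X Y (f : hom X Y) : exists Q (p : hom Y Q), is_cokernel f p.
Proof.
have [g fgf] := reg f; have ee : (f ∘ g) ∘ (f ∘ g) = f ∘ g by rewrite cA fgf.
have [Q [i [p [pi ip]]]] := split_idem (idem_compl ee).
exists Q, p; split.
  by rewrite -[p]c1 -pi -!cA (cA i) ip (compBl L) c1 fgf subrr (comp0r L).
move=> W u uf; exists (u ∘ i); split.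
  by rewrite -cA ip (compBr L) cm1 cA uf (comp0l L) subr0.
by move=> v <-; rewrite -cA pi cm1.
Qed.

Lemma regular_mono_kernel X Y (f : hom X Y) : mono f -> exists Z (g : hom Y Z), is_kernel g f.
Proof.
move=> /mono_retract[g gf]; exists Y, (idm Y - f ∘ g); split.
  by rewrite (compBl L) c1 -cA gf cm1 subrr.
move=> W u; rewrite (compBl L) c1 => /eqP; rewrite subr_eq0 => /eqP uE.
exists (g ∘ u); split; first by rewrite cA -uE.
by move=> v <-; rewrite cA gf c1.
Qed.

Lemma regular_epi_cokernel X Y (f : hom X Y) : epi f -> exists Z (g : hom Z X),
  is_cokernel g f.
Proof.
move=> /epi_section[g fg]; exists X, (idm X - g ∘ f); split.
  by rewrite (compBr L) cm1 cA fg c1 subrr.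
move=> W u; rewrite (compBr L) cm1 => /eqP; rewrite subr_eq0 => /eqP uE.
exists (u ∘ g); split; first by rewrite -cA -uE.
by move=> v <-; rewrite -cA fg cm1.
Qed.

(** The induction measure used in place of length, not yet known to be finite: orthogonal nonzero
    idempotents are linearly independent, and the bound drops on proper summands. *)
Definition idem_bound X (n : nat) : Prop :=
  forall (I : finType) (e : I -> hom X X), (forall a, e a <> 0) ->
    (forall a b, e a ∘ e b = if a == b then e a else 0) -> (#|I| <= n)%N.

Lemma idem_bound_exists X : exists n, idem_bound X n.
Proof.
have [n [b bP]] := fdim X X; exists n => I e e0 eP; rewrite leqNgt; apply/negP => nI.
have [c cP] := choice (fun a => bP (e a)).
pose M : 'M[k]_(#|I|, n) := \matrix_(i, j) c (enum_val i) j.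
have [i0 [j0 wj0]] : exists i j, kermx M i j != 0.
  have : kermx M != 0.
    rewrite -mxrank_eq0 mxrank_ker -lt0n subn_gt0.
    exact: leq_ltn_trans (rank_leq_col M) nI.
  move/eqP => M0; apply: contrapT => h; apply: M0; apply/matrixP => i j.
  rewrite [RHS]mxE; apply/eqP; apply: contrapT => /negP nz.
  by apply: h; exists i, j.
have : \sum_j kermx M i0 j *: e (enum_val j) = 0.
  have E j : e (enum_val j) = \sum_a M j a *: b a.
    by rewrite cP; apply: eq_bigr => a _; rewrite mxE.
  under eq_bigr => j _ do rewrite E scaler_sumr.
  rewrite exchange_big big1 //= => a _.
  under eq_bigr => j _ do rewrite scalerA.
  rewrite -scaler_suml; have /matrixP/(_ i0 a) := mulmx_ker M.
  by rewrite !mxE => ->; rewrite scale0r.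
(* Composing the relation with one idempotent isolates its coefficient, which was chosen nonzero. *)
move=> /(congr1 (fun u => u ∘ e (enum_val j0))); rewrite (comp0l L) (comp_sum_l L).
rewrite (bigD1 j0) //= big1 => [|j /negbTE nj].
  rewrite addr0 (compZl L) eP eqxx => /eqP; rewrite scaler_eq0 (negbTE wj0) /=.
  by move=> /eqP/e0.
by rewrite (compZl L) eP (inj_eq enum_val_inj) nj scaler0.
Qed.

Lemma idem_bound0 X : idem_bound X 0 -> idm X = 0.
Proof.
move=> h; apply: contrapT => X0; suff : (#|{: unit}| <= 0)%N by rewrite card_unit.
by apply: (h unit (fun=> idm X)) => // [[] []]; rewrite c1.
Qed.

(** A family on [Y] is transported to [X] and enlarged by the nonzero complementary idempotent
    [1 - i p]. *)
Lemma idem_bound_retract X Y (i : hom Y X) (p : hom X Y) n :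
  p ∘ i = idm Y -> i ∘ p <> idm X -> idem_bound X n.+1 -> idem_bound Y n.
Proof.
move=> pi ip h I e e0 eP.
pose e' (a : option I) := if a is Some b then i ∘ e b ∘ p else idm X - i ∘ p.
have qi : (idm X - i ∘ p) ∘ i = 0 by rewrite (compBl L) c1 -cA pi cm1 subrr.
have pq : p ∘ (idm X - i ∘ p) = 0 by rewrite (compBr L) cm1 cA pi c1 subrr.
rewrite -ltnS -card_option; apply: (h _ e').
  move=> [a|] /= ea; last by apply: ip; apply/esym/eqP; rewrite -subr_eq0; apply/eqP.
  apply: (e0 a); rewrite -[e a]c1 -[_ ∘ e a]cm1 -pi.
  transitivity (p ∘ (i ∘ e a ∘ p) ∘ i); first by rewrite !cA.
  by rewrite ea (comp0r L) (comp0l L).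
move=> [a|] [b|] /=.
- rewrite -!cA (cA p i) pi c1 (cA (e a)) eP -[Some a == Some b]/(a == b).
  by case: eqP => _ //; rewrite (comp0l L) (comp0r L).
- by rewrite -!cA pq !(comp0r L).
- by rewrite !cA qi !(comp0l L).
- by rewrite (compBr L) cm1 cA qi (comp0l L) subr0.
Qed.

Lemma simple_summand n X : idem_bound X n -> idm X <> 0 ->
  exists S (i : hom S X) (p : hom X S), simple S /\ p ∘ i = idm S.
Proof.
elim: n X => [|n IH] X Xn X0; first by case: X0; apply: idem_bound0.
have [Xs|Xns] := pselect (simple X); first by exists X, (idm X), (idm X); rewrite c1.
have [Y [i [im [Y0 ini]]]] : exists Y (i : hom Y X), mono i /\ ~ is_zero Y /\ ~ iso i.
  apply: contrapT => h; apply: Xns; split; first by move/(is_zero_idm L).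
  move=> Y i im; have [|Y0] := pselect (is_zero Y); first by left.
  by right; apply: contrapT => ini; apply: h; exists Y, i.
have [p pi] := mono_retract im.
have ip : i ∘ p <> idm X by move=> ip; apply: ini; exists p.
have [||S [j [q [Ss qj]]]] := IH Y.
- exact: idem_bound_retract pi ip Xn.
- by move/(is_zero_idm L).
by exists S, (i ∘ j), (q ∘ p); split=> //; rewrite -cA (cA p) pi c1.
Qed.

Lemma split_summand X S (i : hom S X) (p : hom X S) : p ∘ i = idm S ->
  exists Y (i' : hom Y X) (p' : hom X Y),
    [/\ p' ∘ i' = idm Y, i ∘ p + i' ∘ p' = idm X, p ∘ i' = 0 & p' ∘ i = 0].
Proof.
move=> pi; have ee : (i ∘ p) ∘ (i ∘ p) = i ∘ p by rewrite -cA (cA p) pi c1.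
have [Y [i' [p' [p'i' i'p']]]] := split_idem (idem_compl ee).
exists Y, i', p'; split=> //; first by rewrite i'p' addrC subrK.
  by rewrite -[i']cm1 -p'i' (cA i') i'p' cA (compBr L) cm1 cA pi c1 subrr (comp0l L).
by rewrite -[p']c1 -p'i' -!cA (cA i') i'p' (compBl L) c1 -cA pi cm1 subrr (comp0r L).
Qed.

Lemma semisimple_decomposition n X : idem_bound X n ->
  finite_length X /\
  exists m (S : 'I_m -> C), (forall a, simple (S a)) /\ direct_sum S X.
Proof.
elim: n X => [|n IH] X Xn.
  have X0 := idem_bound0 Xn; split.
    by apply: finite_length0; apply/(is_zero_idm L).
  exists 0, (fun _ => X); split; first by case.
  exists (fun _ => idm X), (fun _ => idm X); split=> [[]|[]|] //.
  by rewrite big_ord0.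
have [X0|X0] := pselect (idm X = 0).
  apply: IH => I e e0 eP; rewrite leqNgt; apply/negP; case: (pickP I) => [a _ _|I0].
    by apply: (e0 a); rewrite -[e a]c1 X0 (comp0l L).
  by rewrite (eq_card0 I0).
have [S [i [p [Ss pi]]]] := simple_summand Xn X0.
have [Y [i' [p' [p'i' ipi'p' pi' p'i]]]] := split_summand pi.
have i'p' : i' ∘ p' <> idm X.
  move=> E; have ip0 : i ∘ p = 0.
    by apply: (addIr (i' ∘ p')); rewrite ipi'p' add0r E.
  apply: Ss.1; apply/(is_zero_idm L).
  by rewrite -pi -[i]cm1 -pi (cA i) ip0 (comp0l L) (comp0r L).
have [Yfl [m [T [Ts [j [q [qj qj0 jq]]]]]]] := IH Y (idem_bound_retract p'i' i'p' Xn).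
split.
  apply: (@finite_lengthS _ _ X Y S i' p) => //.
    split=> // W u pu; exists (p' ∘ u); split.
      by rewrite cA -[RHS]c1 -ipi'p' (compDl L) -(cA i) pu (comp0r L) add0r.
    by move=> v <-; rewrite cA p'i' c1.
  split=> // W u ui; exists (u ∘ i); split.
    by rewrite -cA -[RHS]cm1 -ipi'p' (compDr L) (cA u i') ui (comp0l L) addr0.
  by move=> v <-; rewrite -cA pi cm1.
pose T' (a : option 'I_m) := if a is Some b then T b else S.
pose j' a : hom (T' a) X := if a is Some b then i' ∘ j b else i.
pose q' a : hom X (T' a) := if a is Some b then q b ∘ p' else p.
pose un (a : 'I_m.+1) := unlift ord0 a.
exists m.+1, (fun a => T' (un a)); split.
  by move=> a; case: (un a).
exists (fun a => j' (un a)), (fun a => q' (un a)); split.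
- move=> a; case: (un a) => [b|] //=.
  by rewrite -cA (cA p') p'i' c1 qj.
- move=> a b ab; have : un a != un b.
    apply: contraNneq ab; rewrite /un.
    by case: unliftP => [a' ->|->]; case: unliftP => [b' ->|->] //= [->].
  case: (un a) (un b) => [a'|] [b'|] //= ab'.
  + by rewrite -cA (cA p') p'i' c1 qj0.
  + by rewrite -cA p'i (comp0r L).
  + by rewrite cA pi' (comp0l L).
rewrite big_ord_recl /un unlift_none /= -[RHS]ipi'p'; congr (_ + _).
rewrite -[p' in RHS]c1 -jq (comp_sum_l L) (comp_sum_r L); apply: eq_bigr => a _.
by rewrite liftK /= !cA.
Qed.

Lemma regular_abelian :
  (forall n (S : 'I_n -> C), exists X, direct_sum S X) -> abelian C.
Proof.
move=> sums; split=> // X Y f.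
- exact: regular_kernel.
- exact: regular_cokernel.
- exact: regular_mono_kernel.
- exact: regular_epi_cokernel.
Qed.

End SemisimpleCategory.

(** * From a regular category to its envelope *)

Section KaroubiSemisimple.
Variables (k : fieldType) (C : smcData k) (L : linear_smc C).
Implicit Types X Y Z : C.

Hypothesis regC : forall X (a : hom X X), exists b, a ∘ b ∘ a = a.
Hypothesis fdimC : forall X Y, finite_dim (hom X Y).
Hypothesis sumC : forall n (S : 'I_n -> C), exists X, direct_sum S X.
(* [e'] is the transpose of [e]. *)
Hypothesis dualC : forall X, exists Y (ev : hom (Y ⊗ X) 𝟙) (coev : hom 𝟙 (X ⊗ Y)),
  [/\ runit X ∘ (idm X ⊠ ev) ∘ assoc X Y X ∘ (coev ⊠ idm X) ∘ lunitV X = idm X,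
      lunit Y ∘ (ev ⊠ idm Y) ∘ assocV Y X Y ∘ (idm Y ⊠ coev) ∘ runitV Y = idm Y &
      forall e : hom X X, e ∘ e = e -> exists e' : hom Y Y,
        [/\ e' ∘ e' = e', ev ∘ (e' ⊠ idm X) = ev ∘ (idm Y ⊠ e) &
            (idm X ⊠ e') ∘ coev = (e ⊠ idm Y) ∘ coev]].
Hypothesis end1C : bijective (fun c : k => c *: idm (𝟙 : C)).

Let cA := compA L.
Let c1 := comp1m L.
Let cm1 := compm1 L.

(** Place [a] as an off-diagonal block of an endomorphism of the sum of [X] and [Y], and read off
    the opposite block of its quasi-inverse. *)
Lemma regular_hom X Y (a : hom X Y) : exists b, a ∘ b ∘ a = a.
Proof.
pose S (j : 'I_2) := if val j is 0%N then X else Y.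
have [Z [i [p [pi pi0 _]]]] := sumC S.
pose iX : hom X Z := i ord0; pose iY : hom Y Z := i ord_max.
pose pX : hom Z X := p ord0; pose pY : hom Z Y := p ord_max.
have pX1 : pX ∘ iX = idm X := pi ord0.
have pY1 : pY ∘ iY = idm Y := pi ord_max.
have [b bE] := regC (iY ∘ a ∘ pX); exists (pX ∘ b ∘ iY).
rewrite -[RHS]c1 -[RHS]cm1 -pX1 -pY1.
transitivity (pY ∘ (iY ∘ a ∘ pX) ∘ iX); last by rewrite !cA.
by rewrite -bE !cA pY1 c1 -!cA pX1 cm1.
Qed.

Lemma khom_val_sum (X Y : karoubi L) I (r : seq I) (P : pred I) (f : I -> hom X Y) :
  @khom_val k C X Y (\sum_(a <- r | P a) f a) = \sum_(a <- r | P a) khom_val (f a).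
Proof. by apply: (big_morph (@khom_val k C X Y)). Qed.

Lemma khom_direct_sum n (S : 'I_n -> karoubi L) : exists X : karoubi L, direct_sum S X.
Proof.
have [Z [i [p [pi pi0 ip]]]] := sumC (fun a => kobj (S a)).
pose e := \sum_a i a ∘ kidem (S a) ∘ p a.
have pe a : p a ∘ e = kidem (S a) ∘ p a.
  rewrite /e (comp_sum_r L) (bigD1 a) //= big1 => [|b ab].
    by rewrite !cA pi c1 addr0.
  by rewrite !cA pi0 1?eq_sym // !(comp0l L).
have ei a : e ∘ i a = i a ∘ kidem (S a).
  rewrite /e (comp_sum_l L) (bigD1 a) //= big1 => [|b ab].
    by rewrite -!cA pi cm1 addr0.
  by rewrite -!cA pi0 // !(comp0r L).
have ee : e ∘ e = e.
  rewrite {2}/e (comp_sum_r L); apply: eq_bigr => a _.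
  by rewrite !cA ei -(cA (i a)) kidemP.
pose X : karoubi L := KOb ee.
exists X, (fun a => @kcut k C L (S a) X (i a)), (fun a => @kcut k C L X (S a) (p a)).
have nati a : @knat k C (S a) X (i a) by rewrite /knat ei.
have natp a : @knat k C X (S a) (p a) by rewrite /knat pe.
split.
- by move=> a; rewrite -[LHS]/(kcomp L _ _) (kcut_comp L _ (natp a)) pi (kcut_id L).
- move=> a b ab; rewrite -[LHS]/(kcomp L _ _) (kcut_comp L _ (natp a)) pi0 //.
  by apply: khom_inj; rewrite /= (comp0r L) (comp0l L).
apply: khom_inj; rewrite khom_val_sum /= /e.
apply: eq_bigr => a _; rewrite !cA ei -!cA; congr (_ ∘ _).
by rewrite pe !cA !kidemP.
Qed.

Lemma khom_reg (X Y : karoubi L) (a : hom X Y) : exists b, a ∘ b ∘ a = a.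
Proof.
have [b bE] := regular_hom (khom_val a); exists (@kcut k C L Y X b).
apply: khom_inj; rewrite /= !cA (khomr L a) -!cA (khoml L a).
by rewrite cA bE.
Qed.

Lemma khom_split (X : karoubi L) (e : hom X X) : e ∘ e = e ->
  exists (Y : karoubi L) (i : hom Y X) (p : hom X Y), p ∘ i = idm Y /\ i ∘ p = e.
Proof.
move=> /(congr1 (@khom_val k C X X)) /= ee.
have iP : khom_val e \in @khom_pred k C (KOb ee) X.
  by apply/eqP; rewrite /= (khoml L e) ee.
have pP : khom_val e \in @khom_pred k C X (KOb ee).
  by apply/eqP; rewrite /= ee (khomr L e).
exists (KOb ee : karoubi L), (KHom iP), (KHom pP).
by split; apply: khom_inj.
Qed.

Lemma khom_fdim (X Y : karoubi L) : finite_dim (hom X Y).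
Proof.
have [n [b bP]] := fdimC (kobj X) (kobj Y).
exists n, (fun a => @kcut k C L X Y (b a)) => f; have [c cE] := bP (khom_val f).
exists c; apply: khom_inj; rewrite khom_val_sum /=.
rewrite -[LHS](khomP f) cE (comp_sum_r L) (comp_sum_l L); apply: eq_bigr => a _.
by rewrite (compZr L) (compZl L).
Qed.

Let T1 := tensm1 L.
Let TC X X' X'' Y Y' Y'' := @tensm_comp k C L X X' X'' Y Y' Y''.

(** Sliding along the strings, the [e] on the coevaluation leaves through [runit] at the target, and
    the [e] on the evaluation through [lunitV] at the source. *)
Lemma zigzag_l X Y (ev : hom (Y ⊗ X) 𝟙) (coev : hom 𝟙 (X ⊗ Y)) (e : hom X X) :
  runit X ∘ (idm X ⊠ (ev ∘ (idm Y ⊠ e))) ∘ assoc X Y X ∘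
    (((e ⊠ idm Y) ∘ coev) ⊠ idm X) ∘ lunitV X =
  e ∘ (runit X ∘ (idm X ⊠ ev) ∘ assoc X Y X ∘ (coev ⊠ idm X) ∘ lunitV X) ∘ e.
Proof.
have E1 : idm X ⊠ (ev ∘ (idm Y ⊠ e)) = (idm X ⊠ ev) ∘ (idm X ⊠ (idm Y ⊠ e)).
  by rewrite -TC c1.
have E2 : ((e ⊠ idm Y) ∘ coev) ⊠ idm X = ((e ⊠ idm Y) ⊠ idm X) ∘ (coev ⊠ idm X).
  by rewrite -TC c1.
have E3 : ((idm X ⊠ idm Y) ⊠ e) ∘ ((e ⊠ idm Y) ⊠ idm X) =
    ((e ⊠ idm Y) ⊠ idm X) ∘ ((idm X ⊠ idm Y) ⊠ e).
  by rewrite -!TC !c1 !cm1.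
have E4 : ((idm X ⊠ idm Y) ⊠ e) ∘ (coev ⊠ idm X) = (coev ⊠ idm X) ∘ (idm 𝟙 ⊠ e).
  by rewrite -!TC T1 !c1 !cm1.
have E5 : (idm X ⊠ ev) ∘ (e ⊠ (idm Y ⊠ idm X)) = (e ⊠ idm 𝟙) ∘ (idm X ⊠ ev).
  by rewrite -!TC T1 !c1 !cm1.
rewrite E1 E2 !cA -(cA _ (idm X ⊠ (idm Y ⊠ e))) -(assoc_nat L) !cA.
rewrite -(cA _ ((idm X ⊠ idm Y) ⊠ e)) E3 !cA -(cA _ (assoc X Y X)) (assoc_nat L) !cA.
rewrite -(cA _ (idm X ⊠ ev)) E5 !cA (runit_nat L).
rewrite -(cA _ ((idm X ⊠ idm Y) ⊠ e)) E4 !cA -(cA _ (idm 𝟙 ⊠ e)).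
by rewrite -(lunitV_nat L) !cA.
Qed.

Lemma zigzag_r X Y (ev : hom (Y ⊗ X) 𝟙) (coev : hom 𝟙 (X ⊗ Y)) (e : hom Y Y) :
  lunit Y ∘ ((ev ∘ (e ⊠ idm X)) ⊠ idm Y) ∘ assocV Y X Y ∘
    (idm Y ⊠ ((idm X ⊠ e) ∘ coev)) ∘ runitV Y =
  e ∘ (lunit Y ∘ (ev ⊠ idm Y) ∘ assocV Y X Y ∘ (idm Y ⊠ coev) ∘ runitV Y) ∘ e.
Proof.
have E1 : (ev ∘ (e ⊠ idm X)) ⊠ idm Y = (ev ⊠ idm Y) ∘ ((e ⊠ idm X) ⊠ idm Y).
  by rewrite -TC c1.
have E2 : idm Y ⊠ ((idm X ⊠ e) ∘ coev) = (idm Y ⊠ (idm X ⊠ e)) ∘ (idm Y ⊠ coev).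
  by rewrite -TC c1.
have E3 : ((e ⊠ idm X) ⊠ idm Y) ∘ ((idm Y ⊠ idm X) ⊠ e) =
    ((idm Y ⊠ idm X) ⊠ e) ∘ ((e ⊠ idm X) ⊠ idm Y).
  by rewrite -!TC !c1 !cm1.
have E4 : (e ⊠ (idm X ⊠ idm Y)) ∘ (idm Y ⊠ coev) = (idm Y ⊠ coev) ∘ (e ⊠ idm 𝟙).
  by rewrite -!TC T1 !c1 !cm1.
have E5 : (ev ⊠ idm Y) ∘ ((idm Y ⊠ idm X) ⊠ e) = (idm 𝟙 ⊠ e) ∘ (ev ⊠ idm Y).
  by rewrite -!TC T1 !c1 !cm1.
rewrite E1 E2 !cA -(cA _ (assocV Y X Y)) (assocV_nat L) !cA.
rewrite -(cA _ ((e ⊠ idm X) ⊠ idm Y)) E3 !cA -(cA _ (ev ⊠ idm Y)) E5 !cA (lunit_nat L).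
rewrite -(cA _ ((e ⊠ idm X) ⊠ idm Y)) -(assocV_nat L) !cA.
rewrite -(cA _ (e ⊠ (idm X ⊠ idm Y))) E4 !cA -(cA _ (e ⊠ idm 𝟙)).
by rewrite -(runitV_nat L) !cA.
Qed.

(** The dual of the summand cut out by [e] is cut out by [e']. As [e'] is adjoint to [e],
    compressing evaluation and coevaluation on both sides is the same as on one side, the form that
    [zigzag_l] and [zigzag_r] handle. *)
Lemma khom_rigid (X : karoubi L) : rigid X.
Proof.
case: X => X e ee; have [Y [ev [coev [z1 z2 tr]]]] := dualC X.
have [e' [e'e' evE coevE]] := tr e ee.
pose KX : kob C := KOb ee; pose KY : kob C := KOb e'e'.
have ev_l : ev ∘ (e' ⊠ e) = ev ∘ (idm Y ⊠ e).
  rewrite -[e' in LHS]cm1 -[e in LHS]c1 TC cA evE -cA -TC c1 ee //.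
have ev_r : ev ∘ (e' ⊠ e) = ev ∘ (e' ⊠ idm X).
  by rewrite -[e' in LHS]c1 -[e in LHS]cm1 TC cA -evE -cA -TC c1 e'e'.
have coev_l : (e ⊠ e') ∘ coev = (e ⊠ idm Y) ∘ coev.
  by rewrite -[e in LHS]cm1 -[e' in LHS]c1 TC -cA coevE cA -TC ee c1.
have coev_r : (e ⊠ e') ∘ coev = (idm X ⊠ e') ∘ coev.
  by rewrite -[e in LHS]c1 -[e' in LHS]cm1 TC -cA -coevE cA -TC e'e' c1.
pose f := @kcut k C L (ktens L KY KX) (kunit L) ev.
pose g := @kcut k C L (kunit L) (ktens L KX KY) coev.
have fE : khom_val f = ev ∘ (e' ⊠ e) by rewrite /= c1.
have gE : khom_val g = (e ⊠ e') ∘ coev by rewrite /= cm1.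
have nat_f : knat (khom_val f) := knat_khom L f.
have nat_g : knat (khom_val g) := knat_khom L g.
have natid (Z : kob C) : @knat k C Z Z (idm _) := knat_id L Z.
have natC := @knat_comp k C L; have natT := @knat_tens k C L.
have [nr nl] := (knat_runit L, knat_lunit L).
have [na nV] := (knat_assoc L, knat_assocV L).
exists KY, f, g; split.
  transitivity (kcomp L (kcomp L (kcomp L (kcomp L (@kcut k C L (ktens L KX (kunit L))
    KX (runit X))
    (ktensm L (kid KX) f)) (@kcut k C L (ktens L (ktens L KX KY) KX)
    (ktens L KX (ktens L KY KX)) (assoc X Y X))) (ktensm L g (kid KX)))
    (@kcut k C L KX (ktens L (kunit L) KX) (lunitV X))); first by [].
  rewrite -(kcut_khom L f) -(kcut_khom L g) -!(kcut_id L) !(kcut_tens L) !(kcut_comp L);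
    auto 8.
  by rewrite fE gE ev_l coev_l (zigzag_l ev coev e) z1 cm1; apply: khom_inj; rewrite /= !ee.
transitivity (kcomp L (kcomp L (kcomp L (kcomp L (@kcut k C L (ktens L (kunit L) KY) KY
  (lunit Y))
  (ktensm L f (kid KY))) (@kcut k C L (ktens L KY (ktens L KX KY))
  (ktens L (ktens L KY KX) KY) (assocV Y X Y))) (ktensm L (kid KY) g))
  (@kcut k C L KY (ktens L KY (kunit L)) (runitV Y))); first by [].
rewrite -(kcut_khom L f) -(kcut_khom L g) -!(kcut_id L) !(kcut_tens L) !(kcut_comp L); auto 8.
by rewrite fE gE ev_r coev_r (zigzag_r ev coev e') z2 cm1; apply: khom_inj; rewrite /= !e'e'.
Qed.

Lemma khom_end1 : bijective (fun c : k => c *: idm (𝟙 : karoubi L)).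
Proof.
have [g gK Kg] := end1C; exists (fun f => g (@khom_val k C (kunit L) (kunit L) f)).
  by move=> c; apply: gK.
by move=> f; apply: khom_inj; apply: Kg.
Qed.

Theorem karoubi_semisimple : pre_tannakian (karoubi L) /\ semisimple (karoubi L).
Proof.
have dec (X : karoubi L) := idem_bound_exists (karoubi_smc L) khom_fdim X.
have ss (X : karoubi L) : finite_length X /\
    exists m (S : 'I_m -> karoubi L), (forall a, simple (S a)) /\ direct_sum S X.
  have [n Xn] := dec X.
  exact: (@semisimple_decomposition _ _ (karoubi_smc L) khom_reg khom_split _ _ Xn).
split; last by move=> X; exact: (ss X).2.
split.
- exact: karoubi_smc.
- exact: (regular_abelian (karoubi_smc L) khom_reg khom_split khom_direct_sum).
- by move=> X; exact: (ss X).1.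
- exact: khom_fdim.
- exact: khom_rigid.
- exact: khom_end1.
Qed.

End KaroubiSemisimple.

Theorem perm_semisimple (H : permGroup) (olH : oligomorphic H) (s : orbit_sign H)
    (k : fieldType) (L : linear_smc (perm olH (measure_intr olH k (sign_measure olH s)))) :
  (forall (X : hset H) (x : X) (g : H) n, (0 < n)%N ->
    hact (g ^+ n)%g x = x -> hact g x = x) ->
  pre_tannakian (karoubi L) /\ semisimple (karoubi L).
Proof.
move=> tf; apply: karoubi_semisimple.
- exact: mat_vonNeumann.
- exact: perm_finite_dim.
- exact: perm_direct_sum.
- move=> X; exists X, (mat_ev olH k X), (mat_coev olH k X); split.
  + exact: mat_zigzag_l.
  + exact: mat_zigzag_r.
  move=> e ee; exists (mat_tr olH e); split.
  + by rewrite -[LHS](mat_tr_comp olH s e e) [X in mat_tr _ X]ee.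
  + exact: mat_ev_tr.
  + exact: mat_coev_tr.
exists (fun A : mat k (fpt H) (fpt H) => A (tt, tt)) => [c|A].
  by rewrite -[LHS]/(c * (asbool _)%:R) asboolT // mulr1.
apply: (@matP H k (fpt H) (fpt H)) => -[] [].
by rewrite -[LHS]/((A _ : k) * (asbool _)%:R) asboolT // mulr1.
Qed.

Theorem corollary1p4 :
  exists mu : measure GwrG int,
    regular mu /\
    forall k : fieldType,
      exists L : linear_smc
          (perm oligomorphic_GwrG (measure_intr oligomorphic_GwrG k mu)),
        pre_tannakian (karoubi L) /\ semisimple (karoubi L).
Proof.
exists (sign_measure oligomorphic_GwrG wreath_sign); split.
  exact: sign_measure_regular.
move=> k; exists (perm_smc _ _ k); apply: perm_semisimple.
exact: hact_torsion_free.
Qed.
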